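(* Consider the class of equations $u_t = x^2u_{xx}+f(x)u_y$ with $f$ an arbitrary nonconstant smooth function of $x$. Every equation of this class that admits a Lie symmetry algebra $A^{max}$ properly extending the kernel algebra $A^{ker}$ (in the sense given in the context) is reduced, by an equivalence transformation from the group $G^{equiv}$ (given in the context), to one of the following five canonical equations $u_t=x^2u_{xx}+f(x)u_y$. For each of them the finite-dimensional part of the maximal Lie invariance algebra has the basis listed. (1) $f(x)=x$: $\ \partial_t,\ \partial_y,\ u\partial_u,\ x\partial_x+y\partial_y,\ xy\partial_x+\tfrac12y^2\partial_y+\tfrac12xu\partial_u$. (2) $f(x)=\ln^n x$ with $n$ a real constant, $n\neq -2,0,1$: $\ \partial_t,\ \partial_y,\ u\partial_u,\ t\partial_t+\tfrac12x\ln x\,\partial_x+\tfrac{n+2}{2}y\partial_y+\tfrac14(\ln x-t)u\partial_u$. (3) $f(x)=\ln x$: $\ \partial_t,\ \partial_y,\ u\partial_u,\ x\partial_x-t\partial_y$, $tx\partial_x-\tfrac12t^2\partial_y+\tfrac12(t-\ln x)u\partial_u$, $t^2x\partial_x-\tfrac13t^3\partial_y-\left(t\ln x+y-\tfrac12t^2\right)u\partial_u$, $t\partial_t+\tfrac12x\ln x\,\partial_x+\tfrac32y\partial_y+\tfrac14(\ln x-t)u\partial_u$, $t^2\partial_t+(t\ln x-3y)x\partial_x+3ty\partial_y-\left(\ln^2x-\tfrac12t\ln x+\tfrac14t^2+2t+\tfrac32y\right)u\partial_u$. (4) $f(x)=\ln^{-2}x$: $\ \partial_t,\ \partial_y,\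 u\partial_u$, $t\partial_t+\tfrac12x\ln x\,\partial_x+\tfrac14(\ln x-t)u\partial_u$, $t^2\partial_t+tx\ln x\,\partial_x-\tfrac14\left(\ln^2x-2t\ln x+t^2+2t\right)u\partial_u$. (5) $f(x)=\ln\ln x$: $\ \partial_t,\ \partial_y,\ u\partial_u,\ t\partial_t+\tfrac12x\ln x\,\partial_x+\left(y-\tfrac12t\right)\partial_y+\tfrac14(\ln x-t)u\partial_u$.
   Context: Setting: $u=u(t,x,y)$ is a real function of three real variables, subscripts denote partial derivatives, and $f$ is a nonconstant smooth function of $x$. All considerations are local, on domains where the expressions involved (real powers, logarithms) are defined; $\ln^n x$ means $(\ln x)^n$. Lie symmetries: a Lie symmetry operator of the equation $u_t=x^2u_{xx}+f(x)u_y$ is a vector field $X=\xi^0\partial_t+\xi^1\partial_x+\xi^2\partial_y+\eta\partial_u$ with smooth coefficients depending on $(t,x,y,u)$ such that $\tilde X(u_t-x^2u_{xx}-f(x)u_y)=0$ whenever $u_t=x^2u_{xx}+f(x)u_y$, where $\tilde X$ is the second prolongation of $X$. The maximal Lie invariance algebra of the equation is the Lie algebra of all its Lie symmetry operators. It always contains the operators $\beta(t,x,y)\partial_u$, where $\beta$ is an arbitrary solution of the same equation (superposition principle). These are disregarded: ''the finite-dimensional part of the maximal Lie invariance algebra has basis $X_1,\dots,X_k$'' means that the maximal Lie invariance algebra is the direct sum (as a vector space) of the linear span of the linearly independent operators $X_1,\dots,X_k$ and the space of all operators $\beta(t,x,y)\partial_u$ with $\beta$ a solution of the equation. Kernel algebra: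 $A^{ker}$ is the algebra of operators that are Lie symmetries of $u_t=x^2u_{xx}+f(x)u_y$ for every $f$; it is spanned by $\partial_t$, $\partial_y$, $u\partial_u$ and $\beta(t,x)\partial_u$ with $\beta_t=x^2\beta_{xx}$. An equation of the class admits an algebra $A^{max}$ properly extending $A^{ker}$ if, disregarding the operators $\beta(t,x,y)\partial_u$ with $\beta$ a solution of the equation, its Lie symmetry algebra has dimension larger than that of $\langle\partial_t,\partial_y,u\partial_u\rangle$; that is, it has a Lie symmetry operator not of the form $C_1\partial_t+C_2\partial_y+C_3u\partial_u+\beta(t,x,y)\partial_u$ with constants $C_1,C_2,C_3$. Equivalence group: $G^{equiv}$ consists of the transformations $\bar t=\epsilon_1^2t+\epsilon_2$, $\bar x=\epsilon_3x^{\epsilon_1}$, $\bar y=\epsilon_4t+\epsilon_5y+\epsilon_6$, $\bar u=\epsilon_7e^{(1-\epsilon_1^2)t/4}x^{(\epsilon_1-1)/2}u+\varphi(t,x)$, $\bar f=\epsilon_1^{-2}(\epsilon_5f-\epsilon_4)$, where $\epsilon_1,\dots,\epsilon_7$ are arbitrary constants with $\epsilon_1\epsilon_3\epsilon_5\epsilon_7\ne0$ and $\varphi(t,x)$ is an arbitrary solution of $\varphi_t=x^2\varphi_{xx}+(1-\epsilon_1)x\varphi_x$. Such a transformation maps the equation with $f$ to the equation $\bar u_{\bar t}=\bar x^2\bar u_{\bar x\bar x}+\bar f(\bar x)\bar u_{\bar y}$. *)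

(* Defs.v *)
From Stdlib Require Export Reals ZArith List.
From Coquelicot Require Export Coquelicot.
Export ListNotations.
Open Scope R_scope.

(** * Domains and smooth functions of (t,x,y,u) *)

Definition fun4 := R -> R -> R -> R -> R.

Definition open_interval (J : R -> Prop) : Prop :=
  open J /\ (exists a, J a) /\
  (forall a b c, J a -> J c -> a <= b <= c -> J b).

Record box := Box { bt : R -> Prop; bx : R -> Prop; by_ : R -> Prop; bu : R -> Prop }.

Definition in_box (B : box) (t x y u : R) : Prop :=
  bt B t /\ bx B x /\ by_ B y /\ bu B u.

(* Arbitrary open intervals, bounded or not.  The half-line x > 0 is the common
   domain of the powers [x^e1] of the equivalence group and of the logarithms. *)
Definition domain (B : box) : Prop :=
  open_interval (bt B) /\ open_interval (bx B) /\
  open_interval (by_ B) /\ open_interval (bu B) /\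
  (forall x, bx B x -> 0 < x).

Inductive var := Vt | Vx | Vy | Vu.

Definition pd (v : var) (F : fun4) : fun4 := fun t x y u =>
  match v with
  | Vt => Derive (fun s => F s x y u) t
  | Vx => Derive (fun s => F t s y u) x
  | Vy => Derive (fun s => F t x s u) y
  | Vu => Derive (fun s => F t x y s) u
  end.

Definition ex_pd (v : var) (F : fun4) (t x y u : R) : Prop :=
  match v with
  | Vt => ex_derive (fun s => F s x y u) t
  | Vx => ex_derive (fun s => F t s y u) x
  | Vy => ex_derive (fun s => F t x s u) y
  | Vu => ex_derive (fun s => F t x y s) u
  end.

Definition pds (l : list var) (F : fun4) : fun4 := fold_right pd F l.

(* C^infinity on the box: all iterated partial derivatives, in every order of
   differentiation, exist and are jointly continuous. *)
Definition smooth (B : box) (F : fun4) : Prop :=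
  forall (l : list var) (t x y u : R), in_box B t x y u ->
    continuous (fun p : R * R * R * R =>
                  let '(t', x', y', u') := p in pds l F t' x' y' u')
               (t, x, y, u)
    /\ (forall v, ex_pd v (pds l F) t x y u).

(** * Jet space of order two and prolongation *)

Inductive ivar := It | Ix | Iy.

Inductive jvar :=
  | J_t | J_x | J_y | J_u
  | J_ut | J_ux | J_uy
  | J_utt | J_utx | J_uty | J_uxx | J_uxy | J_uyy.

Definition jvar_eq_dec (a b : jvar) : {a = b} + {a <> b}.
Proof. decide equality. Defined.

Definition jet := jvar -> R.

Definition base (i : ivar) : jvar :=
  match i with It => J_t | Ix => J_x | Iy => J_y end.

Definition first (i : ivar) : jvar :=
  match i with It => J_ut | Ix => J_ux | Iy => J_uy end.

Definition second (i k : ivar) : jvar :=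
  match i, k with
  | It, It => J_utt
  | It, Ix | Ix, It => J_utx
  | It, Iy | Iy, It => J_uty
  | Ix, Ix => J_uxx
  | Ix, Iy | Iy, Ix => J_uxy
  | Iy, Iy => J_uyy
  end.

Definition upd (j : jet) (c : jvar) (s : R) : jet :=
  fun c' => if jvar_eq_dec c c' then s else j c'.

Definition jd (c : jvar) (F : jet -> R) : jet -> R :=
  fun j => Derive (fun s => F (upd j c s)) (j c).

Definition sum3 (a : ivar -> R) : R := a It + a Ix + a Iy.

(* The total derivative D_i, for functions of the jets of order at most one. *)
Definition total (i : ivar) (F : jet -> R) : jet -> R := fun j =>
  jd (base i) F j + j (first i) * jd J_u F j
  + sum3 (fun k => j (second i k) * jd (first k) F j).

Definition on_jet (F : fun4) : jet -> R :=
  fun j => F (j J_t) (j J_x) (j J_y) (j J_u).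

Record vfield := VF { xi0 : fun4; xi1 : fun4; xi2 : fun4; eta : fun4 }.

Definition xi (X : vfield) (i : ivar) : fun4 :=
  match i with It => xi0 X | Ix => xi1 X | Iy => xi2 X end.

(* eta^i = D_i eta - sum_k u_k D_i xi^k *)
Definition eta1 (X : vfield) (i : ivar) : jet -> R := fun j =>
  total i (on_jet (eta X)) j
  - sum3 (fun k => j (first k) * total i (on_jet (xi X k)) j).

(* eta^{il} = D_l eta^i - sum_k u_{ik} D_l xi^k *)
Definition eta2 (X : vfield) (i l : ivar) : jet -> R := fun j =>
  total l (eta1 X i) j
  - sum3 (fun k => j (second i k) * total l (on_jet (xi X k)) j).

Definition prolong2 (X : vfield) (F : jet -> R) : jet -> R := fun j =>
  sum3 (fun i => on_jet (xi X i) j * jd (base i) F j)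
  + on_jet (eta X) j * jd J_u F j
  + sum3 (fun i => eta1 X i j * jd (first i) F j)
  + eta2 X It It j * jd J_utt F j
  + eta2 X It Ix j * jd J_utx F j
  + eta2 X It Iy j * jd J_uty F j
  + eta2 X Ix Ix j * jd J_uxx F j
  + eta2 X Ix Iy j * jd J_uxy F j
  + eta2 X Iy Iy j * jd J_uyy F j.

(** * The class u_t = x^2 u_xx + f(x) u_y *)

Definition Delta (f : R -> R) : jet -> R := fun j =>
  j J_ut - (j J_x) ^ 2 * j J_uxx - f (j J_x) * j J_uy.

Definition smooth_nonconstant (B : box) (f : R -> R) : Prop :=
  (forall n x, bx B x -> ex_derive_n f n x) /\
  (exists x1 x2, bx B x1 /\ bx B x2 /\ f x1 <> f x2).

Definition vf_smooth (B : box) (X : vfield) : Prop :=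
  smooth B (xi0 X) /\ smooth B (xi1 X) /\ smooth B (xi2 X) /\ smooth B (eta X).

Definition lie_symmetry (B : box) (f : R -> R) (X : vfield) : Prop :=
  vf_smooth B X /\
  (forall j : jet, in_box B (j J_t) (j J_x) (j J_y) (j J_u) ->
     Delta f j = 0 -> prolong2 X (Delta f) j = 0).

Definition solution (B : box) (f : R -> R) (beta : R -> R -> R -> R) : Prop :=
  smooth B (fun t x y _ => beta t x y) /\
  (forall t x y, bt B t -> bx B x -> by_ B y ->
     Derive (fun s => beta s x y) t
     = x ^ 2 * Derive_n (fun s => beta t s y) 2 x
       + f x * Derive (fun s => beta t x s) y).

Definition vf_eq (B : box) (X Y : vfield) : Prop :=
  forall t x y u, in_box B t x y u ->
    xi0 X t x y u = xi0 Y t x y u /\ xi1 X t x y u = xi1 Y t x y u /\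
    xi2 X t x y u = xi2 Y t x y u /\ eta X t x y u = eta Y t x y u.

Definition vf_zero : vfield :=
  VF (fun _ _ _ _ => 0) (fun _ _ _ _ => 0) (fun _ _ _ _ => 0) (fun _ _ _ _ => 0).

Definition vf_add (X Y : vfield) : vfield :=
  VF (fun t x y u => xi0 X t x y u + xi0 Y t x y u)
     (fun t x y u => xi1 X t x y u + xi1 Y t x y u)
     (fun t x y u => xi2 X t x y u + xi2 Y t x y u)
     (fun t x y u => eta X t x y u + eta Y t x y u).

Definition vf_scale (c : R) (X : vfield) : vfield :=
  VF (fun t x y u => c * xi0 X t x y u)
     (fun t x y u => c * xi1 X t x y u)
     (fun t x y u => c * xi2 X t x y u)
     (fun t x y u => c * eta X t x y u).

(* [c] and [L] are always required to have the same length. *)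
Definition lincomb (c : list R) (L : list vfield) : vfield :=
  fold_right (fun p V => vf_add (vf_scale (fst p) (snd p)) V) vf_zero (combine c L).

Definition vf_beta (beta : R -> R -> R -> R) : vfield :=
  VF (fun _ _ _ _ => 0) (fun _ _ _ _ => 0) (fun _ _ _ _ => 0)
     (fun t x y _ => beta t x y).

Definition lin_independent (B : box) (L : list vfield) : Prop :=
  forall c, length c = length L -> vf_eq B (lincomb c L) vf_zero ->
    List.Forall (fun a => a = 0) c.

(* The Lie symmetry operators form the direct sum of the span of the linearly
   independent family L and the space of all beta(t,x,y) d_u, beta a solution. *)
Definition finite_part_basis (B : box) (f : R -> R) (L : list vfield) : Prop :=
  lin_independent B L /\
  (forall X, lie_symmetry B f X <->
     exists c beta, length c = length L /\ solution B f beta /\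
       vf_eq B X (vf_add (lincomb c L) (vf_beta beta))) /\
  (forall c beta, length c = length L -> solution B f beta ->
     vf_eq B (lincomb c L) (vf_beta beta) -> vf_eq B (lincomb c L) vf_zero).

Definition op_t : vfield :=
  VF (fun _ _ _ _ => 1) (fun _ _ _ _ => 0) (fun _ _ _ _ => 0) (fun _ _ _ _ => 0).
Definition op_y : vfield :=
  VF (fun _ _ _ _ => 0) (fun _ _ _ _ => 0) (fun _ _ _ _ => 1) (fun _ _ _ _ => 0).
Definition op_u : vfield :=
  VF (fun _ _ _ _ => 0) (fun _ _ _ _ => 0) (fun _ _ _ _ => 0) (fun _ _ _ u => u).

Definition admits_proper_extension (B : box) (f : R -> R) : Prop :=
  exists X, lie_symmetry B f X /\
    ~ (exists C1 C2 C3 beta, solution B f beta /\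
         vf_eq B X (vf_add (lincomb [C1; C2; C3] [op_t; op_y; op_u])
                           (vf_beta beta))).

(** * The equivalence group *)

Record equiv_transf := Equiv
  { e1 : R; e2 : R; e3 : R; e4 : R; e5 : R; e6 : R; e7 : R; phi : R -> R -> R }.

Definition in_Gequiv (B : box) (g : equiv_transf) : Prop :=
  e1 g * e3 g * e5 g * e7 g <> 0 /\
  smooth B (fun t x _ _ => phi g t x) /\
  (forall t x, bt B t -> bx B x ->
     Derive (fun s => phi g s x) t
     = x ^ 2 * Derive_n (fun s => phi g t s) 2 x
       + (1 - e1 g) * x * Derive (fun s => phi g t s) x).

(* Equivalence transformations act on the space with coordinates (t,x,y,u,f). *)
Definition equiv_act (g : equiv_transf) (p : R * R * R * R * R) : R * R * R * R * R :=
  let '(t, x, y, u, f) := p in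
  ( e1 g ^ 2 * t + e2 g,
    e3 g * Rpower x (e1 g),
    e4 g * t + e5 g * y + e6 g,
    e7 g * exp ((1 - e1 g ^ 2) * t / 4) * Rpower x ((e1 g - 1) / 2) * u + phi g t x,
    / (e1 g ^ 2) * (e5 g * f - e4 g) ).

(* g maps the equation with coefficient f on B to the equation with
   coefficient h, where h is considered on the set D. *)
Definition maps_equation (B : box) (g : equiv_transf) (f h : R -> R) (D : R -> Prop)
  : Prop :=
  forall t x y u, in_box B t x y u ->
    let '(t', x', y', u', f') := equiv_act g (t, x, y, u, f x) in
    D x' /\ f' = h x'.

(** * The canonical equations *)

(* Real power a^r where it is meaningful: any r for a > 0, integer r for a < 0,
   nonnegative integer r for a = 0.  [Rpower a r] alone is only correct for a > 0. *)
Definition rpow_dom (a r : R) : Prop :=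
  0 < a \/ (exists k : Z, r = IZR k /\ (a <> 0 \/ (0 <= k)%Z)).

Definition rpow (a r : R) : R :=
  if Rlt_dec 0 a then Rpower a r else powerRZ a (Int_part r).

(* [canonical h D L]: coefficient h, the set D of those x > 0 where h(x) is
   defined, and the basis L of the finite-dimensional part of the algebra. *)
Inductive canonical : (R -> R) -> (R -> Prop) -> list vfield -> Prop :=
| canonical_x :
    canonical (fun x => x) (fun x => 0 < x)
      [ op_t; op_y; op_u;
        VF (fun t x y u => 0) (fun t x y u => x) (fun t x y u => y)
           (fun t x y u => 0);
        VF (fun t x y u => 0) (fun t x y u => x * y) (fun t x y u => / 2 * y ^ 2)
           (fun t x y u => / 2 * x * u) ]
| canonical_ln_pow (n : R) :
    n <> -2 -> n <> 0 -> n <> 1 ->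
    canonical (fun x => rpow (ln x) n) (fun x => 0 < x /\ rpow_dom (ln x) n)
      [ op_t; op_y; op_u;
        VF (fun t x y u => t) (fun t x y u => / 2 * x * ln x)
           (fun t x y u => (n + 2) / 2 * y)
           (fun t x y u => / 4 * (ln x - t) * u) ]
| canonical_ln :
    canonical (fun x => ln x) (fun x => 0 < x)
      [ op_t; op_y; op_u;
        VF (fun t x y u => 0) (fun t x y u => x) (fun t x y u => - t)
           (fun t x y u => 0);
        VF (fun t x y u => 0) (fun t x y u => t * x)
           (fun t x y u => - (/ 2 * t ^ 2))
           (fun t x y u => / 2 * (t - ln x) * u);
        VF (fun t x y u => 0) (fun t x y u => t ^ 2 * x)
           (fun t x y u => - (/ 3 * t ^ 3))
           (fun t x y u => - (t * ln x + y - / 2 * t ^ 2) * u);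
        VF (fun t x y u => t) (fun t x y u => / 2 * x * ln x)
           (fun t x y u => 3 / 2 * y)
           (fun t x y u => / 4 * (ln x - t) * u);
        VF (fun t x y u => t ^ 2) (fun t x y u => (t * ln x - 3 * y) * x)
           (fun t x y u => 3 * t * y)
           (fun t x y u =>
              - ((ln x) ^ 2 - / 2 * t * ln x + / 4 * t ^ 2 + 2 * t + 3 / 2 * y) * u) ]
| canonical_ln_m2 :
    canonical (fun x => / (ln x) ^ 2) (fun x => 0 < x /\ ln x <> 0)
      [ op_t; op_y; op_u;
        VF (fun t x y u => t) (fun t x y u => / 2 * x * ln x) (fun t x y u => 0)
           (fun t x y u => / 4 * (ln x - t) * u);
        VF (fun t x y u => t ^ 2) (fun t x y u => t * x * ln x) (fun t x y u => 0)
           (fun t x y u =>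
              - (/ 4 * ((ln x) ^ 2 - 2 * t * ln x + t ^ 2 + 2 * t)) * u) ]
| canonical_ln_ln :
    canonical (fun x => ln (ln x)) (fun x => 0 < x /\ 0 < ln x)
      [ op_t; op_y; op_u;
        VF (fun t x y u => t) (fun t x y u => / 2 * x * ln x)
           (fun t x y u => y - / 2 * t)
           (fun t x y u => / 4 * (ln x - t) * u) ].

(* Main.v *)
Require Import Defs.
From Stdlib Require Import Lra Lia Psatz Classical.

(** In terms of z = ln x and D = x d/dx the infinitesimal criterion says that tau = xi0 and
    psi = xi2 depend on (t,y) only, that zeta = xi1/x depends on (t,x,y), that
    eta = A(t,x,y) u + beta with beta a solution, and that
      D zeta = (tau_t - f tau_y)/2,
      Df zeta = f^2 tau_y - f (tau_t - psi_y) - psi_t,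
      2 DA = D zeta + D^2 zeta - Y zeta   and   Y A = D^2 A - D A,   where Y = d_t - f d_y.
    Integrating the third equation by means of a primitive S of Y zeta (D S = Y zeta) and
    inserting the result in the fourth expresses tau_y D^2 f as a quadratic polynomial in f,
    with coefficients depending on (t,y), plus 2 Y S.  If tau_y <> 0 somewhere, the first two
    equations determine (Df)^2 as an explicit function of f there, and comparing degrees in f
    gives a contradiction; so tau_y = 0.  Then zeta is affine in ln x, and any symmetry outside
    the kernel yields an equation Df (a ln x + b) = c f + d, whose smooth nonconstant solutions
    are, up to equivalence, the canonical ones.  For these, the system is solved explicitly. *)

(** * Smooth functions on a box *)

(** At fixed (t,y) the D-derivative of the second equation, with zeta and D zeta eliminated, reads
    D^2 f Q(f) = (Df)^2 L(f), where Q = tau_y f^2 + (psi_y - tau_t) f - psi_t and L = (5/2) tau_y f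
    + psi_y - (3/2) tau_t; the 5/2 is 2 from f^2 plus 1/2 from D zeta. Since f does not depend on
    (t,y), the fractions L/Q at different points agree as rational functions of f. So either L and Q
    share a root, and L/Q = (5/2)/(f - s), or all pairs (Q,L) are proportional. Each case has its
    own explicit S. The other obstacle is that boxes are arbitrary. Dividing by tau_y, Df or L
    requires a smaller box. Moreover the interval of x may contain the zero of a ln x + b, where the
    equation for f is singular and its real-power solutions are undefined. *)

Lemma ex_derive_continuous_R (g : R -> R) (x : R) : ex_derive g x -> continuous g x.
Proof. exact (ex_derive_continuous g x). Qed.

(** With [coord], reduces the four cases of [pd] and [ex_pd] to one-variable statements that are
    uniform in [v]. *)
Definition slice (v : var) (F : fun4) (t x y u : R) : R -> R :=
  match v with
  | Vt => fun s => F s x y u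
  | Vx => fun s => F t s y u
  | Vy => fun s => F t x s u
  | Vu => fun s => F t x y s
  end.

Definition coord (v : var) (t x y u : R) : R :=
  match v with Vt => t | Vx => x | Vy => y | Vu => u end.

Definition uncurry4 (F : fun4) (p : R * R * R * R) : R :=
  let '(t, x, y, u) := p in F t x y u.

Definition eq_on (B : box) (F G : fun4) : Prop :=
  forall t x y u, in_box B t x y u -> F t x y u = G t x y u.

Notation zero4 := (fun _ _ _ _ : R => 0).

Lemma pd_slice v F t x y u :
  pd v F t x y u = Derive (slice v F t x y u) (coord v t x y u).
Proof. destruct v; reflexivity. Qed.

Lemma ex_pd_slice v F t x y u :
  ex_pd v F t x y u <-> ex_derive (slice v F t x y u) (coord v t x y u).
Proof. destruct v; reflexivity. Qed.

Lemma box_slice B v t x y u : domain B -> in_box B t x y u ->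
  locally (coord v t x y u)
    (fun s => match v with
              | Vt => in_box B s x y u
              | Vx => in_box B t s y u
              | Vy => in_box B t x s u
              | Vu => in_box B t x y s
              end).
Proof.
  intros ((Ot & _) & (Ox & _) & (Oy & _) & (Ou & _) & _) (Ht & Hx & Hy & Hu).
  unfold in_box.
  destruct v; simpl;
    [ generalize (Ot _ Ht) | generalize (Ox _ Hx)
    | generalize (Oy _ Hy) | generalize (Ou _ Hu) ];
    apply filter_imp; tauto.
Qed.

Lemma box_open B t x y u : domain B -> in_box B t x y u ->
  locally (t, x, y, u) (fun p => let '(t', x', y', u') := p in in_box B t' x' y' u').
Proof.
  intros ((Ot & _) & (Ox & _) & (Oy & _) & (Ou & _) & _) (Ht & Hx & Hy & Hu).
  destruct (Ot _ Ht) as [d1 H1]. destruct (Ox _ Hx) as [d2 H2].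
  destruct (Oy _ Hy) as [d3 H3]. destruct (Ou _ Hu) as [d4 H4].
  assert (Hd : 0 < Rmin (Rmin d1 d2) (Rmin d3 d4)).
  { repeat apply Rmin_glb_lt; apply cond_pos. }
  exists (mkposreal _ Hd). intros [[[t' x'] y'] u'] [[[K1 K2] K3] K4]. simpl in *.
  assert (L1 := Rmin_l (Rmin d1 d2) (Rmin d3 d4)).
  assert (L2 := Rmin_r (Rmin d1 d2) (Rmin d3 d4)).
  assert (L3 := Rmin_l d1 d2). assert (L4 := Rmin_r d1 d2).
  assert (L5 := Rmin_l d3 d4). assert (L6 := Rmin_r d3 d4).
  repeat split.
  - apply H1. eapply ball_le; [ | exact K1 ]; simpl; lra.
  - apply H2. eapply ball_le; [ | exact K2 ]; simpl; lra.
  - apply H3. eapply ball_le; [ | exact K3 ]; simpl; lra.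
  - apply H4. eapply ball_le; [ | exact K4 ]; simpl; lra.
Qed.

Lemma slice_eq_on B v F G t x y u : domain B -> eq_on B F G -> in_box B t x y u ->
  locally (coord v t x y u) (fun s => slice v F t x y u s = slice v G t x y u s).
Proof.
  intros HB HE Hp. generalize (box_slice B v t x y u HB Hp). apply filter_imp.
  intros s; destruct v; simpl; apply HE.
Qed.

(** Openness of the box is the reason: near each of its points the two slices coincide, so their
    derivatives do. *)
Lemma pd_ext {B} v {F G} : domain B -> eq_on B F G -> eq_on B (pd v F) (pd v G).
Proof.
  intros HB HE t x y u Hp. rewrite !pd_slice. apply Derive_ext_loc.
  now apply slice_eq_on with B.
Qed.

Lemma ex_pd_ext B v F G t x y u : domain B -> eq_on B F G -> in_box B t x y u ->
  ex_pd v F t x y u -> ex_pd v G t x y u.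
Proof.
  intros HB HE Hp. rewrite !ex_pd_slice. apply ex_derive_ext_loc.
  now apply slice_eq_on with B.
Qed.

(** * Differentiability of finite order and its closure properties *)

Definition basic (B : box) (F : fun4) : Prop :=
  forall t x y u, in_box B t x y u ->
    continuous (uncurry4 F) (t, x, y, u) /\ (forall v, ex_pd v F t x y u).

(** Closure of [smooth] under products and compositions has no direct induction on the list of
    derivatives. Here the derivative taken first is peeled off, so a closure property follows by
    differentiating once and applying the induction hypothesis to the result. *)
Fixpoint differentiable (N : nat) (B : box) (F : fun4) : Prop :=
  basic B F /\
  match N with O => True | S n => forall v, differentiable n B (pd v F) end.

Lemma pds_app l1 l2 F : pds (l1 ++ l2) F = pds l1 (pds l2 F).
Proof. unfold pds. apply fold_right_app. Qed.

Lemma smooth_pd B v F : smooth B F -> smooth B (pd v F).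
Proof.
  intros H l t x y u Hp. specialize (H (l ++ [v]) t x y u Hp).
  rewrite pds_app in H. exact H.
Qed.

Lemma smooth_basic B F : smooth B F -> basic B F.
Proof. intros H t x y u Hp. exact (H [] t x y u Hp). Qed.

Lemma smooth_differentiable B F : smooth B F <-> forall N, differentiable N B F.
Proof.
  split.
  - intros H N. revert F H. induction N as [|N IH]; intros F H; simpl.
    + split; [ now apply smooth_basic | exact I ].
    + split; [ now apply smooth_basic | ]. intros v. apply IH. now apply smooth_pd.
  - intros H l. revert F H. induction l as [|v l IH] using rev_ind; intros F H.
    + destruct (H O) as [H0 _]. exact H0.
    + rewrite pds_app. apply IH. intros N. destruct (H (S N)) as [_ H1]. apply H1.
Qed.

Lemma basic_ext B F G : domain B -> eq_on B F G -> basic B F -> basic B G.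
Proof.
  intros HB HE H t x y u Hp. destruct (H t x y u Hp) as [H1 H2]. split.
  - apply continuous_ext_loc with (uncurry4 F); [ | exact H1 ].
    generalize (box_open B t x y u HB Hp). apply filter_imp.
    intros [[[t' x'] y'] u'] Hq. simpl. now apply HE.
  - intros v. now apply ex_pd_ext with B F.
Qed.

Lemma differentiable_ext N B F G :
  domain B -> eq_on B F G -> differentiable N B F -> differentiable N B G.
Proof.
  intros HB. revert F G. induction N as [|N IH]; intros F G HE [H0 H1]; simpl.
  - split; [ now apply basic_ext with F | exact I ].
  - split; [ now apply basic_ext with F | ]. intros v.
    apply IH with (pd v F); [ now apply pd_ext | apply H1 ].
Qed.

Lemma smooth_ext B F G : domain B -> eq_on B F G -> smooth B F -> smooth B G.
Proof.
  rewrite !smooth_differentiable. intros HB HE H N.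
  now apply differentiable_ext with F.
Qed.

Lemma differentiable_lower N B F : differentiable (S N) B F -> differentiable N B F.
Proof.
  revert F. induction N as [|N IH]; intros F [H0 H1].
  - split; [ exact H0 | exact I ].
  - split; [ exact H0 | ]. intros v. apply IH, H1.
Qed.

Lemma differentiable_basic N B F : differentiable N B F -> basic B F.
Proof. destruct N; intros [H _]; exact H. Qed.

Lemma smooth_ex_pd B F v t x y u :
  smooth B F -> in_box B t x y u -> ex_pd v F t x y u.
Proof. intros H Hp. now apply (smooth_basic B F H). Qed.

Lemma slice_derive B F v t x y u : smooth B F -> in_box B t x y u ->
  is_derive (slice v F t x y u) (coord v t x y u) (pd v F t x y u).
Proof.
  intros H Hp. rewrite pd_slice. apply Derive_correct, ex_pd_slice.
  now apply smooth_ex_pd with B.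
Qed.

Lemma pd_plus v F G t x y u : ex_pd v F t x y u -> ex_pd v G t x y u ->
  pd v (fun t x y u => F t x y u + G t x y u) t x y u
  = pd v F t x y u + pd v G t x y u.
Proof. destruct v; simpl; intros H1 H2; exact (Derive_plus _ _ _ H1 H2). Qed.

Lemma ex_pd_plus v F G t x y u : ex_pd v F t x y u -> ex_pd v G t x y u ->
  ex_pd v (fun t x y u => F t x y u + G t x y u) t x y u.
Proof.
  destruct v; simpl; intros H1 H2; exact (ex_derive_plus _ _ _ H1 H2).
Qed.

Lemma pd_mult v F G t x y u : ex_pd v F t x y u -> ex_pd v G t x y u ->
  pd v (fun t x y u => F t x y u * G t x y u) t x y u
  = pd v F t x y u * G t x y u + F t x y u * pd v G t x y u.
Proof. destruct v; simpl; intros H1 H2; exact (Derive_mult _ _ _ H1 H2). Qed.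

Lemma ex_pd_mult v F G t x y u : ex_pd v F t x y u -> ex_pd v G t x y u ->
  ex_pd v (fun t x y u => F t x y u * G t x y u) t x y u.
Proof.
  destruct v; simpl; intros H1 H2; exact (ex_derive_mult _ _ _ H1 H2).
Qed.

Lemma pd_inv v F t x y u : ex_pd v F t x y u -> F t x y u <> 0 ->
  pd v (fun t x y u => / F t x y u) t x y u
  = - pd v F t x y u * (/ F t x y u * / F t x y u).
Proof.
  intros H1 H2. transitivity (- pd v F t x y u / F t x y u ^ 2).
  - destruct v; simpl in *; exact (Derive_inv _ _ H1 H2).
  - field. exact H2.
Qed.

Lemma pd_const v c t x y u : pd v (fun _ _ _ _ => c) t x y u = 0.
Proof. destruct v; simpl; apply Derive_const. Qed.

Lemma basic_const B c : basic B (fun _ _ _ _ => c).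
Proof.
  intros t x y u _. split.
  - apply continuous_ext with (fun _ => c); [ now intros [[[? ?] ?] ?] | ].
    apply continuous_const.
  - intros v; destruct v; exact (ex_derive_const c _).
Qed.

Lemma basic_plus B F G : basic B F -> basic B G ->
  basic B (fun t x y u => F t x y u + G t x y u).
Proof.
  intros HF HG t x y u Hp.
  destruct (HF _ _ _ _ Hp) as [F1 F2]. destruct (HG _ _ _ _ Hp) as [G1 G2]. split.
  - apply continuous_ext with (fun p => plus (uncurry4 F p) (uncurry4 G p)).
    + now intros [[[? ?] ?] ?].
    + now apply @continuous_plus.
  - intros v. now apply ex_pd_plus.
Qed.

Lemma basic_mult B F G : basic B F -> basic B G ->
  basic B (fun t x y u => F t x y u * G t x y u).
Proof.
  intros HF HG t x y u Hp.
  destruct (HF _ _ _ _ Hp) as [F1 F2]. destruct (HG _ _ _ _ Hp) as [G1 G2]. split.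
  - apply continuous_ext with (fun p => mult (uncurry4 F p) (uncurry4 G p)).
    + now intros [[[? ?] ?] ?].
    + now apply @continuous_mult.
  - intros v. now apply ex_pd_mult.
Qed.

Lemma basic_comp B (g : R -> R) F : basic B F ->
  (forall t x y u, in_box B t x y u ->
     continuous g (F t x y u) /\ ex_derive g (F t x y u)) ->
  basic B (fun t x y u => g (F t x y u)).
Proof.
  intros HF Hg t x y u Hp.
  destruct (HF _ _ _ _ Hp) as [F1 F2]. destruct (Hg _ _ _ _ Hp) as [G1 G2]. split.
  - apply continuous_ext with (fun p => g (uncurry4 F p)).
    + now intros [[[? ?] ?] ?].
    + apply continuous_comp; assumption.
  - intros v. specialize (F2 v). destruct v; simpl in *.
    + exact (ex_derive_comp g _ _ G2 F2).
    + exact (ex_derive_comp g _ _ G2 F2).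
    + exact (ex_derive_comp g _ _ G2 F2).
    + exact (ex_derive_comp g _ _ G2 F2).
Qed.

Lemma differentiable_const N B c : domain B -> differentiable N B (fun _ _ _ _ => c).
Proof.
  intros HB. revert c. induction N as [|N IH]; intros c; simpl.
  - split; [ apply basic_const | exact I ].
  - split; [ apply basic_const | ]. intros v.
    apply differentiable_ext with (fun _ _ _ _ => 0); [ exact HB | | apply IH ].
    intros t x y u _. now rewrite pd_const.
Qed.

Lemma differentiable_plus N B F G : domain B ->
  differentiable N B F -> differentiable N B G ->
  differentiable N B (fun t x y u => F t x y u + G t x y u).
Proof.
  intros HB. revert F G. induction N as [|N IH]; intros F G [F0 F1] [G0 G1]; simpl.
  - split; [ now apply basic_plus | exact I ].
  - split; [ now apply basic_plus | ]. intros v.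
    apply differentiable_ext with (fun t x y u => pd v F t x y u + pd v G t x y u);
      [ exact HB | | now apply IH ].
    intros t x y u Hp. symmetry. apply pd_plus; [ now apply F0 | now apply G0 ].
Qed.

Lemma differentiable_mult N B F G : domain B ->
  differentiable N B F -> differentiable N B G ->
  differentiable N B (fun t x y u => F t x y u * G t x y u).
Proof.
  intros HB. revert F G. induction N as [|N IH]; intros F G HF HG.
  - destruct HF as [F0 _], HG as [G0 _]. split; [ now apply basic_mult | exact I ].
  (* The Leibniz rule puts the undifferentiated factors next to derivatives, so [F] and [G] are
     needed at order [N] as well. *)
  - assert (HF' := differentiable_lower _ _ _ HF).
    assert (HG' := differentiable_lower _ _ _ HG).
    destruct HF as [F0 F1], HG as [G0 G1].
    split; [ now apply basic_mult | ]. intros v.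
    apply differentiable_ext with
      (fun t x y u => pd v F t x y u * G t x y u + F t x y u * pd v G t x y u);
      [ exact HB | | ].
    + intros t x y u Hp. symmetry. apply pd_mult; [ now apply F0 | now apply G0 ].
    + apply differentiable_plus; [ exact HB | | ];
        [ apply (IH (pd v F) G) | apply (IH F (pd v G)) ]; auto.
Qed.

Lemma smooth_const B c : domain B -> smooth B (fun _ _ _ _ => c).
Proof. intros HB. apply smooth_differentiable. intros N. now apply differentiable_const. Qed.

Lemma smooth_plus B F G : domain B -> smooth B F -> smooth B G ->
  smooth B (fun t x y u => F t x y u + G t x y u).
Proof.
  rewrite !smooth_differentiable. intros HB HF HG N. now apply differentiable_plus.
Qed.

Lemma smooth_mult B F G : domain B -> smooth B F -> smooth B G ->
  smooth B (fun t x y u => F t x y u * G t x y u).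
Proof.
  rewrite !smooth_differentiable. intros HB HF HG N. now apply differentiable_mult.
Qed.

Lemma smooth_opp B F : domain B -> smooth B F -> smooth B (fun t x y u => - F t x y u).
Proof.
  intros HB HF. apply smooth_ext with (fun t x y u => -1 * F t x y u); [ exact HB | | ].
  - intros t x y u _. ring.
  - apply (smooth_mult B (fun _ _ _ _ => -1)); auto. now apply smooth_const.
Qed.

Lemma smooth_minus B F G : domain B -> smooth B F -> smooth B G ->
  smooth B (fun t x y u => F t x y u - G t x y u).
Proof.
  intros HB HF HG. apply (smooth_plus B F (fun t x y u => - G t x y u)); auto.
  now apply smooth_opp.
Qed.

Lemma smooth_pow B F n : domain B -> smooth B F -> smooth B (fun t x y u => F t x y u ^ n).
Proof.
  intros HB HF. induction n as [|n IH]; simpl.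
  - now apply smooth_const.
  - now apply (smooth_mult B F (fun t x y u => F t x y u ^ n)).
Qed.

(** The chain rule as an induction step. When g' is expressed through g itself, as for inverses and
    real powers, iterating it gives smoothness without naming the higher derivatives of g. *)
Lemma differentiable_comp_step N B (g g' : R -> R) F : domain B ->
  (forall t x y u, in_box B t x y u -> is_derive g (F t x y u) (g' (F t x y u))) ->
  differentiable (S N) B F ->
  differentiable N B (fun t x y u => g' (F t x y u)) ->
  differentiable (S N) B (fun t x y u => g (F t x y u)).
Proof.
  intros HB Hg HF Hg'. assert (F0 := differentiable_basic _ _ _ HF). split.
  - apply basic_comp; [ exact F0 | ]. intros t x y u Hp. specialize (Hg t x y u Hp).
    assert (E : ex_derive g (F t x y u)) by (eexists; exact Hg).
    split; [ now apply ex_derive_continuous_R | exact E ].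
  - intros v. destruct HF as [_ F1].
    apply differentiable_ext with (fun t x y u => pd v F t x y u * g' (F t x y u));
      [ exact HB | | apply differentiable_mult; auto ].
    intros t x y u Hp. specialize (Hg t x y u Hp). destruct (F0 t x y u Hp) as [_ F2].
    specialize (F2 v). symmetry. destruct v; simpl in *; apply is_derive_unique;
      exact (is_derive_comp g _ _ _ _ Hg (Derive_correct _ _ F2)).
Qed.

Lemma smooth_inv B F : domain B -> smooth B F ->
  (forall t x y u, in_box B t x y u -> F t x y u <> 0) ->
  smooth B (fun t x y u => / F t x y u).
Proof.
  intros HB HF Hnz. apply smooth_differentiable. intros N.
  assert (HD : forall a, a <> 0 -> is_derive Rinv a (- (/ a * / a))).
  { intros a Ha. auto_derive; [ exact Ha | ]. field. exact Ha. }
  assert (Hl : forall t x y u, in_box B t x y u ->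
            is_derive Rinv (F t x y u) (- (/ F t x y u * / F t x y u))).
  { intros t x y u Hp. apply HD. now apply Hnz. }
  induction N as [|N IH].
  - split; [ | exact I ]. apply basic_comp; [ now apply smooth_basic | ].
    intros t x y u Hp. assert (E : ex_derive Rinv (F t x y u)).
    { eexists; now apply Hl. }
    split; [ now apply ex_derive_continuous_R | exact E ].
  - apply differentiable_comp_step with (g' := fun a => - (/ a * / a)); auto.
    + rewrite smooth_differentiable in HF. apply HF.
    + apply differentiable_ext with
        (fun t x y u => -1 * (/ F t x y u * / F t x y u)); [ exact HB | | ].
      * intros t x y u _. ring.
      * apply (differentiable_mult N B (fun _ _ _ _ => -1));
          [ exact HB | now apply differentiable_const | ].
        now apply differentiable_mult.
Qed.

Lemma smooth_div B F G : domain B -> smooth B F -> smooth B G ->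
  (forall t x y u, in_box B t x y u -> G t x y u <> 0) ->
  smooth B (fun t x y u => F t x y u / G t x y u).
Proof.
  intros HB HF HG Hnz. apply (smooth_mult B F (fun t x y u => / G t x y u)); auto.
  now apply smooth_inv.
Qed.

Lemma smooth_ln B F : domain B -> smooth B F ->
  (forall t x y u, in_box B t x y u -> 0 < F t x y u) ->
  smooth B (fun t x y u => ln (F t x y u)).
Proof.
  intros HB HF Hpos. apply smooth_differentiable.
  assert (Hl : forall t x y u, in_box B t x y u ->
            is_derive ln (F t x y u) (/ F t x y u)).
  { intros t x y u Hp. apply is_derive_ln. now apply Hpos. }
  assert (Hi : smooth B (fun t x y u => / F t x y u)).
  { apply smooth_inv; auto. intros t x y u Hp. specialize (Hpos t x y u Hp). lra. }
  rewrite smooth_differentiable in Hi, HF. intros [|N].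
  - split; [ | exact I ]. apply basic_comp; [ apply (HF O) | ].
    intros t x y u Hp. assert (E : ex_derive ln (F t x y u)).
    { eexists; now apply Hl. }
    split; [ now apply ex_derive_continuous_R | exact E ].
  - now apply differentiable_comp_step with (g' := Rinv).
Qed.

Lemma coordinate_smooth B w : domain B ->
  smooth B (fun t x y u => coord w t x y u).
Proof.
  intros HB. apply smooth_differentiable.
  assert (Hb : basic B (fun t x y u => coord w t x y u)).
  { intros t x y u Hp. split.
    - assert (C1 : continuous (fun p : R * R * R * R => fst p) (t, x, y, u))
        by apply continuous_fst.
      assert (C2 : continuous (fun p : R * R * R * R => fst (fst p)) (t, x, y, u)).
      { apply continuous_comp with (f := fst) (g := fst); apply continuous_fst. }
      destruct w;
        [ apply continuous_ext with (fun p : R * R * R * R => fst (fst (fst p)))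
        | apply continuous_ext with (fun p : R * R * R * R => snd (fst (fst p)))
        | apply continuous_ext with (fun p : R * R * R * R => snd (fst p))
        | apply continuous_ext with (fun p : R * R * R * R => snd p) ];
        try (now intros [[[? ?] ?] ?]).
      + apply (continuous_comp (fun p : R * R * R * R => fst (fst p)) fst);
          [ apply C2 | apply continuous_fst ].
      + apply (continuous_comp (fun p : R * R * R * R => fst (fst p)) snd);
          [ apply C2 | apply continuous_snd ].
      + apply (continuous_comp (fun p : R * R * R * R => fst p) snd);
          [ apply C1 | apply continuous_snd ].
      + apply continuous_snd.
    - intros v; destruct v, w; simpl; 
        first [ exact (ex_derive_id (K := R_AbsRing) _)
              | exact (ex_derive_const (K := R_AbsRing) (V := R_NormedModule) _ _) ]. }
  assert (Hd : forall v, exists c, forall t x y u,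
             pd v (fun t x y u => coord w t x y u) t x y u = c).
  { intros v; destruct v, w; simpl;
      first [ exists 0; intros; now rewrite Derive_const
            | exists 1; intros; now rewrite Derive_id ]. }
  intros [|N]; (split; [ exact Hb | ]); [ exact I | ]. intros v.
  destruct (Hd v) as [c Hc].
  apply differentiable_ext with (fun _ _ _ _ => c);
    [ exact HB | | now apply differentiable_const ].
  intros t x y u _. now rewrite Hc.
Qed.

Lemma smooth_t B : domain B -> smooth B (fun t x y u => t).
Proof. exact (coordinate_smooth B Vt). Qed.
Lemma smooth_x B : domain B -> smooth B (fun t x y u => x).
Proof. exact (coordinate_smooth B Vx). Qed.
Lemma smooth_y B : domain B -> smooth B (fun t x y u => y).
Proof. exact (coordinate_smooth B Vy). Qed.
Lemma smooth_u B : domain B -> smooth B (fun t x y u => u).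
Proof. exact (coordinate_smooth B Vu). Qed.

Lemma smooth_ln_x B : domain B -> smooth B (fun t x y u => ln x).
Proof.
  intros HB. apply (smooth_ln B (fun t x y u => x)); [ exact HB | now apply smooth_x | ].
  intros t x y u (_ & Hx & _). now apply HB.
Qed.

Lemma smooth_of_x B f : domain B -> (forall n x, bx B x -> ex_derive_n f n x) ->
  smooth B (fun _ x _ _ => f x).
Proof.
  intros HB Hf. apply smooth_differentiable. intros N.
  (* Generalised to all iterates, since differentiating in x replaces [k] by [S k]. *)
  assert (H : forall k, differentiable N B (fun _ x _ _ => Derive_n f k x)).
  { induction N as [|N IH]; intros k.
    - split; [ | exact I ]. apply (basic_comp B (Derive_n f k) (fun t x y u => x)).
      + now apply smooth_basic, smooth_x.
      + intros t x y u (_ & Hx & _).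
        split; [ apply ex_derive_continuous_R | ]; exact (Hf (S k) x Hx).
    - split; [ exact (differentiable_basic _ _ _ (IH k)) | ]. intros v. destruct v.
      2: exact (IH (S k)).
      all: apply differentiable_ext with zero4;
        [ exact HB | intros t x y u _; simpl; now rewrite Derive_const
        | now apply differentiable_const ]. }
  exact (H O).
Qed.

Lemma pd_opp v F t x y u :
  pd v (fun t x y u => - F t x y u) t x y u = - pd v F t x y u.
Proof. destruct v; simpl; apply Derive_opp. Qed.

Lemma pd_minus v F G t x y u : ex_pd v F t x y u -> ex_pd v G t x y u ->
  pd v (fun t x y u => F t x y u - G t x y u) t x y u
  = pd v F t x y u - pd v G t x y u.
Proof. destruct v; simpl; intros H1 H2; exact (Derive_minus _ _ _ H1 H2). Qed.

Lemma ball4 (t x y u t' x' y' u' d : R) (Hd : 0 < d) :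
  Rabs (t' - t) < d -> Rabs (x' - x) < d -> Rabs (y' - y) < d -> Rabs (u' - u) < d ->
  ball (t, x, y, u) d (t', x', y', u').
Proof. intros. repeat split; assumption. Qed.

(** [smooth] makes every iterated derivative jointly continuous in four variables; restricted to the
    plane of two of them, this gives the hypotheses of the two-variable theorem. *)
Lemma schwarz {B} v w {F} : domain B -> smooth B F ->
  eq_on B (pd v (pd w F)) (pd w (pd v F)).
Proof.
  intros HB HF t x y u Hp.
  assert (C : forall l (e : posreal), exists d : posreal, forall t' x' y' u',
            Rabs (t' - t) < d -> Rabs (x' - x) < d ->
            Rabs (y' - y) < d -> Rabs (u' - u) < d ->
            Rabs (pds l F t' x' y' u' - pds l F t x y u) < e).
  { intros l e. destruct (HF l t x y u Hp) as [H _].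
    destruct (proj1 (filterlim_locally _ _) H e) as [d Hd].
    exists d. intros t' x' y' u' H1 H2 H3 H4.
    exact (Hd (t', x', y', u') (ball4 _ _ _ _ _ _ _ _ _ (cond_pos d) H1 H2 H3 H4)). }
  assert (Z : forall a (d : posreal), Rabs (a - a) < d).
  { intros a d. replace (a - a) with 0 by ring. rewrite Rabs_R0. apply cond_pos. }
  assert (L : exists d : posreal, forall t' x' y' u',
            Rabs (t' - t) < d -> Rabs (x' - x) < d ->
            Rabs (y' - y) < d -> Rabs (u' - u) < d ->
            in_box B t' x' y' u').
  { destruct (box_open B t x y u HB Hp) as [d Hd].
    exists d. intros t' x' y' u' H1 H2 H3 H4.
    exact (Hd (t', x', y', u') (ball4 _ _ _ _ _ _ _ _ _ (cond_pos d) H1 H2 H3 H4)). }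
  destruct L as [dl L].
  assert (E : forall v0 G, smooth B G -> forall t' x' y' u', in_box B t' x' y' u' ->
            ex_pd v0 G t' x' y' u').
  { intros; now apply smooth_ex_pd with B. }
  Ltac swap_derivatives F HF dl C E L Z v w g :=
    apply (Schwarz g);
      [ exists dl; intros a b Ha Hb;
        refine (conj (E v F HF _ _ _ _ _) (conj (E w F HF _ _ _ _ _)
               (conj (E v _ (smooth_pd _ w _ HF) _ _ _ _ _)
                     (E w _ (smooth_pd _ v _ HF) _ _ _ _ _)))); apply L
      | intros e; destruct (C [v; w] e) as [d Hd]; exists d; intros a b Ha Hb;
        refine (Hd _ _ _ _ _ _ _ _)
      | intros e; destruct (C [w; v] e) as [d Hd]; exists d; intros a b Ha Hb;
        refine (Hd _ _ _ _ _ _ _ _) ];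
      first [ assumption | apply Z ].
  destruct v, w; try reflexivity; simpl.
  - swap_derivatives F HF dl C E L Z Vt Vx (fun a b => F a b y u).
  - swap_derivatives F HF dl C E L Z Vt Vy (fun a b => F a x b u).
  - swap_derivatives F HF dl C E L Z Vt Vu (fun a b => F a x y b).
  - swap_derivatives F HF dl C E L Z Vx Vt (fun a b => F b a y u).
  - swap_derivatives F HF dl C E L Z Vx Vy (fun a b => F t a b u).
  - swap_derivatives F HF dl C E L Z Vx Vu (fun a b => F t a y b).
  - swap_derivatives F HF dl C E L Z Vy Vt (fun a b => F b x a u).
  - swap_derivatives F HF dl C E L Z Vy Vx (fun a b => F t b a u).
  - swap_derivatives F HF dl C E L Z Vy Vu (fun a b => F t x a b).
  - swap_derivatives F HF dl C E L Z Vu Vt (fun a b => F b x y a).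
  - swap_derivatives F HF dl C E L Z Vu Vx (fun a b => F t b y a).
  - swap_derivatives F HF dl C E L Z Vu Vy (fun a b => F t x b a).
Qed.

(** * Functions with vanishing partial derivatives *)

Lemma derive_zero_constant (J : R -> Prop) (g : R -> R) a b :
  (forall a b c, J a -> J c -> a <= b <= c -> J b) ->
  (forall s, J s -> is_derive g s 0) -> J a -> J b -> g a = g b.
Proof.
  intros HJ Hg Ha Hb.
  assert (K : forall s, Rmin a b <= s <= Rmax a b -> J s).
  { intros s Hs. destruct (Rle_dec a b) as [H|H].
    - rewrite Rmin_left, Rmax_right in Hs by lra. exact (HJ a s b Ha Hb Hs).
    - rewrite Rmin_right, Rmax_left in Hs by lra. exact (HJ b s a Hb Ha Hs). }
  destruct (MVT_gen g a b (fun _ => 0)) as [c [_ Hc]].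
  - intros s Hs. apply Hg, K. lra.
  - intros s Hs. apply continuity_pt_filterlim, ex_derive_continuous_R.
    eexists. apply Hg, K, Hs.
  - lra.
Qed.

Definition coord_dom (B : box) (v : var) : R -> Prop :=
  match v with Vt => bt B | Vx => bx B | Vy => by_ B | Vu => bu B end.

Lemma domain_interval B v : domain B -> open_interval (coord_dom B v).
Proof. intros (H1 & H2 & H3 & H4 & _); destruct v; assumption. Qed.

Lemma slice_const B v F t x y u s : domain B -> smooth B F ->
  (forall t x y u, in_box B t x y u -> pd v F t x y u = 0) ->
  in_box B t x y u -> coord_dom B v s -> slice v F t x y u s = F t x y u.
Proof.
  intros HB HF H0 Hp Hs.
  assert (Hc : coord_dom B v (coord v t x y u)).
  { destruct Hp as (H1 & H2 & H3 & H4); destruct v; assumption. }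
  transitivity (slice v F t x y u (coord v t x y u)); [ | destruct v; reflexivity ].
  apply derive_zero_constant with (coord_dom B v); auto; [ apply domain_interval, HB | ].
  intros r Hr.
  assert (D : forall t x y u, in_box B t x y u ->
            is_derive (slice v F t x y u) (coord v t x y u) 0).
  { intros. erewrite <- H0; [ now apply slice_derive with B | eassumption ]. }
  destruct Hp as (H1 & H2 & H3 & H4). destruct v; simpl in *.
  - apply (D r x y u); repeat split; assumption.
  - apply (D t r y u); repeat split; assumption.
  - apply (D t x r u); repeat split; assumption.
  - apply (D t x y r); repeat split; assumption.
Qed.

Lemma pd_zero B v w F : domain B -> eq_on B (pd v F) zero4 ->
  eq_on B (pd w (pd v F)) zero4.
Proof.
  intros HB H t x y u Hp. rewrite (pd_ext w HB H t x y u Hp). apply pd_const.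
Qed.

Lemma pd_zero_comm B v w F : domain B -> smooth B F ->
  eq_on B (pd v F) zero4 -> eq_on B (pd v (pd w F)) zero4.
Proof.
  intros HB SF H0 t x y u Hp. rewrite (schwarz v w HB SF _ _ _ _ Hp).
  exact (pd_zero B v w F HB H0 _ _ _ _ Hp).
Qed.

(** Comparing coefficients at one point yields several equations at once; this turns them into
    separate identities on the box. *)
Lemma eq_on_and2 B F G F' G' :
  (forall t x y u, in_box B t x y u -> F t x y u = G t x y u /\ F' t x y u = G' t x y u) ->
  eq_on B F G /\ eq_on B F' G'.
Proof. intros H. split; intros t x y u Hp; apply (H t x y u Hp). Qed.

Lemma eq_on_and3 B F G F' G' F2 G2 :
  (forall t x y u, in_box B t x y u ->
     F t x y u = G t x y u /\ F' t x y u = G' t x y u /\ F2 t x y u = G2 t x y u) ->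
  eq_on B F G /\ eq_on B F' G' /\ eq_on B F2 G2.
Proof. intros H. repeat split; intros t x y u Hp; apply (H t x y u Hp). Qed.

Lemma domain_point B : domain B -> exists t x y u, in_box B t x y u.
Proof.
  intros ((_ & [t Ht] & _) & (_ & [x Hx] & _) & (_ & [y Hy] & _) & (_ & [u Hu] & _) & _).
  now exists t, x, y, u.
Qed.

Lemma in_box_x {B t x x' y u} : in_box B t x y u -> bx B x' -> in_box B t x' y u.
Proof. intros (Ht & _ & Hy & Hu) Hx'. repeat split; assumption. Qed.

Lemma x_invariant B F t x x' y u : domain B -> smooth B F ->
  eq_on B (pd Vx F) zero4 -> in_box B t x y u -> bx B x' ->
  F t x' y u = F t x y u.
Proof. intros HB SF H0 Hp Hx'. exact (slice_const B Vx F t x y u x' HB SF H0 Hp Hx'). Qed.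

(** * The determining equations *)

Lemma pd_of_x v f t x y u :
  pd v (fun _ x _ _ => f x) t x y u = match v with Vx => Derive f x | _ => 0 end.
Proof. destruct v; simpl; try apply Derive_const; reflexivity. Qed.

Lemma pd_t v t x y u :
  pd v (fun t _ _ _ => t) t x y u = match v with Vt => 1 | _ => 0 end.
Proof. destruct v; simpl; first [ apply Derive_const | apply Derive_id ]. Qed.

Lemma pd_x v t x y u :
  pd v (fun _ x _ _ => x) t x y u = match v with Vx => 1 | _ => 0 end.
Proof. destruct v; simpl; first [ apply Derive_const | apply Derive_id ]. Qed.

Lemma pd_y v t x y u :
  pd v (fun _ _ y _ => y) t x y u = match v with Vy => 1 | _ => 0 end.
Proof. destruct v; simpl; first [ apply Derive_const | apply Derive_id ]. Qed.

Lemma pd_u v t x y u :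
  pd v (fun _ _ _ u => u) t x y u = match v with Vu => 1 | _ => 0 end.
Proof. destruct v; simpl; first [ apply Derive_const | apply Derive_id ]. Qed.

Lemma pd_div v F G t x y u :
  pd v (fun t x y u => F t x y u / G t x y u) t x y u
  = pd v (fun t x y u => F t x y u * / G t x y u) t x y u.
Proof. reflexivity. Qed.

Lemma pd_pow v F n t x y u : ex_pd v F t x y u ->
  pd v (fun t x y u => F t x y u ^ n) t x y u
  = INR n * F t x y u ^ pred n * pd v F t x y u.
Proof.
  intros H. destruct v; simpl in *; rewrite (Derive_pow _ n _ H); simpl; ring.
Qed.

Lemma pd_ln_x v t x y u : 0 < x ->
  pd v (fun _ x _ _ => ln x) t x y u = match v with Vx => / x | _ => 0 end.
Proof.
  intros Hx. rewrite pd_of_x. destruct v; try reflexivity.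
  now apply is_derive_unique, is_derive_ln.
Qed.

Ltac nonzero := solve [ assumption | cbv beta; intros; lra | eauto ].

Ltac smooth_rec :=
  lazymatch goal with
  | |- smooth ?B ?F =>
    first [ assumption |
      lazymatch F with
      | (fun _ _ _ _ => ?c) => apply (smooth_const B c); assumption
      | (fun t _ _ _ => t) => apply (smooth_t B); assumption
      | (fun _ x _ _ => x) => apply (smooth_x B); assumption
      | (fun _ _ y _ => y) => apply (smooth_y B); assumption
      | (fun _ _ _ u => u) => apply (smooth_u B); assumption
      | (fun _ x _ _ => ln x) => apply (smooth_ln_x B); assumption
      | (fun t x y u => @?f t x y u + @?g t x y u) =>
        apply (smooth_plus B f g); [ assumption | smooth_rec | smooth_rec ]
      | (fun t x y u => @?f t x y u - @?g t x y u) =>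
        apply (smooth_minus B f g); [ assumption | smooth_rec | smooth_rec ]
      | (fun t x y u => @?f t x y u * @?g t x y u) =>
        apply (smooth_mult B f g); [ assumption | smooth_rec | smooth_rec ]
      | (fun t x y u => @?f t x y u / @?g t x y u) =>
        apply (smooth_div B f g); [ assumption | smooth_rec | smooth_rec | try nonzero ]
      | (fun t x y u => / @?g t x y u) =>
        apply (smooth_inv B g); [ assumption | smooth_rec | try nonzero ]
      | (fun t x y u => - @?f t x y u) =>
        apply (smooth_opp B f); [ assumption | smooth_rec ]
      | (fun t x y u => @?f t x y u ^ ?n) =>
        apply (smooth_pow B f n); [ assumption | smooth_rec ]
      | (fun t x y u => pd ?v ?F t x y u) => apply (smooth_pd B v F); smooth_rec
      | pd ?v ?F => apply (smooth_pd B v F); smooth_rec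
      | (fun t x y u => ?F t x y u) => change (smooth B F); smooth_rec
      end ]
  end.

Ltac ex_pd_rec B := apply (smooth_ex_pd B); [ smooth_rec | assumption ].

Ltac pd_step B :=
  match goal with
  | |- context [pd ?v (fun t x y u => ?F t x y u)] =>
    change (fun t x y u => F t x y u) with F
  | |- context [pd ?v (fun _ _ _ _ => ?c) ?p1 ?p2 ?p3 ?p4] =>
    rewrite (pd_const v c p1 p2 p3 p4)
  | |- context [pd ?v (fun t _ _ _ => t) ?p1 ?p2 ?p3 ?p4] => rewrite (pd_t v p1 p2 p3 p4)
  | |- context [pd ?v (fun _ x _ _ => x) ?p1 ?p2 ?p3 ?p4] => rewrite (pd_x v p1 p2 p3 p4)
  | |- context [pd ?v (fun _ _ y _ => y) ?p1 ?p2 ?p3 ?p4] => rewrite (pd_y v p1 p2 p3 p4)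
  | |- context [pd ?v (fun _ _ _ u => u) ?p1 ?p2 ?p3 ?p4] => rewrite (pd_u v p1 p2 p3 p4)
  | |- context [pd ?v (fun _ x _ _ => ln x) ?p1 ?p2 ?p3 ?p4] =>
    rewrite (pd_ln_x v p1 p2 p3 p4) by assumption
  | |- context [pd ?v (fun t x y u => @?f t x y u + @?g t x y u) ?p1 ?p2 ?p3 ?p4] =>
    rewrite (pd_plus v f g p1 p2 p3 p4) by ex_pd_rec B
  | |- context [pd ?v (fun t x y u => @?f t x y u - @?g t x y u) ?p1 ?p2 ?p3 ?p4] =>
    rewrite (pd_minus v f g p1 p2 p3 p4) by ex_pd_rec B
  | |- context [pd ?v (fun t x y u => - @?f t x y u) ?p1 ?p2 ?p3 ?p4] =>
    rewrite (pd_opp v f p1 p2 p3 p4)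
  | |- context [pd ?v (fun t x y u => @?f t x y u * @?g t x y u) ?p1 ?p2 ?p3 ?p4] =>
    rewrite (pd_mult v f g p1 p2 p3 p4) by ex_pd_rec B
  | |- context [pd ?v (fun t x y u => @?f t x y u / @?g t x y u) ?p1 ?p2 ?p3 ?p4] =>
    rewrite (pd_div v f g p1 p2 p3 p4)
  | |- context [pd ?v (fun t x y u => / @?f t x y u) ?p1 ?p2 ?p3 ?p4] =>
    rewrite (pd_inv v f p1 p2 p3 p4) by (nonzero || ex_pd_rec B)
  | |- context [pd ?v (fun t x y u => @?f t x y u ^ ?n) ?p1 ?p2 ?p3 ?p4] =>
    rewrite (pd_pow v f n p1 p2 p3 p4) by ex_pd_rec B
  | |- context [pd ?v (fun _ x _ _ => ?f x) ?p1 ?p2 ?p3 ?p4] => rewrite (pd_of_x v f p1 p2 p3 p4)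
  end; cbv beta.

Ltac pd_compute B := repeat pd_step B.

Ltac vanishing_pd :=
  first [ assumption
        | apply pd_zero; [ assumption | vanishing_pd ]
        | apply pd_zero_comm; [ assumption | smooth_rec | vanishing_pd ] ].

(** Besides the available equations it uses that a second derivative vanishes as soon as one of the
    two first derivatives does, in either order. *)
Ltac reduce_on Hp :=
  lazymatch type of Hp with in_box ?B ?t ?x ?y ?u =>
  repeat match goal with
  | H : eq_on B ?F _ |- context [?F t x y u] => rewrite (H t x y u Hp); cbv beta
  | |- context [pd ?v (pd ?w ?F) t x y u] =>
    let E := fresh in
    assert (E : eq_on B (pd v (pd w F)) zero4) by vanishing_pd;
    rewrite (E t x y u Hp); clear E
  end end.

Ltac pd_from E :=
  intros t x y u Hp;
  lazymatch type of Hp with in_box ?B _ _ _ _ =>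
    rewrite (@pd_ext B _ _ _ ltac:(assumption) E _ _ _ _ Hp); pd_compute B; reduce_on Hp;
    first [ ring | field ]
  end.

Ltac rewrite_derive D :=
  lazymatch type of D with is_derive ?f _ _ =>
    change (fun x => f x) with f; rewrite (is_derive_unique _ _ _ D)
  end.

(** Prepares comparisons of coefficients in x: whatever does not depend on x is moved from the
    running point to the fixed one, which leaves a relation in x with constant coefficients. *)
Ltac shift_x Hp Hs :=
  lazymatch type of Hp with in_box ?B ?t ?x ?y ?u =>
  lazymatch type of Hs with _ ?s =>
  repeat match goal with
  | |- context [?F t s y u] =>
    rewrite (x_invariant B F t x s y u) by first [ assumption | smooth_rec | vanishing_pd ]
  end end end.

Ltac coefficients Z :=
  repeat (let E := fresh "E" in assert (E := Forall_inv Z); cbv beta in E;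
          apply Forall_inv_tail in Z); clear Z.

(** * Explicit prolongation formulas *)

Definition var_of (i : ivar) : var :=
  match i with It => Vt | Ix => Vx | Iy => Vy end.

Lemma total_on_jet i F j :
  total i (on_jet F) j
  = on_jet (pd (var_of i) F) j + j (first i) * on_jet (pd Vu F) j.
Proof.
  assert (H : forall k, jd (first k) (on_jet F) j = 0).
  { intros k. destruct k; unfold jd, on_jet; cbn; apply Derive_const. }
  unfold total, sum3. rewrite !H. destruct i; unfold on_jet, jd; cbn; ring.
Qed.

#[local] Arguments pd : simpl never.

Lemma eta1_formula X i j :
  eta1 X i j
  = on_jet (pd (var_of i) (eta X)) j + j (first i) * on_jet (pd Vu (eta X)) j
    - sum3 (fun k => j (first k) *
        (on_jet (pd (var_of i) (xi X k)) j + j (first i) * on_jet (pd Vu (xi X k)) j)).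
Proof. unfold eta1, sum3. now rewrite !total_on_jet. Qed.

Lemma eta2_xx_formula B X j : domain B -> vf_smooth B X ->
  in_box B (j J_t) (j J_x) (j J_y) (j J_u) ->
  let e F := F (j J_t) (j J_x) (j J_y) (j J_u) in
  let p := j J_ut in let q := j J_ux in let r := j J_uy in
  eta2 X Ix Ix j
  = e (pd Vx (pd Vx (eta X))) + q * e (pd Vx (pd Vu (eta X)))
    - p * (e (pd Vx (pd Vx (xi0 X))) + q * e (pd Vx (pd Vu (xi0 X))))
    - q * (e (pd Vx (pd Vx (xi1 X))) + q * e (pd Vx (pd Vu (xi1 X))))
    - r * (e (pd Vx (pd Vx (xi2 X))) + q * e (pd Vx (pd Vu (xi2 X))))
    + q * (e (pd Vu (pd Vx (eta X))) + q * e (pd Vu (pd Vu (eta X)))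
           - p * (e (pd Vu (pd Vx (xi0 X))) + q * e (pd Vu (pd Vu (xi0 X))))
           - q * (e (pd Vu (pd Vx (xi1 X))) + q * e (pd Vu (pd Vu (xi1 X))))
           - r * (e (pd Vu (pd Vx (xi2 X))) + q * e (pd Vu (pd Vu (xi2 X)))))
    + j J_uxx * (e (pd Vu (eta X)) - p * e (pd Vu (xi0 X))
                 - e (pd Vx (xi1 X)) - 2 * q * e (pd Vu (xi1 X))
                 - r * e (pd Vu (xi2 X)))
    - 2 * j J_utx * (e (pd Vx (xi0 X)) + q * e (pd Vu (xi0 X)))
    - j J_uxx * (e (pd Vx (xi1 X)) + q * e (pd Vu (xi1 X)))
    - 2 * j J_uxy * (e (pd Vx (xi2 X)) + q * e (pd Vu (xi2 X))).
Proof.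
  intros HB (S0 & S1 & S2 & S3) Hp e p q r.
  set (E1 := fun j : jet =>
     on_jet (pd Vx (eta X)) j + j J_ux * on_jet (pd Vu (eta X)) j
     - (j J_ut * (on_jet (pd Vx (xi0 X)) j + j J_ux * on_jet (pd Vu (xi0 X)) j)
        + j J_ux * (on_jet (pd Vx (xi1 X)) j + j J_ux * on_jet (pd Vu (xi1 X)) j)
        + j J_uy * (on_jet (pd Vx (xi2 X)) j + j J_ux * on_jet (pd Vu (xi2 X)) j))).
  set (F1 := fun t x y u => pd Vx (eta X) t x y u + q * pd Vu (eta X) t x y u
     - (p * (pd Vx (xi0 X) t x y u + q * pd Vu (xi0 X) t x y u)
        + q * (pd Vx (xi1 X) t x y u + q * pd Vu (xi1 X) t x y u)
        + r * (pd Vx (xi2 X) t x y u + q * pd Vu (xi2 X) t x y u))).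
  assert (E : forall c, jd c (eta1 X Ix) j = jd c E1 j).
  { intros c. apply Derive_ext. intros s. now rewrite eta1_formula. }
  unfold eta2. unfold total at 1. rewrite !E. unfold sum3. rewrite !total_on_jet, !E.
  cbn [base first second xi var_of].
  (* Differentiation in x or u holds the first-order jets fixed; with [p], [q], [r] frozen it is an
     ordinary partial derivative, accessible to [pd_compute]. *)
  change (jd J_x E1 j) with (e (pd Vx F1)). change (jd J_u E1 j) with (e (pd Vu F1)).
  unfold E1, F1. clear E E1 F1.
  unfold jd. cbn [upd jvar_eq_dec]. unfold on_jet, upd. cbn.
  fold p q r.
  unfold e. clearbody p q r.
  (* What remains are derivatives in u_t, u_x and u_y, in which [eta1] is polynomial. *)
  repeat match goal with
  | |- context [Derive ?g ?a] =>
    erewrite (is_derive_unique g a) by (auto_derive; [ exact I | reflexivity ])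
  end.
  pd_compute B. ring.
Qed.

(** Of the second-order coordinates only u_xx occurs in the equation, so [eta2 X Ix Ix] is the one
    second-order coefficient that survives. *)
Lemma prolong2_Delta B f X j : domain B -> vf_smooth B X ->
  ex_derive f (j J_x) ->
  prolong2 X (Delta f) j
  = on_jet (xi1 X) j * (- (2 * j J_x * j J_uxx) - Derive f (j J_x) * j J_uy)
    + eta1 X It j - f (j J_x) * eta1 X Iy j - j J_x ^ 2 * eta2 X Ix Ix j.
Proof.
  intros HB HX Hf. unfold prolong2, sum3.
  assert (Ht : jd J_t (Delta f) j = 0) by (unfold jd, Delta; cbn; apply Derive_const).
  assert (Hy : jd J_y (Delta f) j = 0) by (unfold jd, Delta; cbn; apply Derive_const).
  assert (Hu : jd J_u (Delta f) j = 0) by (unfold jd, Delta; cbn; apply Derive_const).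
  assert (Hux : jd J_ux (Delta f) j = 0) by (unfold jd, Delta; cbn; apply Derive_const).
  assert (Htt : jd J_utt (Delta f) j = 0) by (unfold jd, Delta; cbn; apply Derive_const).
  assert (Htx : jd J_utx (Delta f) j = 0) by (unfold jd, Delta; cbn; apply Derive_const).
  assert (Hty : jd J_uty (Delta f) j = 0) by (unfold jd, Delta; cbn; apply Derive_const).
  assert (Hxy : jd J_uxy (Delta f) j = 0) by (unfold jd, Delta; cbn; apply Derive_const).
  assert (Hyy : jd J_uyy (Delta f) j = 0) by (unfold jd, Delta; cbn; apply Derive_const).
  assert (Hut : jd J_ut (Delta f) j = 1).
  { unfold jd, Delta; cbn. apply is_derive_unique. auto_derive; [ exact I | ring ]. }
  assert (Huy : jd J_uy (Delta f) j = - f (j J_x)).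
  { unfold jd, Delta; cbn. apply is_derive_unique. auto_derive; [ exact I | ring ]. }
  assert (Huxx : jd J_uxx (Delta f) j = - j J_x ^ 2).
  { unfold jd, Delta; cbn. apply is_derive_unique. auto_derive; [ exact I | ring ]. }
  assert (Hx : jd J_x (Delta f) j
               = - (2 * j J_x * j J_uxx) - Derive f (j J_x) * j J_uy).
  { unfold jd, Delta; cbn. apply is_derive_unique. auto_derive; [ easy | ].
    change (fun x : R => f x) with f. ring. }
  cbn [base first xi].
  rewrite Ht, Hy, Hu, Hux, Htt, Htx, Hty, Hxy, Hyy, Hut, Huy, Huxx, Hx. ring.
Qed.

(** * Invariance expressed by the determining equations *)

(** The coefficients of the invariance condition as a polynomial on the equation: in order, those of
    u_tx, u_x u_tx, u_xy, u_x u_xy, u_x u_xx, u_x^2, u_xx, u_y, u_x and 1, each simplified by the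
    earlier ones. *)
Definition determining_at (f : R -> R) (X : vfield) (t x y u : R) : Prop :=
  let e (F : fun4) := F t x y u in
  (e (pd Vx (xi0 X)) = 0 /\ e (pd Vu (xi0 X)) = 0) /\
  (e (pd Vx (xi2 X)) = 0 /\ e (pd Vu (xi2 X)) = 0) /\
  (e (pd Vu (xi1 X)) = 0 /\ e (pd Vu (pd Vu (eta X))) = 0) /\
  2 * (x * e (pd Vx (xi1 X)) - e (xi1 X))
    = x * (e (pd Vt (xi0 X)) - f x * e (pd Vy (xi0 X))) /\
  Derive f x * e (xi1 X)
    = f x ^ 2 * e (pd Vy (xi0 X))
      - f x * (e (pd Vt (xi0 X)) - e (pd Vy (xi2 X))) - e (pd Vt (xi2 X)) /\
  x ^ 2 * (2 * e (pd Vx (pd Vu (eta X))) - e (pd Vx (pd Vx (xi1 X))))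
    = f x * e (pd Vy (xi1 X)) - e (pd Vt (xi1 X)) /\
  e (pd Vt (eta X)) = x ^ 2 * e (pd Vx (pd Vx (eta X))) + f x * e (pd Vy (eta X)).

Definition determining (B : box) (f : R -> R) (X : vfield) : Prop :=
  forall t x y u, in_box B t x y u -> determining_at f X t x y u.

(** Parametrises the equation in jet space by its free coordinates, with u_t solved for. The zeros
    are mere choices, as the prolonged equation does not involve u_tt, u_ty and u_yy. *)
Definition equation_jet (f : R -> R) (t x y u q r s v w : R) : jet := fun c =>
  match c with
  | J_t => t | J_x => x | J_y => y | J_u => u
  | J_ut => x ^ 2 * s + f x * r | J_ux => q | J_uy => r
  | J_uxx => s | J_utx => v | J_uxy => w
  | J_utt => 0 | J_uty => 0 | J_uyy => 0
  end.


(** [K] is the invariance condition as a polynomial identity in the free jet coordinates. Its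
    coefficients are isolated by differences of its values at 0, 1 and -1. *)
Lemma lie_symmetry_determining B f X :
  domain B -> (forall x, bx B x -> ex_derive f x) ->
  lie_symmetry B f X -> vf_smooth B X /\ determining B f X.
Proof.
  intros HB Hf [HX HL]. split; [ exact HX | ].
  assert (S := HX). destruct S as (S0 & S1 & S2 & S3).
  assert (K : forall t x y u q r s v w, in_box B t x y u ->
     xi1 X t x y u * (- (2 * x * s) - Derive f x * r)
     + (let p := x ^ 2 * s + f x * r in
        let e (F : fun4) := F t x y u in
        e (pd Vt (eta X)) + p * e (pd Vu (eta X))
        - (p * (e (pd Vt (xi0 X)) + p * e (pd Vu (xi0 X)))
           + q * (e (pd Vt (xi1 X)) + p * e (pd Vu (xi1 X)))
           + r * (e (pd Vt (xi2 X)) + p * e (pd Vu (xi2 X))))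
        - f x * (e (pd Vy (eta X)) + r * e (pd Vu (eta X))
        - (p * (e (pd Vy (xi0 X)) + r * e (pd Vu (xi0 X)))
           + q * (e (pd Vy (xi1 X)) + r * e (pd Vu (xi1 X)))
           + r * (e (pd Vy (xi2 X)) + r * e (pd Vu (xi2 X)))))
        - x ^ 2 * (e (pd Vx (pd Vx (eta X))) + q * e (pd Vx (pd Vu (eta X)))
    - p * (e (pd Vx (pd Vx (xi0 X))) + q * e (pd Vx (pd Vu (xi0 X))))
    - q * (e (pd Vx (pd Vx (xi1 X))) + q * e (pd Vx (pd Vu (xi1 X))))
    - r * (e (pd Vx (pd Vx (xi2 X))) + q * e (pd Vx (pd Vu (xi2 X))))
    + q * (e (pd Vu (pd Vx (eta X))) + q * e (pd Vu (pd Vu (eta X)))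
           - p * (e (pd Vu (pd Vx (xi0 X))) + q * e (pd Vu (pd Vu (xi0 X))))
           - q * (e (pd Vu (pd Vx (xi1 X))) + q * e (pd Vu (pd Vu (xi1 X))))
           - r * (e (pd Vu (pd Vx (xi2 X))) + q * e (pd Vu (pd Vu (xi2 X)))))
    + s * (e (pd Vu (eta X)) - p * e (pd Vu (xi0 X))
                 - e (pd Vx (xi1 X)) - 2 * q * e (pd Vu (xi1 X))
                 - r * e (pd Vu (xi2 X)))
    - 2 * v * (e (pd Vx (xi0 X)) + q * e (pd Vu (xi0 X)))
    - s * (e (pd Vx (xi1 X)) + q * e (pd Vu (xi1 X)))
    - 2 * w * (e (pd Vx (xi2 X)) + q * e (pd Vu (xi2 X))))) = 0).
  { intros t x y u q r s v w Hp. set (j := equation_jet f t x y u q r s v w).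
    assert (H := HL j Hp ltac:(unfold Delta; cbn; ring)).
    rewrite (prolong2_Delta B f X j HB HX) in H; [ | apply Hf, Hp ].
    rewrite (eta2_xx_formula B X _ HB HX Hp), !eta1_formula in H.
    unfold sum3, on_jet in H. cbn in H. rewrite <- H. cbv beta zeta. ring. }
  assert (X0 : forall t x y u, in_box B t x y u -> 0 < x ^ 2).
  { intros t x y u Hp. apply pow_lt. apply HB, Hp. }
  assert (E1 : eq_on B (pd Vx (xi0 X)) zero4).
  { intros t x y u Hp. assert (P := X0 _ _ _ _ Hp).
    assert (A := K t x y u 0 0 0 0 0 Hp). assert (C := K t x y u 0 0 0 1 0 Hp).
    cbv beta zeta in A, C. apply Rmult_eq_reg_l with (x ^ 2); lra. }
  assert (E2 : eq_on B (pd Vu (xi0 X)) zero4).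
  { intros t x y u Hp. assert (P := X0 _ _ _ _ Hp). assert (Z := E1 _ _ _ _ Hp).
    assert (A := K t x y u 1 0 0 0 0 Hp). assert (C := K t x y u 1 0 0 1 0 Hp).
    cbv beta zeta in A, C. rewrite Z in A, C. apply Rmult_eq_reg_l with (x ^ 2); lra. }
  assert (E3 : eq_on B (pd Vx (xi2 X)) zero4).
  { intros t x y u Hp. assert (P := X0 _ _ _ _ Hp).
    assert (A := K t x y u 0 0 0 0 0 Hp). assert (C := K t x y u 0 0 0 0 1 Hp).
    cbv beta zeta in A, C. apply Rmult_eq_reg_l with (x ^ 2); lra. }
  assert (E4 : eq_on B (pd Vu (xi2 X)) zero4).
  { intros t x y u Hp. assert (P := X0 _ _ _ _ Hp). assert (Z := E3 _ _ _ _ Hp).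
    assert (A := K t x y u 1 0 0 0 0 Hp). assert (C := K t x y u 1 0 0 0 1 Hp).
    cbv beta zeta in A, C. rewrite Z in A, C. apply Rmult_eq_reg_l with (x ^ 2); lra. }
  assert (E5 : eq_on B (pd Vu (xi1 X)) zero4).
  { intros t x y u Hp. assert (P := X0 _ _ _ _ Hp).
    generalize (K t x y u 0 0 0 0 0 Hp), (K t x y u 1 0 0 0 0 Hp),
      (K t x y u 0 0 1 0 0 Hp), (K t x y u 1 0 1 0 0 Hp).
    cbv beta zeta. reduce_on Hp. intros A0 A1 A2 A3.
    apply Rmult_eq_reg_l with (x ^ 2); lra. }
  intros t x y u Hp. assert (P := X0 _ _ _ _ Hp).
  assert (Px : 0 < x) by (apply HB, Hp).
  (* The values 1 and -1 of u_x separate the linear from the quadratic coefficient in u_x; the last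
     two values isolate the coefficients of u_y and u_xx. *)
  generalize (K t x y u 0 0 0 0 0 Hp), (K t x y u 1 0 0 0 0 Hp),
    (K t x y u (-1) 0 0 0 0 Hp), (K t x y u 0 1 0 0 0 Hp), (K t x y u 0 0 1 0 0 Hp).
  cbv beta zeta. rewrite !(schwarz Vu Vx HB S3 _ _ _ _ Hp). reduce_on Hp.
  intros A0 A1 A2 A3 A4.
  unfold determining_at.
  repeat split; try now (apply E1 || apply E2 || apply E3 || apply E4 || apply E5).
  - apply Rmult_eq_reg_l with (x ^ 2); lra.
  - apply Rmult_eq_reg_l with x; [ | lra ].
    clear A1 A2 A3. ring_simplify in A0. ring_simplify in A4. ring_simplify. lra.
  - lra.
  - lra.
  - lra.
Qed.

Lemma determining_lie_symmetry B f X :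
  domain B -> (forall x, bx B x -> ex_derive f x) ->
  vf_smooth B X -> determining B f X -> lie_symmetry B f X.
Proof.
  intros HB Hf HX HD. split; [ exact HX | ]. intros j Hp HE.
  assert (S := HX). destruct S as (S0 & S1 & S2 & S3).
  rewrite (prolong2_Delta B f X j HB HX); [ | apply Hf, Hp ].
  rewrite (eta2_xx_formula B X _ HB HX Hp). cbv beta zeta. rewrite !eta1_formula.
  unfold sum3. cbn [first xi var_of].
  assert (E1 : eq_on B (pd Vx (xi0 X)) zero4) by (intros a b c d H; apply HD, H).
  assert (E2 : eq_on B (pd Vu (xi0 X)) zero4) by (intros a b c d H; apply HD, H).
  assert (E3 : eq_on B (pd Vx (xi2 X)) zero4) by (intros a b c d H; apply HD, H).
  assert (E4 : eq_on B (pd Vu (xi2 X)) zero4) by (intros a b c d H; apply HD, H).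
  assert (E5 : eq_on B (pd Vu (xi1 X)) zero4) by (intros a b c d H; apply HD, H).
  destruct (HD _ _ _ _ Hp) as (_ & _ & (_ & E6) & E7 & E8 & E9 & E10).
  unfold Delta in HE.
  assert (Hx : 0 < j J_x) by (apply HB, Hp).
  set (t := j J_t) in *. set (x := j J_x) in *. set (y := j J_y) in *. set (u := j J_u) in *.
  unfold on_jet. fold t x y u. cbv beta zeta in *.
  rewrite !(schwarz Vu Vx HB S3 _ _ _ _ Hp), E6. reduce_on Hp.
  replace (j J_ut) with (x ^ 2 * j J_uxx + f x * j J_uy) by lra.
  rewrite E10.
  (* With [E10] already inserted, the prolonged equation is a combination of the remaining
     determining equations with jet coordinates as multipliers. *)
  match goal with |- ?L = 0 => transitivity
    (j J_uxx * x * (2 * (x * pd Vx (xi1 X) t x y u - xi1 X t x y u)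
       - x * (pd Vt (xi0 X) t x y u - f x * pd Vy (xi0 X) t x y u))
     - j J_uy * (Derive f x * xi1 X t x y u - (f x ^ 2 * pd Vy (xi0 X) t x y u
        - f x * (pd Vt (xi0 X) t x y u - pd Vy (xi2 X) t x y u) - pd Vt (xi2 X) t x y u))
     - j J_ux * (x ^ 2 * (2 * pd Vx (pd Vu (eta X)) t x y u - pd Vx (pd Vx (xi1 X)) t x y u)
        - (f x * pd Vy (xi1 X) t x y u - pd Vt (xi1 X) t x y u)));
    [ ring | rewrite E7, E8, E9; ring ] end.
Qed.

(** * The reduced system *)

(** The operator D, that is d/dz for z = ln x. It turns x^2 d_x^2 into D^2 - D, which has constant
    coefficients. *)
Definition logD (f : R -> R) (x : R) : R := x * Derive f x.

Lemma smooth_logD B f : domain B -> smooth B (fun _ x _ _ => f x) ->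
  smooth B (fun _ x _ _ => logD f x).
Proof.
  intros HB Hf. apply (smooth_mult B (fun _ x _ _ => x) (pd Vx (fun _ x _ _ => f x)));
    [ exact HB | smooth_rec | smooth_rec ].
Qed.

(** [zeta] stands for xi1 / x and [A] for eta_u. In [red_c] the term D^2 zeta is already replaced by
    - Df tau_y / 2, its value by [red_a]. *)
Record reduced (B : box) (f : R -> R) (tau psi zeta A : fun4) : Prop := Reduced {
  red_tau : smooth B tau;
  red_psi : smooth B psi;
  red_zeta : smooth B zeta;
  red_A : smooth B A;
  red_tau_x : eq_on B (pd Vx tau) zero4;
  red_psi_x : eq_on B (pd Vx psi) zero4;
  red_a : eq_on B (fun t x y u => x * pd Vx zeta t x y u)
    (fun t x y u => (pd Vt tau t x y u - f x * pd Vy tau t x y u) / 2);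
  red_b : eq_on B (fun t x y u => logD f x * zeta t x y u)
    (fun t x y u => f x ^ 2 * pd Vy tau t x y u
       - f x * (pd Vt tau t x y u - pd Vy psi t x y u) - pd Vt psi t x y u);
  red_c : eq_on B (fun t x y u => 2 * (x * pd Vx A t x y u))
    (fun t x y u => f x * pd Vy zeta t x y u - pd Vt zeta t x y u
       + (pd Vt tau t x y u - f x * pd Vy tau t x y u) / 2
       - logD f x * pd Vy tau t x y u / 2);
  red_d : eq_on B (pd Vt A)
    (fun t x y u => x ^ 2 * pd Vx (pd Vx A) t x y u + f x * pd Vy A t x y u) }.

Definition zeta_of (X : vfield) : fun4 := fun t x y u => xi1 X t x y u / x.

Lemma in_box_x_pos {B t x y u} : domain B -> in_box B t x y u -> 0 < x.
Proof. intros HB Hp. apply HB, Hp. Qed.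

Lemma in_box_x_neq0 {B t x y u} : domain B -> in_box B t x y u -> x <> 0.
Proof. intros HB Hp. apply Rgt_not_eq, (in_box_x_pos HB Hp). Qed.

Lemma determining_reduced B f X :
  domain B -> smooth B (fun _ x _ _ => f x) -> vf_smooth B X -> determining B f X ->
  reduced B f (xi0 X) (xi2 X) (zeta_of X) (pd Vu (eta X)).
Proof.
  intros HB Sf (S0 & S1 & S2 & S3) HD.
  assert (Nx : forall t x y u, in_box B t x y u -> x <> 0).
  { intros t x y u. now apply in_box_x_neq0. }
  assert (Sz : smooth B (zeta_of X)) by (unfold zeta_of; smooth_rec).
  assert (E1 : eq_on B (pd Vx (xi0 X)) zero4) by (intros a b c d H; apply HD, H).
  assert (E3 : eq_on B (pd Vx (xi2 X)) zero4) by (intros a b c d H; apply HD, H).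
  assert (Z : eq_on B (xi1 X) (fun t x y u => x * zeta_of X t x y u)).
  { intros t x y u Hp. unfold zeta_of. field. now apply Nx with t y u. }
  assert (Zx : eq_on B (pd Vx (xi1 X))
                (fun t x y u => zeta_of X t x y u + x * pd Vx (zeta_of X) t x y u)).
  { intros t x y u Hp. rewrite (pd_ext Vx HB Z _ _ _ _ Hp).
    pd_compute B. ring. }
  assert (Ra : eq_on B (fun t x y u => x * pd Vx (zeta_of X) t x y u)
    (fun t x y u => (pd Vt (xi0 X) t x y u - f x * pd Vy (xi0 X) t x y u) / 2)).
  { intros t x y u Hp. destruct (HD _ _ _ _ Hp) as (_ & _ & _ & E7 & _).
    cbv beta zeta in E7. rewrite (Zx _ _ _ _ Hp), (Z _ _ _ _ Hp) in E7.
    apply Rmult_eq_reg_l with x; [ lra | now apply Nx with t y u ]. }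
  (* The x-derivative of [Ra], in which only f contributes because tau does not depend on x; it is
     needed to express xi1_xx. *)
  assert (Rax : forall t x y u, in_box B t x y u ->
     pd Vx (zeta_of X) t x y u + x * pd Vx (pd Vx (zeta_of X)) t x y u
     = - Derive f x * pd Vy (xi0 X) t x y u / 2).
  { intros t x y u Hp. assert (K := pd_ext Vx HB Ra _ _ _ _ Hp).
    assert (S1' := smooth_const B 2 HB).
    assert (N2 : 2 <> 0) by lra.
    revert K. pd_compute B.
    rewrite (schwarz Vx Vt HB S0 _ _ _ _ Hp), (schwarz Vx Vy HB S0 _ _ _ _ Hp).
    rewrite (pd_zero B Vx Vt _ HB E1 _ _ _ _ Hp), (pd_zero B Vx Vy _ HB E1 _ _ _ _ Hp).
    intros K. lra. }
  split; auto.
  - smooth_rec.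
  - intros t x y u Hp. destruct (HD _ _ _ _ Hp) as (_ & _ & _ & _ & E8 & _).
    cbv beta zeta in E8. rewrite <- E8, (Z _ _ _ _ Hp). unfold logD. ring.
  - intros t x y u Hp. destruct (HD _ _ _ _ Hp) as (_ & _ & _ & _ & _ & E9 & _).
    cbv beta zeta in E9. rewrite (pd_ext Vx HB Zx _ _ _ _ Hp) in E9.
    rewrite (pd_ext Vy HB Z _ _ _ _ Hp), (pd_ext Vt HB Z _ _ _ _ Hp) in E9.
    revert E9. pd_compute B. intros E9.
    assert (A1 := Ra _ _ _ _ Hp). assert (A2 := Rax _ _ _ _ Hp). cbv beta in A1.
    apply Rmult_eq_reg_l with x; [ | now apply Nx with t y u ].
    transitivity (x ^ 2 * (2 * pd Vx (pd Vu (eta X)) t x y u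
       - (pd Vx (zeta_of X) t x y u + (1 * pd Vx (zeta_of X) t x y u
          + x * pd Vx (pd Vx (zeta_of X)) t x y u)))
       + x * (x * pd Vx (zeta_of X) t x y u)
       + x * x * (pd Vx (zeta_of X) t x y u + x * pd Vx (pd Vx (zeta_of X)) t x y u));
      [ ring | ].
    rewrite E9, A1, A2. unfold logD. field.
  (* The equation for [eta] holds identically in u, so its u-derivative is the same equation for
     eta_u. *)
  - assert (E10 : eq_on B (pd Vt (eta X))
       (fun t x y u => x ^ 2 * pd Vx (pd Vx (eta X)) t x y u + f x * pd Vy (eta X) t x y u)).
    { intros a b c d H; apply HD, H. }
    intros t x y u Hp.
    rewrite (schwarz Vt Vu HB S3 _ _ _ _ Hp).
    rewrite (pd_ext Vu HB E10 _ _ _ _ Hp). pd_compute B.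
    rewrite (schwarz Vy Vu HB S3 _ _ _ _ Hp).
    rewrite (pd_ext Vx HB (schwarz Vx Vu HB S3) _ _ _ _ Hp).
    rewrite (schwarz Vx Vu HB (smooth_pd _ _ _ S3) _ _ _ _ Hp). ring.
Qed.

(* When S is a primitive of (zeta_t - f zeta_y) / x in x, this is the constant of integration
   of [red_c]. *)
Definition gauge_rest (f : R -> R) (tau zeta A S : fun4) : fun4 := fun t x y u =>
  2 * A t x y u - zeta t x y u
  - (pd Vt tau t x y u - f x * pd Vy tau t x y u) / 2 + S t x y u.

Lemma gauge_rest_smooth B f tau psi zeta A S :
  domain B -> smooth B (fun _ x _ _ => f x) -> reduced B f tau psi zeta A ->
  smooth B S -> smooth B (gauge_rest f tau zeta A S).
Proof.
  intros HB Sf HR SS. destruct HR as [St Sp Sz SA _ _ _ _ _ _].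
  assert (N2 : 2 <> 0) by lra. unfold gauge_rest. smooth_rec.
Qed.

(** With D S = Y zeta, [red_c] says 2 DA = D (zeta + D zeta - S). *)
Lemma gauge_rest_x B f tau psi zeta A S :
  domain B -> smooth B (fun _ x _ _ => f x) -> reduced B f tau psi zeta A ->
  smooth B S ->
  eq_on B (fun t x y u => x * pd Vx S t x y u)
    (fun t x y u => pd Vt zeta t x y u - f x * pd Vy zeta t x y u) ->
  eq_on B (pd Vx (gauge_rest f tau zeta A S)) zero4.
Proof.
  intros HB Sf HR SS HS t x y u Hp.
  destruct HR as [St Sp Sz SA Tx Px Ra _ Rc _].
  assert (N2 : 2 <> 0) by lra. assert (Nx := in_box_x_neq0 HB Hp).
  unfold gauge_rest. pd_compute B.
  rewrite (schwarz Vx Vt HB St _ _ _ _ Hp), (schwarz Vx Vy HB St _ _ _ _ Hp).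
  rewrite (pd_zero B Vx Vt _ HB Tx _ _ _ _ Hp), (pd_zero B Vx Vy _ HB Tx _ _ _ _ Hp).
  assert (K1 := Ra _ _ _ _ Hp). assert (K2 := Rc _ _ _ _ Hp). assert (K3 := HS _ _ _ _ Hp).
  cbv beta in K1, K2, K3. unfold logD in K2.
  apply Rmult_eq_reg_l with x; [ | exact Nx ].
  transitivity (2 * (x * pd Vx A t x y u) - x * pd Vx zeta t x y u
     + x * Derive f x * pd Vy tau t x y u / 2 + x * pd Vx S t x y u); [ field | ].
  rewrite K1, K2, K3. field.
Qed.

(** Substitute 2A = al + zeta + D zeta - S into YA = D^2 A - DA. Because D al = 0, D S = Y zeta and
    D (Y zeta) = Y (D zeta) - Df zeta_y, the terms Y zeta cancel. The term D^2 f comes from D^3 zeta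
    = - tau_y D^2 f / 2, and the quadratic in f from 2 Y (D zeta) = Y (Y tau). *)
Lemma gauge_identity B f tau psi zeta A S :
  domain B -> smooth B (fun _ x _ _ => f x) -> reduced B f tau psi zeta A ->
  smooth B S ->
  eq_on B (fun t x y u => x * pd Vx S t x y u)
    (fun t x y u => pd Vt zeta t x y u - f x * pd Vy zeta t x y u) ->
  forall t x y u, in_box B t x y u ->
  let al := gauge_rest f tau zeta A S in
  pd Vy tau t x y u * logD (logD f) x / 2
  = - (pd Vt al t x y u - f x * pd Vy al t x y u)
    - (pd Vt (pd Vt tau) t x y u - 2 * f x * pd Vy (pd Vt tau) t x y u
       + f x ^ 2 * pd Vy (pd Vy tau) t x y u)
    + logD f x * pd Vy zeta t x y u
    + (pd Vt S t x y u - f x * pd Vy S t x y u)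
    - (pd Vt tau t x y u - f x * pd Vy tau t x y u) / 2.
Proof.
  intros HB Sf HR SS HS t x y u Hp al.
  destruct HR as [St Sp Sz SA Tx Px Ra _ Rc Rd].
  assert (N2 : 2 <> 0) by lra. assert (Nx := in_box_x_neq0 HB Hp).
  assert (Sf1 := smooth_logD B f HB Sf).
  assert (At : pd Vt al t x y u = 2 * pd Vt A t x y u - pd Vt zeta t x y u
      - (pd Vt (pd Vt tau) t x y u - f x * pd Vy (pd Vt tau) t x y u) / 2
      + pd Vt S t x y u).
  { unfold al, gauge_rest. pd_compute B.
    rewrite (schwarz Vt Vy HB St _ _ _ _ Hp). field. }
  assert (Ay : pd Vy al t x y u = 2 * pd Vy A t x y u - pd Vy zeta t x y u
      - (pd Vy (pd Vt tau) t x y u - f x * pd Vy (pd Vy tau) t x y u) / 2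
      + pd Vy S t x y u).
  { unfold al, gauge_rest. pd_compute B. field. }
  assert (Zt : x * pd Vx (pd Vt zeta) t x y u
      = (pd Vt (pd Vt tau) t x y u - f x * pd Vy (pd Vt tau) t x y u) / 2).
  { assert (K := pd_ext Vt HB Ra _ _ _ _ Hp). revert K. pd_compute B.
    rewrite (schwarz Vt Vy HB St _ _ _ _ Hp).
    rewrite (schwarz Vx Vt HB Sz _ _ _ _ Hp). intros K. lra. }
  assert (Zy : x * pd Vx (pd Vy zeta) t x y u
      = (pd Vy (pd Vt tau) t x y u - f x * pd Vy (pd Vy tau) t x y u) / 2).
  { assert (K := pd_ext Vy HB Ra _ _ _ _ Hp). revert K. pd_compute B.
    rewrite (schwarz Vx Vy HB Sz _ _ _ _ Hp). intros K. lra. }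
  assert (Ac : 2 * (pd Vx A t x y u + x * pd Vx (pd Vx A) t x y u)
     = Derive f x * pd Vy zeta t x y u + f x * pd Vx (pd Vy zeta) t x y u
       - pd Vx (pd Vt zeta) t x y u
       - Derive f x * pd Vy tau t x y u / 2
       - Derive (logD f) x * pd Vy tau t x y u / 2).
  { assert (K := pd_ext Vx HB Rc _ _ _ _ Hp). revert K. pd_compute B.
    rewrite (schwarz Vx Vt HB St _ _ _ _ Hp), (schwarz Vx Vy HB St _ _ _ _ Hp).
    rewrite (pd_zero B Vx Vt _ HB Tx _ _ _ _ Hp), (pd_zero B Vx Vy _ HB Tx _ _ _ _ Hp).
    intros K. lra. }
  assert (K2 := Rc _ _ _ _ Hp). assert (K4 := Rd _ _ _ _ Hp). cbv beta in K2, K4.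
  rewrite At, Ay, K4. unfold logD at 1.
  assert (Ac' : x ^ 2 * (2 * pd Vx (pd Vx A) t x y u)
     = logD f x * pd Vy zeta t x y u + f x * (x * pd Vx (pd Vy zeta) t x y u)
       - x * pd Vx (pd Vt zeta) t x y u
       - logD f x * pd Vy tau t x y u / 2
       - x * Derive (logD f) x * pd Vy tau t x y u / 2
       - 2 * (x * pd Vx A t x y u)).
  { transitivity (x * (2 * (pd Vx A t x y u + x * pd Vx (pd Vx A) t x y u))
                  - 2 * (x * pd Vx A t x y u)); [ ring | ].
    rewrite Ac. unfold logD. field. }
  rewrite Zt, Zy, K2 in Ac'. lra.
Qed.

(** * Exclusion of tau_y <> 0 *)

Fixpoint horner (l : list R) (s : R) : R :=
  match l with [] => 0 | c :: l' => c + s * horner l' s end.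

(** For the polynomial P of [l] these are the coefficients of k P + s P'. With k = 1 this is the
    derivative of s P(s), which is how the derivative of a list [c :: l] arises. *)
Fixpoint weight_coeffs (k : nat) (l : list R) : list R :=
  match l with [] => [] | c :: l' => INR k * c :: weight_coeffs (S k) l' end.

Lemma is_derive_horner l s :
  exists d, is_derive (horner l) s d /\
    forall k, INR k * horner l s + s * d = horner (weight_coeffs k l) s.
Proof.
  induction l as [|c l (d & Hd & IH)].
  - exists 0. split; [ exact (is_derive_const 0 s) | intros k; simpl; ring ].
  - exists (horner l s + s * d). split.
    + simpl. auto_derive; [ now exists d | ].
      change (fun x => horner l x) with (horner l). rewrite (is_derive_unique _ _ _ Hd). ring.
    + intros k. cbn [horner weight_coeffs]. rewrite <- IH, S_INR. ring.
Qed.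

Lemma is_derive_horner_cons c l s :
  is_derive (horner (c :: l)) s (horner (weight_coeffs 1 l) s).
Proof.
  destruct (is_derive_horner l s) as (d & Hd & K). rewrite <- K. simpl.
  auto_derive; [ now exists d | ].
  change (fun x => horner l x) with (horner l). rewrite (is_derive_unique _ _ _ Hd). ring.
Qed.

Lemma weight_coeffs_zero k l : (0 < k)%nat ->
  List.Forall (fun c => c = 0) (weight_coeffs k l) -> List.Forall (fun c => c = 0) l.
Proof.
  revert k. induction l as [|c l IH]; intros k Hk H; constructor; inversion H; subst.
  - apply Rmult_eq_reg_l with (INR k); [ lra | ]. apply not_0_INR. lia.
  - apply IH with (S k); [ lia | assumption ].
Qed.

Lemma weight_coeffs_length k l : length (weight_coeffs k l) = length l.
Proof. revert k. induction l; intros k; simpl; auto. Qed.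

(** Differentiating the identity and cancelling f' lowers the degree by one, so induction kills all
    coefficients except the constant one, which is then the value of the polynomial. *)
Lemma horner_zero (J : R -> Prop) (f f' : R -> R) l :
  open J -> (exists a, J a) ->
  (forall x, J x -> is_derive f x (f' x) /\ f' x <> 0) ->
  (forall x, J x -> horner l (f x) = 0) -> List.Forall (fun c => c = 0) l.
Proof.
  intros OJ [x0 Hx0] Hf. remember (length l) as n eqn:Hn. revert l Hn.
  induction n as [|n IH]; intros [|c l] Hn H0; try discriminate; [ constructor | ].
  assert (Hl : List.Forall (fun c => c = 0) l).
  { apply weight_coeffs_zero with 1%nat; [ lia | ]. apply IH.
    - rewrite weight_coeffs_length. simpl in Hn. congruence.
    - intros x Hx. destruct (Hf x Hx) as [D N].
      assert (D1 := is_derive_comp (horner (c :: l)) f x _ _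
                      (is_derive_horner_cons c l (f x)) D).
      assert (D2 : is_derive (fun x => horner (c :: l) (f x)) x 0).
      { apply is_derive_ext_loc with (fun _ => 0); [ | exact (is_derive_const 0 x) ].
        generalize (OJ x Hx). apply filter_imp. intros y Hy. symmetry. now apply H0. }
      apply is_derive_unique in D1. apply is_derive_unique in D2. rewrite D1 in D2.
      change (f' x * horner (weight_coeffs 1 l) (f x) = 0) in D2.
      apply Rmult_integral in D2. tauto. }
  constructor; [ | exact Hl ].
  specialize (H0 x0 Hx0). simpl in H0.
  assert (Z : forall s, horner l s = 0).
  { intros s. clear - Hl. induction Hl as [|c l Hc _ IH]; simpl; [ reflexivity | ].
    rewrite Hc, IH. ring. }
  rewrite Z in H0. lra.
Qed.

(** * Incompatible differential equations for f *)

(** [f1] and [f2] play the roles of Df and D^2 f, so that the contradictions below concern ordinary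
    differential equations alone, without symmetries or boxes. *)
Record log_derivatives (J : R -> Prop) (f f1 f2 : R -> R) : Prop := LogDerivatives {
  ld_interval : open_interval J;
  ld_pos : forall x, J x -> 0 < x;
  ld_f : forall x, J x -> is_derive f x (f1 x / x);
  ld_f1 : forall x, J x -> is_derive f1 x (f2 x / x);
  ld_nz : forall x, J x -> f1 x <> 0 }.

Lemma log_derivatives_horner J f f1 f2 l : log_derivatives J f f1 f2 ->
  (forall x, J x -> horner l (f x) = 0) -> List.Forall (fun c => c = 0) l.
Proof.
  intros [(OJ & EJ & _) P D _ N]. apply horner_zero with (fun x => f1 x / x); auto.
  intros x Hx. split; [ now apply D | ]. specialize (P x Hx). specialize (N x Hx).
  apply Rmult_integral_contrapositive_currified; [ exact N | ].
  apply Rinv_neq_0_compat. lra.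
Qed.

(** Multiplying D^2 f = k1 f + k0 by 2 Df and integrating gives (Df)^2 = k1 f^2 + 2 k0 f + k2. In
    the first relation the coefficients of f^3, f^2 and f then give (3/2) k1 = 0, 4 k0 = 0 and (5/2)
    k2 = 0 in turn, so Df = 0. *)
Lemma affine_second_derivative J f f1 f2 b c b' k0 k1 :
  log_derivatives J f f1 f2 ->
  (forall x, J x -> f2 x * (f x ^ 2 + b * f x + c) = f1 x ^ 2 * (5 / 2 * f x + b')) ->
  (forall x, J x -> f2 x = k1 * f x + k0) -> False.
Proof.
  intros HL HQ H2. assert (HL' := HL). destruct HL' as [(OJ & [x0 Hx0] & CJ) P D1 D2 N].
  set (E := fun x => f1 x ^ 2 - k1 * f x ^ 2 - 2 * k0 * f x).
  assert (C : forall x, J x -> E x = E x0).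
  { intros x Hx. apply derive_zero_constant with J; auto.
    intros s Hs. unfold E. specialize (D1 s Hs). specialize (D2 s Hs). specialize (P s Hs).
    auto_derive; [ split; [ now exists (f2 s / s) | split; [ now exists (f1 s / s) | ] ];
      try split; try easy; now exists (f1 s / s) | ].
    rewrite_derive D1. rewrite_derive D2. rewrite (H2 s Hs).
    field. lra. }
  set (k2 := E x0) in *.
  assert (Z := log_derivatives_horner J f f1 f2
    [k2 * b' - k0 * c; 5 / 2 * k2 + 2 * k0 * b' - k1 * c - k0 * b;
     5 * k0 + k1 * b' - k0 - k1 * b; 5 / 2 * k1 - k1] HL).
  assert (Z' : List.Forall (fun c0 => c0 = 0)
    [k2 * b' - k0 * c; 5 / 2 * k2 + 2 * k0 * b' - k1 * c - k0 * b;
     5 * k0 + k1 * b' - k0 - k1 * b; 5 / 2 * k1 - k1]).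
  { apply Z. intros x Hx. specialize (HQ x Hx). specialize (C x Hx).
    unfold E in C. simpl. rewrite (H2 x Hx) in HQ.
    replace (f1 x ^ 2) with (k1 * f x ^ 2 + 2 * k0 * f x + k2) in HQ by lra. lra. }
  clear Z. apply Forall_inv_tail in Z'. assert (A1 := Forall_inv Z').
  apply Forall_inv_tail in Z'. assert (A2 := Forall_inv Z').
  apply Forall_inv_tail in Z'. assert (A3 := Forall_inv Z'). cbv beta in A1, A2, A3.
  assert (k1 = 0) by lra. subst k1. assert (k0 = 0) by lra. subst k0.
  assert (K2 : k2 = 0) by lra. unfold k2, E in K2. apply (N x0 Hx0).
  assert (f1 x0 ^ 2 = 0) by lra. apply Rmult_integral in H. lra.
Qed.

(** By partial fractions the first relation says D^2 f / (Df)^2 = 1/(f - e) + (3/2)/(f + g), which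
    integrates to (Df)^2 = K (f - e)^2 (f + g)^3. Multiplied by K (f + g), the last relation becomes
    polynomial in f, with f^5 occurring only with coefficient (5/2) K^2. Hence K = 0 and Df = 0. *)
Lemma roots_contradiction J f f1 f2 e g q0 q1 q2 m0 m1 :
  log_derivatives J f f1 f2 ->
  (forall x, J x -> (f x - e) * (f x + g) <> 0) ->
  (forall x, J x -> f2 x * ((f x - e) * (f x + g))
                    = f1 x ^ 2 * (5 / 2 * f x + (g - 3 / 2 * e))) ->
  (forall x, J x -> f2 x = q2 * f x ^ 2 + q1 * f x + q0
                           + (m0 + m1 * f x) * ((f x - e) * (f x + g) / f1 x) ^ 2) -> False.
Proof.
  intros HL HN HQ H2. assert (HL' := HL). destruct HL' as [(OJ & [x0 Hx0] & CJ) P D1 D2 N].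
  assert (HN1 : forall x, J x -> f x - e <> 0 /\ f x + g <> 0).
  { intros x Hx. specialize (HN x Hx). split; intros Z; apply HN; rewrite Z; ring. }
  set (E := fun x => f1 x ^ 2 / ((f x - e) ^ 2 * (f x + g) ^ 3)).
  assert (C : forall x, J x -> E x = E x0).
  { intros x Hx. apply derive_zero_constant with J; auto.
    intros s Hs. unfold E. specialize (D1 s Hs). specialize (D2 s Hs). specialize (P s Hs).
    destruct (HN1 s Hs) as [N1 N2].
    assert (F2 : f2 s = f1 s ^ 2 * (5 / 2 * f s + (g - 3 / 2 * e)) / ((f s - e) * (f s + g))).
    { rewrite <- (HQ s Hs). field. tauto. }
    auto_derive.
    - repeat split; try (now exists (f1 s / s)); try (now exists (f2 s / s)).
      repeat apply Rmult_integral_contrapositive_currified; auto; lra.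
    - rewrite_derive D1. rewrite_derive D2. rewrite F2.
      field. repeat split; auto; lra. }
  set (K := E x0) in *.
  assert (HK : forall x, J x -> f1 x ^ 2 = K * (f x - e) ^ 2 * (f x + g) ^ 3).
  { intros x Hx. rewrite <- (C x Hx). unfold E. destruct (HN1 x Hx). field. tauto. }
  assert (Z' : List.Forall (fun c0 => c0 = 0)
    [ K ^ 2 * (- e * g ^ 3 * (g - 3 / 2 * e)) - K * g * q0 - m0;
      K ^ 2 * ((g ^ 3 - 3 * e * g ^ 2) * (g - 3 / 2 * e) - 5 / 2 * e * g ^ 3)
        - K * (q0 + g * q1) - m1;
      K ^ 2 * ((3 * g ^ 2 - 3 * e * g) * (g - 3 / 2 * e) + 5 / 2 * (g ^ 3 - 3 * e * g ^ 2))
        - K * (q1 + g * q2);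
      K ^ 2 * ((3 * g - e) * (g - 3 / 2 * e) + 5 / 2 * (3 * g ^ 2 - 3 * e * g)) - K * q2;
      K ^ 2 * ((g - 3 / 2 * e) + 5 / 2 * (3 * g - e));
      K ^ 2 * (5 / 2) ]).
  { apply (log_derivatives_horner J f f1 f2); [ exact HL | ]. intros x Hx.
    destruct (HN1 x Hx) as [N1 N2]. assert (N0 := N x Hx).
    assert (F2 : f2 x = K * (f x - e) * (f x + g) ^ 2 * (5 / 2 * f x + (g - 3 / 2 * e))).
    { apply Rmult_eq_reg_r with ((f x - e) * (f x + g)); [ | auto ].
      rewrite (HQ x Hx), (HK x Hx). ring. }
    assert (W : K * (f x + g) * ((f x - e) * (f x + g) / f1 x) ^ 2 = 1).
    { transitivity (K * (f x + g) * ((f x - e) * (f x + g)) ^ 2 / f1 x ^ 2).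
      - field. exact N0.
      - rewrite (HK x Hx). field. repeat split; auto. intros Z. apply N0.
        assert (HH := HK x Hx). rewrite Z in HH.
        assert (f1 x ^ 2 = 0) by (rewrite HH; ring). apply Rmult_integral in H. lra. }
    assert (T := H2 x Hx). rewrite F2 in T.
    set (W2 := ((f x - e) * (f x + g) / f1 x) ^ 2) in *.
    transitivity (K * (f x + g) * (K * (f x - e) * (f x + g) ^ 2
        * (5 / 2 * f x + (g - 3 / 2 * e)))
      - K * (f x + g) * (q2 * f x ^ 2 + q1 * f x + q0) - (m0 + m1 * f x));
      [ simpl; field | ].
    rewrite T. transitivity ((m0 + m1 * f x) * (K * (f x + g) * W2 - 1)); [ ring | ].
    rewrite W. ring. }
  do 5 apply Forall_inv_tail in Z'. apply Forall_inv in Z'.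
  apply (N x0 Hx0).
  assert (A' : K * K = 0) by lra.
  assert (K0 : K = 0) by (apply Rmult_integral in A'; tauto).
  assert (f1 x0 ^ 2 = 0) by (rewrite (HK x0 Hx0), K0; ring). apply Rmult_integral in H. lra.
Qed.

(** * The two alternatives for tau_y <> 0 *)

Lemma smooth_of_x_derive B f x : domain B -> smooth B (fun _ x _ _ => f x) -> bx B x ->
  is_derive f x (logD f x / x).
Proof.
  intros HB Sf Hx. destruct (domain_point B HB) as (t & x0 & y & u & Hp).
  assert (Hq := in_box_x Hp Hx).
  assert (D := smooth_ex_pd B _ Vx t x y u Sf Hq).
  unfold logD. replace (x * Derive f x / x) with (Derive f x).
  - apply Derive_correct. exact D.
  - field. exact (in_box_x_neq0 HB Hq).
Qed.

Lemma log_derivatives_logD B f : domain B -> smooth B (fun _ x _ _ => f x) ->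
  (forall x, bx B x -> logD f x <> 0) ->
  log_derivatives (bx B) f (logD f) (logD (logD f)).
Proof.
  intros HB Sf HN. split.
  - apply HB.
  - apply HB.
  - intros x Hx. now apply smooth_of_x_derive with B.
  - intros x Hx. apply smooth_of_x_derive with B; auto. now apply smooth_logD.
  - exact HN.
Qed.

(* The x-derivative of [red_b], with zeta eliminated. *)
Lemma reduced_quadratic B f tau psi zeta A :
  domain B -> smooth B (fun _ x _ _ => f x) -> reduced B f tau psi zeta A ->
  forall t x y u, in_box B t x y u ->
  logD (logD f) x * (f x ^ 2 * pd Vy tau t x y u
       + f x * (pd Vy psi t x y u - pd Vt tau t x y u) - pd Vt psi t x y u)
  = logD f x ^ 2 * (5 / 2 * f x * pd Vy tau t x y u
                    + pd Vy psi t x y u - 3 / 2 * pd Vt tau t x y u).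
Proof.
  intros HB Sf HR t x y u Hp.
  destruct HR as [St Sp Sz SA Tx Px Ra Rb Rc Rd].
  assert (Sf1 := smooth_logD B f HB Sf).
  assert (K := pd_ext Vx HB Rb _ _ _ _ Hp). revert K. pd_compute B.
  rewrite (pd_zero_comm B Vx Vy tau HB St Tx _ _ _ _ Hp),
    (pd_zero_comm B Vx Vt tau HB St Tx _ _ _ _ Hp),
    (pd_zero_comm B Vx Vy psi HB Sp Px _ _ _ _ Hp),
    (pd_zero_comm B Vx Vt psi HB Sp Px _ _ _ _ Hp).
  intros K. assert (Kb := Rb _ _ _ _ Hp). assert (Ka := Ra _ _ _ _ Hp).
  cbv beta in Kb, Ka. simpl (INR 2) in K. simpl (Nat.pred 2) in K.
  assert (Nx := in_box_x_neq0 HB Hp).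
  transitivity (x * logD f x * (Derive (logD f) x * zeta t x y u
      + logD f x * pd Vx zeta t x y u) - logD f x ^ 2 * (x * pd Vx zeta t x y u)).
  - replace (f x ^ 2 * pd Vy tau t x y u
       + f x * (pd Vy psi t x y u - pd Vt tau t x y u) - pd Vt psi t x y u)
      with (logD f x * zeta t x y u) by (rewrite Kb; ring).
    unfold logD at 1. ring.
  - rewrite K, Ka. unfold logD. field.
Qed.

(** The case in which Q is mu = tau_y times the fixed polynomial f^2 + b f + c. Then zeta = mu w
    with D w = (e - f)/2, and S = mu_y w^2 is a primitive of Y zeta = (e - f) mu_y w. Now psi_ty =
    psi_yt leaves two cases: e is a root of f^2 + b f + c and - (b + e) the other one, or mu_y = 0,
    so that S = 0 and D^2 f is affine in f. *)
Lemma proportional_contradiction B f tau psi zeta A b c e :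
  domain B -> smooth B (fun _ x _ _ => f x) -> reduced B f tau psi zeta A ->
  (forall x, bx B x -> logD f x <> 0) ->
  (forall t x y u, in_box B t x y u -> pd Vy tau t x y u <> 0) ->
  (forall x, bx B x -> f x ^ 2 + b * f x + c <> 0) ->
  eq_on B (pd Vt tau) (fun t x y u => e * pd Vy tau t x y u) ->
  eq_on B (pd Vy psi) (fun t x y u => (b + e) * pd Vy tau t x y u) ->
  eq_on B (pd Vt psi) (fun t x y u => - c * pd Vy tau t x y u) -> False.
Proof.
  intros HB Sf HR HN Hmu HQ Et Ey Ept.
  assert (HL := log_derivatives_logD B f HB Sf HN).
  assert (Sf1 := smooth_logD B f HB Sf).
  assert (HR' := HR). destruct HR' as [St Sp Sz SA Tx Px Ra Rb Rc Rd].
  assert (Nf : forall t x y u, in_box B t x y u -> logD f x <> 0).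
  { intros t x y u Hp. apply HN, Hp. }
  set (mu := pd Vy tau) in *.
  assert (Smu : smooth B mu) by (unfold mu; smooth_rec).
  assert (Mx : eq_on B (pd Vx mu) zero4) by now apply pd_zero_comm.
  assert (Mt : eq_on B (pd Vt mu) (fun t x y u => e * pd Vy mu t x y u)).
  { intros t x y u Hp. unfold mu at 1. rewrite (schwarz Vt Vy HB St _ _ _ _ Hp).
    revert t x y u Hp. pd_from Et. }
  assert (Mc : forall t x y u, in_box B t x y u ->
             (c + (b + e) * e) * pd Vy mu t x y u = 0).
  { intros t x y u Hp. assert (K := schwarz Vt Vy HB Sp _ _ _ _ Hp). revert K.
    rewrite (pd_ext Vt HB Ey _ _ _ _ Hp), (pd_ext Vy HB Ept _ _ _ _ Hp).
    pd_compute B. reduce_on Hp. intros K. lra. }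
  set (w := fun x => (f x ^ 2 + b * f x + c) / logD f x).
  assert (Sw : smooth B (fun _ x _ _ => w x)) by (unfold w; smooth_rec).
  assert (Zw : eq_on B zeta (fun t x y u => mu t x y u * w x)).
  { intros t x y u Hp. assert (K := Rb _ _ _ _ Hp). cbv beta in K.
    rewrite (Et _ _ _ _ Hp), (Ey _ _ _ _ Hp), (Ept _ _ _ _ Hp) in K.
    unfold w. apply Rmult_eq_reg_l with (logD f x); [ | now apply Nf with t y u ].
    rewrite K. field. now apply Nf with t y u. }
  assert (Zt : eq_on B (pd Vt zeta) (fun t x y u => e * pd Vy mu t x y u * w x)).
  { pd_from Zw. }
  assert (Zy : eq_on B (pd Vy zeta) (fun t x y u => pd Vy mu t x y u * w x)).
  { pd_from Zw. }
  assert (Dw : forall t x y u, in_box B t x y u -> x * Derive w x = (e - f x) / 2).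
  { intros t x y u Hp. assert (K := Ra _ _ _ _ Hp). cbv beta in K.
    rewrite (pd_ext Vx HB Zw _ _ _ _ Hp) in K. revert K. pd_compute B.
    rewrite (Mx _ _ _ _ Hp), (Et _ _ _ _ Hp). fold mu. intros K.
    apply Rmult_eq_reg_l with (mu t x y u); [ lra | now apply Hmu ]. }
  set (S := fun t x y u : R => pd Vy mu t x y u * w x ^ 2).
  assert (SS : smooth B S) by (unfold S; smooth_rec).
  assert (HS : eq_on B (fun t x y u => x * pd Vx S t x y u)
    (fun t x y u => pd Vt zeta t x y u - f x * pd Vy zeta t x y u)).
  { intros t x y u Hp. unfold S. pd_compute B. reduce_on Hp. simpl INR. simpl Nat.pred.
    transitivity (2 * pd Vy mu t x y u * w x * (x * Derive w x)); [ ring | ].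
    rewrite (Dw _ _ _ _ Hp). field. }
  set (al := gauge_rest f tau zeta A S).
  assert (Sal : smooth B al) by now apply gauge_rest_smooth with psi.
  assert (Ax := gauge_rest_x B f tau psi zeta A S HB Sf HR SS HS). fold al in Ax.
  assert (G := gauge_identity B f tau psi zeta A S HB Sf HR SS HS). fold al in G. fold mu in G.
  assert (Ttt : eq_on B (pd Vt (pd Vt tau)) (fun t x y u => e ^ 2 * pd Vy mu t x y u)).
  { pd_from Et. }
  assert (Tty : eq_on B (pd Vy (pd Vt tau)) (fun t x y u => e * pd Vy mu t x y u)).
  { pd_from Et. }
  assert (Stt : eq_on B (pd Vt S) (fun t x y u => e * pd Vy (pd Vy mu) t x y u * w x ^ 2)).
  { intros t x y u Hp. unfold S. pd_compute B.
    rewrite (schwarz Vt Vy HB Smu _ _ _ _ Hp).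
    rewrite (pd_ext Vy HB Mt _ _ _ _ Hp). pd_compute B. ring. }
  assert (Sy : eq_on B (pd Vy S) (fun t x y u => pd Vy (pd Vy mu) t x y u * w x ^ 2)).
  { intros t x y u Hp. unfold S. pd_compute B. ring. }
  destruct (domain_point B HB) as (t0 & x0 & y0 & u0 & Hp00).
  assert (Hx0 := proj1 (proj2 Hp00)).
  assert (Hp0 : forall x, bx B x -> in_box B t0 x y0 u0) 
    by (intros x; exact (in_box_x Hp00)).
  set (m0 := mu t0 x0 y0 u0). set (m1 := pd Vy mu t0 x0 y0 u0).
  set (m2 := pd Vy (pd Vy mu) t0 x0 y0 u0).
  set (a0 := pd Vt al t0 x0 y0 u0). set (a1 := pd Vy al t0 x0 y0 u0).
  assert (M0 : m0 <> 0) by now apply Hmu, Hp0.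
  assert (G0 : forall x, bx B x -> m0 * logD (logD f) x / 2
     = - (a0 - f x * a1)
       - (e ^ 2 * m1 - 2 * f x * (e * m1) + f x ^ 2 * m1)
       + m1 * (f x ^ 2 + b * f x + c)
       + (e - f x) * m2 * w x ^ 2 - (e - f x) * m0 / 2).
  { intros x Hx. assert (Hp := Hp0 x Hx). assert (K := G _ _ _ _ Hp). cbv beta zeta in K.
    assert (Hq := Hp0 x0 Hx0). revert K. reduce_on Hp. shift_x Hq Hx. intros K.
    fold m0 m1 m2 a0 a1 in K. rewrite K.
    replace (f x ^ 2 + b * f x + c) with (logD f x * w x).
    - field.
    - unfold w. field. now apply HN. }
  assert (Q0 : forall x, bx B x -> logD (logD f) x * (f x ^ 2 + b * f x + c)
             = logD f x ^ 2 * (5 / 2 * f x + (b - e / 2))).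
  { intros x Hx. assert (Hp := Hp0 x Hx).
    assert (K := reduced_quadratic B f tau psi zeta A HB Sf HR _ _ _ _ Hp). fold mu in K.
    rewrite (Et _ _ _ _ Hp), (Ey _ _ _ _ Hp), (Ept _ _ _ _ Hp) in K.
    apply Rmult_eq_reg_r with (mu t0 x y0 u0); [ lra | now apply Hmu ]. }
  destruct (Req_dec (c + (b + e) * e) 0) as [Hc|Hc].
  - assert (EQ : forall x, (f x - e) * (f x + (b + e)) = f x ^ 2 + b * f x + c).
    { intros x. replace c with (- (b + e) * e) by lra. ring. }
    (* The coefficients of [G0] times 2 / m0: those of 1, f and f^2, the last being 0 by
       cancellation, then the two that multiply w^2. *)
    apply (roots_contradiction (bx B) f (logD f) (logD (logD f)) e (b + e)
      (2 * (- a0 - e ^ 2 * m1 + m1 * c - e * m0 / 2) / m0)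
      (2 * (a1 + 2 * e * m1 + m1 * b + m0 / 2) / m0) 0 (2 * m2 * e / m0)
      (- (2 * m2 / m0)) HL).
    + intros x Hx. rewrite EQ. now apply HQ.
    + intros x Hx. rewrite EQ, (Q0 x Hx). field.
    + intros x Hx. rewrite EQ. fold (w x). apply Rmult_eq_reg_l with (m0 / 2); [ | lra ].
      transitivity (m0 * logD (logD f) x / 2); [ field | ]. rewrite (G0 x Hx). field. exact M0.
  - assert (Z1 : forall t x y u, in_box B t x y u -> pd Vy mu t x y u = 0).
    { intros t x y u Hp. destruct (Rmult_integral _ _ (Mc _ _ _ _ Hp)); tauto. }
    assert (M1 : m1 = 0) by now apply Z1, Hp0.
    assert (M2 : m2 = 0).
    { unfold m2. rewrite (pd_ext Vy HB Z1 _ _ _ _ (Hp0 x0 Hx0)).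
      apply pd_const. }
    apply (affine_second_derivative (bx B) f (logD f) (logD (logD f)) b c (b - e / 2)
      (2 * (- a0 - e * m0 / 2) / m0) (2 * (a1 + m0 / 2) / m0) HL Q0).
    intros x Hx. apply Rmult_eq_reg_l with (m0 / 2); [ | lra ].
    transitivity (m0 * logD (logD f) x / 2); [ field | ]. rewrite (G0 x Hx), M1, M2.
    field. exact M0.
Qed.

(** The case L/Q = (5/2)/(f - s). At every point f - s divides Q, so Q = a (f - s)^2 + G (f - s) and
    zeta = a v + G w. With a primitive S of Y zeta, YS turns out to be affine in f times v^2, and
    [roots_contradiction] applies with e = s and g = - s. *)
Lemma shared_root_contradiction B f tau psi zeta A s :
  domain B -> smooth B (fun _ x _ _ => f x) -> reduced B f tau psi zeta A ->
  (forall x, bx B x -> logD f x <> 0) ->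
  (forall x, bx B x -> logD (logD f) x * (f x - s) = 5 / 2 * logD f x ^ 2) ->
  (forall t x y u, in_box B t x y u -> pd Vy tau t x y u <> 0) -> False.
Proof.
  intros HB Sf HR HN Hs Hmu.
  assert (HL := log_derivatives_logD B f HB Sf HN).
  assert (Sf1 := smooth_logD B f HB Sf).
  assert (HR' := HR). destruct HR' as [St Sp Sz SA Tx Px Ra Rb Rc Rd].
  assert (Nf : forall t x y u, in_box B t x y u -> logD f x <> 0).
  { intros t x y u Hp. apply HN, Hp. }
  set (a := pd Vy tau) in *.
  assert (Sa : smooth B a) by (unfold a; smooth_rec).
  assert (Ax : eq_on B (pd Vx a) zero4) by now apply pd_zero_comm.
  set (G := fun t x y u => pd Vy psi t x y u - pd Vt tau t x y u + 2 * s * a t x y u).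
  assert (SG : smooth B G) by (unfold G; smooth_rec).
  assert (Gx : eq_on B (pd Vx G) zero4).
  { intros t x y u Hp. unfold G. pd_compute B. reduce_on Hp. ring. }
  assert (Coef : forall t x y u, in_box B t x y u ->
     pd Vt psi t x y u = s * (G t x y u - s * a t x y u) /\
     pd Vt tau t x y u = s * a t x y u - 3 * G t x y u).
  { intros t x y u Hp.
    assert (Z : List.Forall (fun c => c = 0)
      [ - s * (pd Vy psi t x y u - 3 / 2 * pd Vt tau t x y u) + 5 / 2 * pd Vt psi t x y u;
        pd Vy psi t x y u - 3 / 2 * pd Vt tau t x y u - 5 / 2 * s * a t x y u
        - 5 / 2 * (pd Vy psi t x y u - pd Vt tau t x y u) ]).
    { apply (log_derivatives_horner (bx B) f (logD f) (logD (logD f)) _ HL). intros x' Hx'.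
      assert (Hp' := in_box_x Hp Hx').
      assert (K := reduced_quadratic B f tau psi zeta A HB Sf HR _ _ _ _ Hp'). fold a in K.
      revert K. shift_x Hp Hx'. intros K.
      assert (N := HN x' Hx'). assert (H5 := Hs x' Hx').
      assert (N2 : logD f x' ^ 2 <> 0) by now apply pow_nonzero.
      set (Q := f x' ^ 2 * a t x y u + f x' * (pd Vy psi t x y u - pd Vt tau t x y u)
                - pd Vt psi t x y u) in *.
      set (L := 5 / 2 * f x' * a t x y u + pd Vy psi t x y u - 3 / 2 * pd Vt tau t x y u) in *.
      assert (E : 5 / 2 * Q = L * (f x' - s)).
      { apply Rmult_eq_reg_l with (logD f x' ^ 2); [ | exact N2 ].
        transitivity (logD f x' ^ 2 * L * (f x' - s)); [ | ring ]. rewrite <- K.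
        transitivity (5 / 2 * logD f x' ^ 2 * Q); [ ring | ]. rewrite <- H5. ring. }
      unfold Q, L in E. simpl. lra. }
    assert (Z1 := Forall_inv Z). assert (Z2 := Forall_inv (Forall_inv_tail Z)).
    cbv beta in Z1, Z2. unfold G.
    assert (E : pd Vt tau t x y u
                = - 3 * (pd Vy psi t x y u - pd Vt tau t x y u) - 5 * s * a t x y u) by lra.
    split; [ | lra ].
    assert (E1 : pd Vy psi t x y u - 3 / 2 * pd Vt tau t x y u
       = 5 / 2 * (s * a t x y u + (pd Vy psi t x y u - pd Vt tau t x y u))) by lra.
    rewrite E1 in Z1. lra. }
  assert (Ept : eq_on B (pd Vt psi) (fun t x y u => s * (G t x y u - s * a t x y u))).
  { intros t x y u Hp. now apply Coef. }
  assert (Et : eq_on B (pd Vt tau) (fun t x y u => s * a t x y u - 3 * G t x y u)).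
  { intros t x y u Hp. now apply Coef. }
  assert (Epy : eq_on B (pd Vy psi) (fun t x y u => - 2 * G t x y u - s * a t x y u)).
  { intros t x y u Hp. assert (K := Et _ _ _ _ Hp). cbv beta in K. unfold G in *. lra. }
  assert (At : eq_on B (pd Vt a) (fun t x y u => s * pd Vy a t x y u - 3 * pd Vy G t x y u)).
  { intros t x y u Hp. unfold a at 1. rewrite (schwarz Vt Vy HB St _ _ _ _ Hp).
    revert t x y u Hp. pd_from Et. }
  (* From psi_ty = psi_yt, in which the terms with a_y cancel. *)
  assert (Gt : eq_on B (pd Vt G) (fun t x y u => s * pd Vy G t x y u)).
  { intros t x y u Hp. assert (K := schwarz Vt Vy HB Sp _ _ _ _ Hp). revert K.
    rewrite (pd_ext Vt HB Epy _ _ _ _ Hp), (pd_ext Vy HB Ept _ _ _ _ Hp).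
    pd_compute B. rewrite (At _ _ _ _ Hp). intros K. lra. }
  set (v := fun x => (f x - s) ^ 2 / logD f x).
  set (w := fun x => (f x - s) / logD f x).
  assert (Sv : smooth B (fun _ x _ _ => v x)) by (unfold v; smooth_rec).
  assert (Sw : smooth B (fun _ x _ _ => w x)) by (unfold w; smooth_rec).
  assert (Dw : forall x, bx B x -> x * Derive w x = - 3 / 2).
  { intros x Hx. assert (D0 := ld_f _ _ _ _ HL x Hx). assert (D1 := ld_f1 _ _ _ _ HL x Hx).
    assert (P := ld_pos _ _ _ _ HL x Hx). assert (N := HN x Hx).
    assert (E : is_derive w x (((logD f x / x) * logD f x
                 - (f x - s) * (logD (logD f) x / x)) / logD f x ^ 2)).
    { unfold w. auto_derive; [ repeat split; eauto; eexists; eauto | ].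
      change (fun x => f x) with f. change (fun x => logD f x) with (logD f).
      rewrite (is_derive_unique _ _ _ D0), (is_derive_unique _ _ _ D1). field. repeat split; first [ exact N | lra ]. }
    rewrite (is_derive_unique _ _ _ E).
    transitivity ((logD f x ^ 2 - logD (logD f) x * (f x - s)) / logD f x ^ 2).
    - field. repeat split; first [ exact N | lra ].
    - rewrite (Hs x Hx). field. exact N. }
  assert (Dv : forall x, bx B x -> x * Derive v x = - (f x - s) / 2).
  { intros x Hx. assert (D0 := ld_f _ _ _ _ HL x Hx). assert (D1 := ld_f1 _ _ _ _ HL x Hx).
    assert (P := ld_pos _ _ _ _ HL x Hx). assert (N := HN x Hx).
    assert (E : is_derive v x ((2 * (f x - s) * (logD f x / x) * logD f x
                 - (f x - s) ^ 2 * (logD (logD f) x / x)) / logD f x ^ 2)).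
    { unfold v. auto_derive; [ repeat split; eauto; eexists; eauto | ].
      change (fun x => f x) with f. change (fun x => logD f x) with (logD f).
      rewrite (is_derive_unique _ _ _ D0), (is_derive_unique _ _ _ D1). field. repeat split; first [ exact N | lra ]. }
    rewrite (is_derive_unique _ _ _ E).
    transitivity ((2 * (f x - s) * logD f x ^ 2
                   - (f x - s) * (logD (logD f) x * (f x - s))) / logD f x ^ 2).
    - field. repeat split; first [ exact N | lra ].
    - rewrite (Hs x Hx). field. exact N. }
  assert (Zw : eq_on B zeta (fun t x y u => a t x y u * v x + G t x y u * w x)).
  { intros t x y u Hp. assert (K := Rb _ _ _ _ Hp). cbv beta in K.
    rewrite (Et _ _ _ _ Hp), (Epy _ _ _ _ Hp), (Ept _ _ _ _ Hp) in K.
    assert (N := Nf _ _ _ _ Hp).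
    unfold v, w. apply Rmult_eq_reg_l with (logD f x); [ | exact N ].
    rewrite K. fold a. field. exact N. }
  assert (Zt : eq_on B (pd Vt zeta) (fun t x y u => pd Vt a t x y u * v x + pd Vt G t x y u * w x)).
  { intros t x y u Hp. rewrite (pd_ext Vt HB Zw _ _ _ _ Hp). pd_compute B. ring. }
  assert (Zy : eq_on B (pd Vy zeta) (fun t x y u => pd Vy a t x y u * v x + pd Vy G t x y u * w x)).
  { intros t x y u Hp. rewrite (pd_ext Vy HB Zw _ _ _ _ Hp). pd_compute B. ring. }
  assert (VW : forall t x y u, in_box B t x y u -> (f x - s) * w x = v x).
  { intros t x y u Hp. unfold v, w. field. now apply Nf with t y u. }
  (* From D v = - (f - s)/2, D w = - 3/2 and (f - s) w = v one gets D S = - 4 G_y v - a_y (f - s) v,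
     which is Y zeta. *)
  set (S := fun t x y u : R => 2 * pd Vy G t x y u * (v x * w x) + pd Vy a t x y u * v x ^ 2).
  assert (SS : smooth B S) by (unfold S; smooth_rec).
  assert (HS : eq_on B (fun t x y u => x * pd Vx S t x y u)
    (fun t x y u => pd Vt zeta t x y u - f x * pd Vy zeta t x y u)).
  { intros t x y u Hp. unfold S. pd_compute B. reduce_on Hp. simpl INR. simpl Nat.pred.
    assert (Hx : bx B x) by apply Hp. assert (E := VW _ _ _ _ Hp).
    transitivity (2 * pd Vy G t x y u * ((x * Derive v x) * w x + v x * (x * Derive w x))
       + pd Vy a t x y u * (2 * v x * (x * Derive v x))); [ ring | ].
    rewrite (Dv x Hx), (Dw x Hx).
    transitivity (- pd Vy G t x y u * ((f x - s) * w x) - 3 * pd Vy G t x y u * v x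
       - pd Vy a t x y u * v x * (f x - s)); [ field | ]. rewrite E.
    transitivity (- 3 * pd Vy G t x y u * v x - pd Vy G t x y u * ((f x - s) * w x)
       - pd Vy a t x y u * v x * (f x - s)); [ rewrite E; ring | ring ]. }
  set (al := gauge_rest f tau zeta A S).
  assert (Sal : smooth B al) by now apply gauge_rest_smooth with psi.
  assert (Alx := gauge_rest_x B f tau psi zeta A S HB Sf HR SS HS). fold al in Alx.
  assert (GI := gauge_identity B f tau psi zeta A S HB Sf HR SS HS). fold al in GI. fold a in GI.
  assert (YS : forall t x y u, in_box B t x y u ->
     pd Vt S t x y u - f x * pd Vy S t x y u
     = - (5 * pd Vy (pd Vy G) t x y u + pd Vy (pd Vy a) t x y u * (f x - s)) * v x ^ 2).
  { intros t x y u Hp. unfold S. pd_compute B.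
    rewrite (schwarz Vt Vy HB Sa _ _ _ _ Hp), (schwarz Vt Vy HB SG _ _ _ _ Hp).
    rewrite (pd_ext Vy HB At _ _ _ _ Hp), (pd_ext Vy HB Gt _ _ _ _ Hp).
    pd_compute B. assert (E := VW _ _ _ _ Hp).
    transitivity (- 2 * pd Vy (pd Vy G) t x y u * v x * ((f x - s) * w x)
      - 3 * pd Vy (pd Vy G) t x y u * v x ^ 2
      - pd Vy (pd Vy a) t x y u * (f x - s) * v x ^ 2); [ ring | rewrite E; ring ]. }
  destruct (domain_point B HB) as (t0 & x0 & y0 & u0 & Hp00).
  assert (Hx0 := proj1 (proj2 Hp00)).
  assert (Hp0 : forall x, bx B x -> in_box B t0 x y0 u0) 
    by (intros x; exact (in_box_x Hp00)).
  set (at0 := a t0 x0 y0 u0). set (ay := pd Vy a t0 x0 y0 u0).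
  set (ayy := pd Vy (pd Vy a) t0 x0 y0 u0). set (g := G t0 x0 y0 u0).
  set (gy := pd Vy G t0 x0 y0 u0). set (gyy := pd Vy (pd Vy G) t0 x0 y0 u0).
  set (c0 := pd Vt al t0 x0 y0 u0). set (c1 := pd Vy al t0 x0 y0 u0).
  set (ttt := pd Vt (pd Vt tau) t0 x0 y0 u0). set (tty := pd Vy (pd Vt tau) t0 x0 y0 u0).
  set (tt := pd Vt tau t0 x0 y0 u0).
  assert (A0 : at0 <> 0) by now apply Hmu, Hp0.
  apply (roots_contradiction (bx B) f (logD f) (logD (logD f)) s (- s)
    (2 * (- c0 - ttt - gy * s - tt / 2 + ay * s ^ 2) / at0)
    (2 * (c1 + 2 * tty + gy + at0 / 2 - 2 * ay * s) / at0) 0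
    ((2 * ayy * s - 10 * gyy) / at0) (- 2 * ayy / at0) HL).
  - intros x Hx Z. assert (N := HN x Hx). assert (Z' : f x - s = 0).
    { apply Rmult_integral in Z. destruct Z; lra. }
    specialize (Hs x Hx). rewrite Z' in Hs. apply (pow_nonzero _ 2 N). lra.
  - intros x Hx. transitivity ((logD (logD f) x * (f x - s)) * (f x - s)); [ ring | ].
    rewrite (Hs x Hx). field.
  - intros x Hx. assert (Hp := Hp0 x Hx). assert (K := GI _ _ _ _ Hp). cbv beta zeta in K.
    rewrite (YS _ _ _ _ Hp), (Zy _ _ _ _ Hp) in K.
    assert (N := HN x Hx).
    replace (logD f x * (pd Vy a t0 x y0 u0 * v x + pd Vy G t0 x y0 u0 * w x))
      with ((f x - s) ^ 2 * pd Vy a t0 x y0 u0 + (f x - s) * pd Vy G t0 x y0 u0) in K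
      by (unfold v, w; field; exact N).
    assert (Hq := Hp0 x0 Hx0). revert K. shift_x Hq Hx. intros K.
    fold at0 ay ayy g gy gyy c0 c1 ttt tty tt in K.
    replace ((f x - s) * (f x + - s) / logD f x) with (v x) by (unfold v; field; exact N).
    apply Rmult_eq_reg_l with (at0 / 2); [ | lra ].
    transitivity (at0 * logD (logD f) x / 2); [ field | ]. rewrite K. field. exact A0.
Qed.

(** * Passing to a smaller box, and the conclusion tau_y = 0 *)

Definition sub_box (B' B : box) : Prop :=
  forall t x y u, in_box B' t x y u -> in_box B t x y u.

Lemma smooth_sub B' B F : sub_box B' B -> smooth B F -> smooth B' F.
Proof. intros HS HF l t x y u Hp. apply HF. now apply HS. Qed.

Lemma reduced_sub B' B f tau psi zeta A : sub_box B' B ->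
  reduced B f tau psi zeta A -> reduced B' f tau psi zeta A.
Proof.
  intros HS []. split; try (now apply smooth_sub with B);
    intros t x y u Hp; auto.
Qed.

Lemma open_interval_around c (d : posreal) : open_interval (fun s => c - d < s < c + d).
Proof.
  assert (Hd := cond_pos d). repeat split.
  - exact (open_and _ _ (open_gt (c - d)) (open_lt (c + d))).
  - exists c. lra.
  - lra.
  - lra.
Qed.

Lemma smooth_nonzero_near B F t x y u : domain B -> smooth B F -> in_box B t x y u ->
  F t x y u <> 0 ->
  exists B', domain B' /\ sub_box B' B /\ in_box B' t x y u /\
    forall t' x' y' u', in_box B' t' x' y' u' -> F t' x' y' u' <> 0.
Proof.
  intros HB SF Hp HF. destruct (smooth_basic B F SF t x y u Hp) as [C _].
  assert (L : locally (t, x, y, u) (fun p => let '(t', x', y', u') := p in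
             in_box B t' x' y' u' /\ F t' x' y' u' <> 0)).
  { assert (L1 := box_open B t x y u HB Hp).
    assert (He : 0 < Rabs (F t x y u)) by now apply Rabs_pos_lt.
    assert (L2 := proj1 (filterlim_locally _ _) C (mkposreal _ He)).
    generalize (filter_and _ _ L1 L2). apply filter_imp.
    intros [[[t' x'] y'] u'] [H1 H2]. split; [ exact H1 | ].
    intros Z. unfold ball in H2. simpl in H2. unfold AbsRing_ball, abs, minus, plus, opp in H2.
    simpl in H2. rewrite Z in H2. rewrite Rplus_0_l, Rabs_Ropp in H2. lra. }
  destruct L as [d Hd]. assert (Hd0 := cond_pos d).
  exists (Box (fun s => t - d < s < t + d) (fun s => x - d < s < x + d)
              (fun s => y - d < s < y + d) (fun s => u - d < s < u + d)).
  assert (K : forall t' x' y' u', in_box (Box (fun s => t - d < s < t + d)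
      (fun s => x - d < s < x + d) (fun s => y - d < s < y + d)
      (fun s => u - d < s < u + d)) t' x' y' u' ->
      in_box B t' x' y' u' /\ F t' x' y' u' <> 0).
  { intros t' x' y' u' (H1 & H2 & H3 & H4). simpl in *.
    apply (Hd (t', x', y', u')). apply ball4; [ exact Hd0 | | | | ]; apply Rabs_def1; lra. }
  split; [ | split; [ | split ] ].
  - unfold domain; simpl.
    repeat (split; [ apply open_interval_around | ]). intros x' Hx'.
    apply (@in_box_x_pos B t x' y u HB). apply K.
    repeat split; simpl; lra.
  - intros t' x' y' u' H. now apply K.
  - repeat split; simpl; lra.
  - intros t' x' y' u' H. now apply K.
Qed.

(** At a point with tau_y <> 0, keep (t,y), move x and shrink the box until tau_y, Df and the linear
    factor L0(f) with coefficients taken at that (t,y) have no zeros. There Q0(f) has none either.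
    What remains depends on whether the root r of L0 is a root of Q0. *)
Lemma tau_y_zero B f tau psi zeta A :
  domain B -> smooth B (fun _ x _ _ => f x) -> reduced B f tau psi zeta A ->
  (exists x1 x2, bx B x1 /\ bx B x2 /\ f x1 <> f x2) ->
  eq_on B (pd Vy tau) zero4.
Proof.
  intros HB Sf HR (xa & xb & Hxa & Hxb & Hab) t x y u Hp.
  apply NNPP. intros Ha.
  assert (HR' := HR). destruct HR' as [St Sp Sz SA Tx Px _ _ _ _].
  assert (Sf1 := smooth_logD B f HB Sf).
  set (a := pd Vy tau) in *.
  assert (Sa : smooth B a) by (unfold a; smooth_rec).
  assert (Ax : eq_on B (pd Vx a) zero4) by now apply pd_zero_comm.
  assert (P : forall s, bx B s -> 0 < s) by apply HB.
  set (a0 := a t x y u) in *.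
  set (l0 := pd Vy psi t x y u - 3 / 2 * pd Vt tau t x y u).
  assert (F1 : exists x1, bx B x1 /\ logD f x1 <> 0).
  { apply NNPP. intros N. apply Hab. apply derive_zero_constant with (bx B); auto.
    - apply HB.
    - intros s Hs. assert (D := smooth_of_x_derive B f s HB Sf Hs).
      replace (logD f s) with 0 in D.
      + unfold Rdiv in D. now rewrite Rmult_0_l in D.
      + apply NNPP. intros N'. apply N. exists s. split; auto. }
  destruct F1 as (x1 & Hx1 & N1).
  (* If L0(f) vanished wherever Df does not, it would vanish near [x1], and so would its derivative
     (5/2) a0 Df / x, against the choice of [x1]. *)
  assert (F2 : exists x2, bx B x2 /\ logD f x2 <> 0 /\ 5 / 2 * f x2 * a0 + l0 <> 0).
  { apply NNPP. intros N.
    destruct (smooth_nonzero_near B (fun _ x _ _ => logD f x) t x1 y u HB Sf1 (in_box_x Hp Hx1) N1)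
      as (B1 & HB1 & S1 & Hp1 & Z1).
    assert (D0 : is_derive (fun s => 5 / 2 * f s * a0 + l0) x1 0).
    { apply is_derive_ext_loc with (fun _ => 0); [ | exact (is_derive_const 0 x1) ].
      destruct HB1 as (_ & (O1 & _) & _).
      generalize (O1 x1 (proj1 (proj2 Hp1))). apply filter_imp. intros s Hs.
      assert (Hq := in_box_x Hp1 Hs).
      symmetry. apply NNPP. intros N'. apply N. exists s. repeat split.
      - apply (S1 _ _ _ _ Hq).
      - exact (Z1 _ _ _ _ Hq).
      - exact N'. }
    assert (D := smooth_of_x_derive B f x1 HB Sf Hx1).
    assert (D1 : is_derive (fun s => 5 / 2 * f s * a0 + l0) x1 (5 / 2 * (logD f x1 / x1) * a0)).
    { auto_derive; [ eexists; exact D | ].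
      rewrite_derive D. field.
      specialize (P x1 Hx1). lra. }
    apply is_derive_unique in D0. apply is_derive_unique in D1. rewrite D0 in D1.
    specialize (P x1 Hx1).
    assert (Z : logD f x1 * a0 = 0).
    { transitivity (2 / 5 * x1 * (5 / 2 * (logD f x1 / x1) * a0)); [ field; lra | ].
      rewrite <- D1. ring. }
    apply Rmult_integral in Z. tauto. }
  destruct F2 as (x2 & Hx2 & N2 & L2).
  destruct (smooth_nonzero_near B (fun t x y u => a t x y u * logD f x
      * (5 / 2 * f x * a0 + l0)) t x2 y u HB ltac:(smooth_rec) (in_box_x Hp Hx2))
    as (B' & HB' & HS & Hp' & HN).
  { rewrite (x_invariant B a t x x2 y u HB Sa Ax Hp Hx2). fold a0.
    exact (Rmult_integral_contrapositive_currified _ _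
      (Rmult_integral_contrapositive_currified _ _ Ha N2) L2). }
  assert (HRs := reduced_sub B' B f tau psi zeta A HS HR).
  assert (Sf' := smooth_sub B' B _ HS Sf).
  assert (N3 : forall t x y u, in_box B' t x y u ->
     a t x y u <> 0 /\ logD f x <> 0 /\ 5 / 2 * f x * a0 + l0 <> 0).
  { intros t' x' y' u' H. specialize (HN _ _ _ _ H). repeat split; intros Z; apply HN;
      rewrite Z; ring. }
  assert (N4 : forall s, bx B' s -> logD f s <> 0 /\ 5 / 2 * f s * a0 + l0 <> 0).
  { intros s Hs. exact (proj2 (N3 _ _ _ _ (in_box_x Hp' Hs))). }
  assert (HL := log_derivatives_logD B' f HB' Sf' (fun s Hs => proj1 (N4 s Hs))).
  set (b0 := pd Vy psi t x y u - pd Vt tau t x y u).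
  set (c0 := - pd Vt psi t x y u).
  assert (Q0 : forall s, bx B' s -> logD (logD f) s * (a0 * f s ^ 2 + b0 * f s + c0)
                  = logD f s ^ 2 * (5 / 2 * f s * a0 + l0)).
  { intros s Hs. assert (H := in_box_x Hp' Hs). assert (Hb := HS _ _ _ _ H).
    assert (K := reduced_quadratic B f tau psi zeta A HB Sf HR _ _ _ _ Hb).
    assert (Hs' := proj1 (proj2 Hb)). revert K. shift_x Hp Hs'. intros K.
    fold a a0 in K. unfold b0, c0, l0. lra. }
  assert (Q0N : forall s, bx B' s -> a0 * f s ^ 2 + b0 * f s + c0 <> 0).
  { intros s Hs Z. specialize (Q0 s Hs). rewrite Z in Q0. destruct (N4 s Hs) as [M1 M2].
    assert (logD f s ^ 2 * (5 / 2 * f s * a0 + l0) = 0) by lra.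
    apply Rmult_integral in H. destruct H as [H|H]; [ | contradiction ].
    apply Rmult_integral in H. destruct H; [ contradiction | ].
    apply Rmult_integral in H. destruct H; [ contradiction | lra ]. }
  (* r is the root of 5/2 a0 f + l0 *)
  set (r := - (2 / 5) * l0 / a0).
  assert (El : l0 = - (5 / 2) * a0 * r) by (unfold r; field; exact Ha).
  destruct (Req_dec (a0 * r ^ 2 + b0 * r + c0) 0) as [HRt|HRt].
  (* By Vieta, - b0 / a0 - r is the other root of Q0. *)
  - apply (shared_root_contradiction B' f tau psi zeta A (- b0 / a0 - r) HB' Sf' HRs).
    + intros s Hs. apply (N4 s Hs).
    + intros s Hs. specialize (Q0 s Hs). destruct (N4 s Hs) as [M1 M2].
      rewrite El in Q0, M2.
      apply Rmult_eq_reg_l with (a0 * (f s - r)).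
      * transitivity (logD (logD f) s * (a0 * f s ^ 2 + b0 * f s + c0)).
        -- replace c0 with (- a0 * r ^ 2 - b0 * r) by lra. field. exact Ha.
        -- rewrite Q0. field.
      * intros Z. apply M2. lra.
    + intros t' x' y' u' H. apply (N3 _ _ _ _ H).
  - set (bb := b0 / a0). set (cc := c0 / a0). set (ll := l0 / a0).
    assert (Prop4 : forall t x y u, in_box B' t x y u ->
      pd Vy psi t x y u - pd Vt tau t x y u = bb * a t x y u /\
      - pd Vt psi t x y u = cc * a t x y u /\
      pd Vy psi t x y u - 3 / 2 * pd Vt tau t x y u = ll * a t x y u).
    { intros t' x' y' u' H.
      set (a1 := a t' x' y' u'). set (b1 := pd Vy psi t' x' y' u' - pd Vt tau t' x' y' u').
      set (c1 := - pd Vt psi t' x' y' u').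
      set (l1 := pd Vy psi t' x' y' u' - 3 / 2 * pd Vt tau t' x' y' u').
      (* Cross-multiplying the relations of the two points gives L0 Q1 - L1 Q0 = 0 on the values of
         f. The cubic terms cancel; these are the other coefficients. *)
      assert (Z : List.Forall (fun c => c = 0)
        [ l0 * c1 - l1 * c0; 5 / 2 * a0 * c1 + l0 * b1 - 5 / 2 * a1 * c0 - l1 * b0;
          5 / 2 * a0 * b1 + l0 * a1 - 5 / 2 * a1 * b0 - l1 * a0 ]).
      { apply (log_derivatives_horner (bx B') f (logD f) (logD (logD f)) _ HL).
        intros s Hs. assert (H1 := in_box_x H Hs). assert (Hb := HS _ _ _ _ H1).
        assert (Hb0 := HS _ _ _ _ H).
        assert (K := reduced_quadratic B f tau psi zeta A HB Sf HR _ _ _ _ Hb).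
        assert (Hs' := proj1 (proj2 Hb)). revert K. shift_x Hb0 Hs'. intros K.
        fold a a1 in K.
        assert (K1 : logD (logD f) s * (a1 * f s ^ 2 + b1 * f s + c1)
                     = logD f s ^ 2 * (5 / 2 * f s * a1 + l1)) by (unfold b1, c1, l1; lra).
        specialize (Q0 s Hs). destruct (N4 s Hs) as [M1 _].
        apply Rmult_eq_reg_l with (logD f s ^ 2); [ | now apply pow_nonzero ].
        simpl. transitivity
          ((logD f s ^ 2 * (5 / 2 * f s * a0 + l0)) * (a1 * f s ^ 2 + b1 * f s + c1)
           - (logD f s ^ 2 * (5 / 2 * f s * a1 + l1)) * (a0 * f s ^ 2 + b0 * f s + c0));
          [ ring | ]. rewrite <- Q0, <- K1. ring. }
      assert (Z0 := Forall_inv Z). apply Forall_inv_tail in Z.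
      assert (Z1 := Forall_inv Z). apply Forall_inv_tail in Z.
      assert (Z2 := Forall_inv Z). cbv beta in Z0, Z1, Z2.
      assert (El1 : l1 - ll * a1 = 5 / 2 * (b1 - bb * a1)).
      { unfold ll, bb. apply Rmult_eq_reg_l with a0; [ | exact Ha ].
        transitivity (a0 * l1 - l0 * a1); [ field; exact Ha | ].
        transitivity (5 / 2 * (a0 * b1 - b0 * a1)); [ lra | field; exact Ha ]. }
      (* The deviation from proportionality: Q1 - (a1/a0) Q0 = be f + ga and L1 - (a1/a0) L0 = (5/2)
         be. Hence L0 (be f + ga) = (5/2) be Q0 as polynomials, and at the root r of L0 this says be
         Q0(r) = 0. *)
      set (be := b1 - bb * a1) in *. set (ga := c1 - cc * a1).
      assert (Eb0 : b0 = bb * a0) by (unfold bb; field; exact Ha).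
      assert (Ec0 : c0 = cc * a0) by (unfold cc; field; exact Ha).
      assert (El0 : l0 = ll * a0) by (unfold ll; field; exact Ha).
      assert (Elr : ll = - (5 / 2) * r) by (unfold ll; rewrite El; field; exact Ha).
      assert (Eb1 : b1 = be + bb * a1) by (unfold be; ring).
      assert (Ec1 : c1 = ga + cc * a1) by (unfold ga; ring).
      assert (El2 : l1 = 5 / 2 * be + ll * a1) by lra.
      assert (Ga : ga = be * (bb + r)).
      { apply Rmult_eq_reg_l with (5 / 2 * a0); [ | lra ].
        rewrite Eb0, Ec0, El0, Eb1, Ec1, El2, Elr in Z1.
        transitivity (5 / 2 * a0 * ga - 0); [ ring | ]. rewrite <- Z1. field. }
      assert (Be : be = 0).
      { assert (E : be * (a0 * r ^ 2 + b0 * r + c0) = 0).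
        { rewrite Eb0, Ec0.
          rewrite Ec0, El0, Ec1, El2, Elr, Ga in Z0. lra. }
        apply Rmult_integral in E. tauto. }
      rewrite Be in *. repeat split; unfold b1, c1, l1 in *; lra. }
    (* The coefficient of f in Q minus the constant term of L is tau_t / 2, whence the constant 2
       (bb - ll). *)
    assert (Ec : forall t x y u, in_box B' t x y u ->
       pd Vt tau t x y u = 2 * (bb - ll) * a t x y u /\
       pd Vy psi t x y u = (bb + 2 * (bb - ll)) * a t x y u /\
       pd Vt psi t x y u = - cc * a t x y u).
    { intros t' x' y' u' H. destruct (Prop4 _ _ _ _ H) as (E1 & E2 & E3).
      repeat split; lra. }
    apply (proportional_contradiction B' f tau psi zeta A bb cc (2 * (bb - ll)) HB' Sf' HRs).
    + intros s Hs. apply (N4 s Hs).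
    + intros t' x' y' u' H. apply (N3 _ _ _ _ H).
    + intros s Hs Z. apply (Q0N s Hs). unfold bb, cc in Z.
      transitivity (a0 * (f s ^ 2 + b0 / a0 * f s + c0 / a0)); [ field; exact Ha | ].
      rewrite Z. ring.
    + intros t' x' y' u' H. apply (Ec _ _ _ _ H).
    + intros t' x' y' u' H. apply (Ec _ _ _ _ H).
    + intros t' x' y' u' H. apply (Ec _ _ _ _ H).
Qed.

(** * Equations admitting an extension *)

Lemma solution_of_pd B f W u0 : domain B -> smooth B W -> bu B u0 ->
  eq_on B (pd Vu W) zero4 ->
  eq_on B (pd Vt W) (fun t x y u => x ^ 2 * pd Vx (pd Vx W) t x y u + f x * pd Vy W t x y u) ->
  solution B f (fun t x y => W t x y u0) /\ eq_on B W (fun t x y _ => W t x y u0).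
Proof.
  intros HB SW Hu0 Wu WE.
  assert (E : eq_on B W (fun t x y _ => W t x y u0)).
  { intros t x y u Hp. symmetry.
    exact (slice_const B Vu W t x y u u0 HB SW Wu Hp Hu0). }
  split; [ | exact E ]. split; [ now apply smooth_ext with W | ].
  intros t x y Ht Hx Hy.
  exact (WE t x y u0 (conj Ht (conj Hx (conj Hy Hu0)))).
Qed.

(** As eta_uu = 0, eta - eta_u u does not depend on u; eta and eta_u both satisfy the equation,
    hence so does this difference, which is beta. *)
Lemma symmetry_shape B f X :
  domain B -> smooth B (fun _ x _ _ => f x) -> lie_symmetry B f X ->
  vf_smooth B X /\ determining B f X /\
  reduced B f (xi0 X) (xi2 X) (zeta_of X) (pd Vu (eta X)) /\
  exists beta, solution B f beta /\
    eq_on B (eta X) (fun t x y u => pd Vu (eta X) t x y u * u + beta t x y).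
Proof.
  intros HB Sf HX.
  destruct (lie_symmetry_determining B f X HB) as [HS HD]; [ | exact HX | ].
  { intros x Hx. eexists. now apply smooth_of_x_derive with B. }
  assert (HR := determining_reduced B f X HB Sf HS HD).
  repeat (split; [ assumption | ]).
  assert (Se : smooth B (eta X)) by apply HS.
  destruct (domain_point B HB) as (_ & _ & _ & u0 & _ & _ & _ & Hu0).
  set (W := fun t x y u => eta X t x y u - pd Vu (eta X) t x y u * u).
  assert (SW : smooth B W) by (unfold W; smooth_rec).
  assert (Auu : eq_on B (pd Vu (pd Vu (eta X))) zero4).
  { intros t x y u Hp. apply HD, Hp. }
  destruct (solution_of_pd B f W u0 HB SW Hu0) as [Sol E].
  - intros t x y u Hp. unfold W. pd_compute B. rewrite (Auu _ _ _ _ Hp). ring.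
  - assert (Wx : eq_on B (pd Vx W)
       (fun t x y u => pd Vx (eta X) t x y u - pd Vx (pd Vu (eta X)) t x y u * u)).
    { intros t x y u Hp. unfold W. pd_compute B. ring. }
    intros t x y u Hp. rewrite (pd_ext Vx HB Wx _ _ _ _ Hp).
    unfold W. pd_compute B. rewrite (red_d _ _ _ _ _ _ HR _ _ _ _ Hp).
    destruct (HD _ _ _ _ Hp) as (_ & _ & _ & _ & _ & _ & E10). cbv beta zeta in E10.
    rewrite E10. ring.
  - exists (fun t x y => W t x y u0). split; [ exact Sol | ].
    intros t x y u Hp. assert (K := E _ _ _ _ Hp). unfold W in *. cbv beta in K. lra.
Qed.

Lemma zeta_affine B f tau psi zeta A t y u x0 :
  domain B -> smooth B (fun _ x _ _ => f x) -> reduced B f tau psi zeta A ->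
  eq_on B (pd Vy tau) zero4 -> in_box B t x0 y u ->
  exists k, forall x, bx B x -> zeta t x y u = pd Vt tau t x0 y u / 2 * ln x + k.
Proof.
  intros HB Sf HR Hy Hp. destruct HR as [St Sp Sz SA Tx Px Ra _ _ _].
  set (c := pd Vt tau t x0 y u / 2).
  exists (zeta t x0 y u - c * ln x0). intros x Hx.
  assert (E : zeta t x y u - c * ln x = zeta t x0 y u - c * ln x0); [ | lra ].
  apply (derive_zero_constant (bx B) (fun x => zeta t x y u - c * ln x)); auto;
    [ apply HB | | apply Hp ].
  intros s Hs. assert (Hq := in_box_x Hp Hs).
  assert (Ps := in_box_x_pos HB Hq).
  assert (D := slice_derive B zeta Vx t s y u Sz Hq). simpl in D.
  assert (K := Ra _ _ _ _ Hq). cbv beta in K. rewrite (Hy _ _ _ _ Hq) in K.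
  revert K. shift_x Hp Hs. intros K.
  auto_derive.
  - split; [ eexists; exact D | split; [ exact Ps | exact I ] ].
  - change (fun x => zeta t x y u) with (fun x => zeta t x y u) in *.
    rewrite (is_derive_unique _ _ _ D).
    apply Rmult_eq_reg_l with s; [ | lra ].
    transitivity (s * pd Vx zeta t s y u - c); [ field; lra | ]. rewrite K. unfold c. field.
Qed.

Lemma two_values B f c1 c0 : (exists x1 x2, bx B x1 /\ bx B x2 /\ f x1 <> f x2) ->
  (forall x, bx B x -> c0 - f x * c1 = 0) -> c0 = 0 /\ c1 = 0.
Proof.
  intros (x1 & x2 & H1 & H2 & N) H. assert (K1 := H x1 H1). assert (K2 := H x2 H2).
  assert (E : c1 * (f x1 - f x2) = 0) by lra.
  apply Rmult_integral in E. destruct E as [E|E]; [ subst c1; lra | lra ].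
Qed.

Lemma constant_of_pd B F : domain B -> smooth B F ->
  (forall v, eq_on B (pd v F) zero4) ->
  exists C, forall t x y u, in_box B t x y u -> F t x y u = C.
Proof.
  intros HB SF F0.
  destruct (domain_point B HB) as (t0 & x0 & y0 & u0 & Ht0 & Hx0 & Hy0 & Hu0).
  exists (F t0 x0 y0 u0). intros t x y u (H1 & H2 & H3 & H4).
  assert (E1 := slice_const B Vt F t x y u t0 HB SF (F0 Vt) (conj H1 (conj H2 (conj H3 H4))) Ht0).
  assert (E2 := slice_const B Vx F t0 x y u x0 HB SF (F0 Vx) (conj Ht0 (conj H2 (conj H3 H4))) Hx0).
  assert (E3 := slice_const B Vy F t0 x0 y u y0 HB SF (F0 Vy) (conj Ht0 (conj Hx0 (conj H3 H4))) Hy0).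
  assert (E4 := slice_const B Vu F t0 x0 y0 u u0 HB SF (F0 Vu) (conj Ht0 (conj Hx0 (conj Hy0 H4))) Hu0).
  simpl in *. congruence.
Qed.

(** The equation is [red_b] at one point, with zeta affine in ln x. If it were trivial at every
    point, tau_t and zeta would vanish throughout; since f is nonconstant, [red_b] and [red_d] would
    then split in powers of f and make psi and eta_u constant, so the symmetry would be in the
    kernel. *)
Lemma extension_ode B f :
  domain B -> smooth_nonconstant B f -> admits_proper_extension B f ->
  exists a b c d, (a <> 0 \/ b <> 0) /\
    forall x, bx B x -> logD f x * (a * ln x + b) = c * f x + d.
Proof.
  intros HB [Hf Hnc] (X & HX & HN).
  assert (Sf := smooth_of_x B f HB Hf).
  destruct (symmetry_shape B f X HB Sf HX) as (HS & HD & HR & beta & Hb & He).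
  assert (Ty := tau_y_zero B f _ _ _ _ HB Sf HR Hnc).
  assert (HR' := HR). destruct HR' as [St Sp Sz SA Tx Px Ra Rb Rc Rd].
  apply NNPP. intros HC. apply HN.
  assert (Triv : forall t x y u, in_box B t x y u ->
            pd Vt (xi0 X) t x y u = 0 /\ zeta_of X t x y u = 0).
  { intros t x y u Hp. apply NNPP. intros N. apply HC.
    destruct (zeta_affine B f _ _ _ _ t y u x HB Sf HR Ty Hp) as [k Hk].
    exists (pd Vt (xi0 X) t x y u / 2), k,
      (- (pd Vt (xi0 X) t x y u - pd Vy (xi2 X) t x y u)), (- pd Vt (xi2 X) t x y u).
    split.
    - apply NNPP. intros N'. apply N.
      assert (Z1 : pd Vt (xi0 X) t x y u = 0) by lra.
      assert (Z2 : k = 0) by (apply NNPP; intros Z2; apply N'; now right).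
      split; [ exact Z1 | ]. rewrite (Hk x (proj1 (proj2 Hp))), Z1, Z2. field.
    - intros s Hs. assert (Hq := in_box_x Hp Hs).
      assert (K := Rb _ _ _ _ Hq). cbv beta in K. rewrite (Ty _ _ _ _ Hq) in K.
      rewrite (Hk s Hs) in K.
      revert K. shift_x Hp Hs. intros K. rewrite K. ring. }
  assert (Tt : eq_on B (pd Vt (xi0 X)) zero4).
  { intros t x y u Hp. apply Triv, Hp. }
  assert (Z0 : eq_on B (zeta_of X) zero4).
  { intros t x y u Hp. apply Triv, Hp. }
  assert (Pty : forall t x y u, in_box B t x y u ->
            pd Vt (xi2 X) t x y u = 0 /\ pd Vy (xi2 X) t x y u = 0).
  { intros t x y u Hp. apply (two_values B f _ _ Hnc). intros s Hs.
    assert (Hq := in_box_x Hp Hs).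
    assert (K := Rb _ _ _ _ Hq). revert K. cbv beta. reduce_on Hq. shift_x Hp Hs. intros K. lra. }
  set (A := pd Vu (eta X)) in *.
  assert (Ax : eq_on B (pd Vx A) zero4).
  { intros t x y u Hp. assert (K := Rc _ _ _ _ Hp). cbv beta in K.
    rewrite (pd_ext Vy HB Z0 _ _ _ _ Hp), (pd_ext Vt HB Z0 _ _ _ _ Hp),
      (Tt _ _ _ _ Hp), (Ty _ _ _ _ Hp), !pd_const in K.
    apply Rmult_eq_reg_l with x; [ lra | now apply (in_box_x_neq0 HB Hp) ]. }
  assert (Aty : forall t x y u, in_box B t x y u ->
             pd Vt A t x y u = 0 /\ pd Vy A t x y u = 0).
  { intros t x y u Hp. apply (two_values B f _ _ Hnc). intros s Hs.
    assert (Hq := in_box_x Hp Hs).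
    assert (K := Rd _ _ _ _ Hq). revert K. cbv beta.
    rewrite (pd_zero B Vx Vx A HB Ax _ _ _ _ Hq). shift_x Hp Hs. intros K. lra. }
  destruct (constant_of_pd B (xi0 X) HB) as [C1 H1]; [ exact St | | ].
  { intros []; auto. intros t x y u Hp; apply HD, Hp. }
  destruct (constant_of_pd B (xi2 X) HB) as [C2 H2]; [ exact Sp | | ].
  { intros []; intros t x y u Hp.
    - exact (proj1 (Pty _ _ _ _ Hp)).
    - apply Px, Hp.
    - exact (proj2 (Pty _ _ _ _ Hp)).
    - apply HD, Hp. }
  destruct (constant_of_pd B A HB) as [C3 H3]; [ exact SA | | ].
  { intros []; intros t x y u Hp.
    - exact (proj1 (Aty _ _ _ _ Hp)).
    - apply Ax, Hp.
    - exact (proj2 (Aty _ _ _ _ Hp)).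
    - apply HD, Hp. }
  exists C1, C2, C3, beta. split; [ exact Hb | ].
  intros t x y u Hp. simpl. rewrite (H1 _ _ _ _ Hp), (H2 _ _ _ _ Hp), (He _ _ _ _ Hp),
    (H3 _ _ _ _ Hp).
  assert (E1 : xi1 X t x y u = 0).
  { assert (K := Z0 _ _ _ _ Hp). unfold zeta_of in K. cbv beta in K.
    assert (Nx := in_box_x_neq0 HB Hp).
    transitivity (x * (xi1 X t x y u / x)); [ field; exact Nx | rewrite K; ring ]. }
  rewrite E1. repeat split; ring.
Qed.

(** * Smooth solutions of the Euler equation through its singular point *)

(** K vanishes at the singular point x0, and as n < 0 the equation keeps K^2 from growing away from
    x0. The mean value theorem makes this precise: K(x)^2 equals (K^2)'(c) (x - x0), which is at
    most 0. *)
Lemma euler_negative B K q n x0 :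
  domain B -> smooth B (fun _ x _ _ => K x) -> n < 0 -> bx B x0 -> ln x0 + q = 0 ->
  (forall x, bx B x -> (ln x + q) * logD K x = n * K x) ->
  forall x, bx B x -> K x = 0.
Proof.
  intros HB SK Hn Hx0 Hz H x Hx.
  assert (P : forall s, bx B s -> 0 < s) by apply HB.
  assert (K0 : K x0 = 0).
  { specialize (H x0 Hx0). rewrite Hz in H. apply Rmult_eq_reg_l with n; lra. }
  assert (CJ : forall s, Rmin x0 x <= s <= Rmax x0 x -> bx B s).
  { intros s Hs. destruct HB as (_ & (_ & _ & CJ) & _).
    destruct (Rle_dec x0 x) as [L|L].
    - rewrite Rmin_left, Rmax_right in Hs by lra. now apply (CJ x0 s x).
    - rewrite Rmin_right, Rmax_left in Hs by lra. now apply (CJ x s x0). }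
  assert (D : forall s, bx B s ->
             is_derive (fun s => K s ^ 2) s (2 * K s * (logD K s / s))).
  { intros s Hs. assert (D := smooth_of_x_derive B K s HB SK Hs).
    auto_derive; [ eexists; exact D | ].
    rewrite_derive D. ring. }
  destruct (MVT_gen (fun s => K s ^ 2) x0 x (fun s => 2 * K s * (logD K s / s)))
    as (c & Hc & E).
  - intros s Hs. apply D, CJ. lra.
  - intros s Hs. apply continuity_pt_filterlim, ex_derive_continuous_R.
    eexists. apply D, CJ, Hs.
  - assert (Hcb := CJ c Hc). assert (Pc := P c Hcb). assert (P0 := P x0 Hx0).
    assert (Px := P x Hx).
    assert (Q : (ln c + q) * (K c * logD K c) <= 0).
    { replace ((ln c + q) * (K c * logD K c)) with (n * (K c) ^ 2).
      - assert (0 <= K c ^ 2) by apply pow2_ge_0. nra.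
      - specialize (H c Hcb). transitivity (K c * ((ln c + q) * logD K c));
          [ rewrite H; ring | ring ]. }
    assert (Sgn : 0 <= (ln c + q) * (x - x0)).
    { destruct (Rle_dec x0 x) as [L|L].
      - rewrite Rmin_left, Rmax_right in Hc by lra.
        assert (ln x0 <= ln c) by (apply ln_le; lra). nra.
      - rewrite Rmin_right, Rmax_left in Hc by lra.
        assert (ln c <= ln x0) by (apply ln_le; lra). nra. }
    assert (S2 : K c * logD K c * (x - x0) <= 0).
    { destruct (Req_dec (ln c + q) 0) as [Z|Z].
      - assert (Kc : K c = 0).
        { specialize (H c Hcb). rewrite Z in H. apply Rmult_eq_reg_l with n; lra. }
        rewrite Kc. lra.
      - assert (M : (ln c + q) * (K c * logD K c) * ((ln c + q) * (x - x0)) <= 0) by nra.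
        assert (0 < (ln c + q) ^ 2) by (apply pow2_gt_0; exact Z).
        assert ((ln c + q) ^ 2 * (K c * logD K c * (x - x0)) <= 0) by lra.
        nra. }
    rewrite K0 in E.
    assert (E2 : K x ^ 2 = 2 / c * (K c * logD K c * (x - x0))).
    { transitivity (K x ^ 2 - 0 ^ 2); [ ring | rewrite E; field; lra ]. }
    assert (0 < 2 / c) by (apply Rdiv_lt_0_compat; lra).
    assert (K x ^ 2 <= 0) by (rewrite E2; nra).
    assert (Z : K x * K x = 0) by nra.
    apply Rmult_integral in Z. tauto.
Qed.

(* Differentiating lowers the exponent by one, so a smooth solution through the singular
   point is a monomial of natural degree, and vanishes once the exponent is negative. *)
Lemma euler_monomial B q x0 M : domain B -> bx B x0 -> ln x0 + q = 0 ->
  forall K n, smooth B (fun _ x _ _ => K x) -> n < INR M ->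
  (forall x, bx B x -> (ln x + q) * logD K x = n * K x) ->
  (forall x, bx B x -> K x = 0) \/
  exists N k, n = INR N /\ forall x, bx B x -> K x = k * (ln x + q) ^ N.
Proof.
  intros HB Hx0 Hz. induction M as [|M IH]; intros K n SK Hn H.
  - left. simpl in Hn. now apply (euler_negative B K q n x0).
  - assert (P : forall s, bx B s -> 0 < s) by apply HB.
    assert (S1 := smooth_logD B K HB SK).
    destruct (IH (logD K) (n - 1) S1) as [Z|(N & k & EN & Ek)].
    + rewrite S_INR in Hn. lra.
    + intros x Hx. assert (D := smooth_of_x_derive B K x HB SK Hx).
      assert (D1 := smooth_of_x_derive B _ x HB S1 Hx).
      assert (Px := P x Hx).
      assert (E1 : is_derive (fun x => (ln x + q) * logD K x) x
        (/ x * logD K x + (ln x + q) * (logD (logD K) x / x))).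
      { auto_derive; [ repeat split; [ exact Px | eexists; exact D1 ] | ].
        change (fun x => logD K x) with (logD K). rewrite (is_derive_unique _ _ _ D1).
        field. lra. }
      assert (E2 : is_derive (fun x => (ln x + q) * logD K x) x (n * (logD K x / x))).
      { apply is_derive_ext_loc with (fun x => n * K x).
        - destruct HB as (_ & (O & _) & _). generalize (O x Hx). apply filter_imp.
          intros y Hy. symmetry. now apply H.
        - auto_derive; [ eexists; exact D | ].
          rewrite_derive D. ring. }
      apply is_derive_unique in E1. apply is_derive_unique in E2. rewrite E1 in E2.
      assert (E3 : x * (/ x * logD K x + (ln x + q) * (logD (logD K) x / x))
                   = x * (n * (logD K x / x))) by now rewrite E2.
      replace (x * (/ x * logD K x + (ln x + q) * (logD (logD K) x / x)))
        with (logD K x + (ln x + q) * logD (logD K) x) in E3 by (field; lra).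
      replace (x * (n * (logD K x / x))) with (n * logD K x) in E3 by (field; lra). lra.
    + destruct (Req_dec n 0) as [N0|N0].
      * right. exists O, (K x0). split; [ simpl; lra | ]. intros x Hx. simpl.
        rewrite Rmult_1_r. apply derive_zero_constant with (bx B); auto; [ apply HB | ].
        intros s Hs. assert (D := smooth_of_x_derive B K s HB SK Hs).
        rewrite (Z s Hs) in D. unfold Rdiv in D. now rewrite Rmult_0_l in D.
      * left. intros x Hx. specialize (H x Hx). rewrite (Z x Hx) in H.
        apply Rmult_eq_reg_l with n; lra.
    + right. exists (S N), (k / n).
      assert (N0 : n <> 0) by (assert (0 <= INR N) by apply pos_INR; lra).
      split; [ rewrite S_INR; lra | ]. intros x Hx. specialize (H x Hx).
      rewrite (Ek x Hx) in H. apply Rmult_eq_reg_l with n; [ | exact N0 ].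
      rewrite <- H. simpl. field. exact N0.
Qed.

(** * Reduction to the canonical coefficients *)

Lemma rpow_INR a N : rpow a (INR N) = a ^ N.
Proof.
  unfold rpow. destruct (Rlt_dec 0 a) as [H|H].
  - now apply Rpower_pow.
  - rewrite Int_part_INR. symmetry. apply pow_powerRZ.
Qed.

Lemma ln_scaled_power e q x :
  ln (exp (e * q) * Rpower x e) = e * (ln x + q).
Proof.
  unfold Rpower. rewrite ln_mult, !ln_exp by apply exp_pos. ring.
Qed.

(** The part of an equivalence transformation that concerns x and f: the new variable has logarithm
    e (ln x + q), and f becomes k f - m. *)
Definition reducible (B : box) (f : R -> R) : Prop :=
  exists (e q k m : R) (h : R -> R) (D : R -> Prop) (L : list vfield),
    e <> 0 /\ k <> 0 /\ canonical h D L /\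
    forall x, bx B x ->
      D (exp (e * q) * Rpower x e) /\ k * f x - m = h (exp (e * q) * Rpower x e).

Lemma reducible_affine B f e q k m h D L : e <> 0 -> k <> 0 -> canonical h D L ->
  (forall x, bx B x -> D (exp (e * q) * Rpower x e) /\
     f x = k * h (exp (e * q) * Rpower x e) + m) -> reducible B f.
Proof.
  intros He Hk HC H. exists e, q, (/ k), (m / k), h, D, L.
  do 3 (split; [ auto using Rinv_neq_0_compat | ]). intros x Hx.
  destruct (H x Hx) as [H1 ->]. split; [ exact H1 | field; exact Hk ].
Qed.

Lemma scaled_power_pos e q x : 0 < exp (e * q) * Rpower x e.
Proof. apply Rmult_lt_0_compat; apply exp_pos. Qed.

(** Serves intervals on which ln x + q may vanish or change sign: with e = 1 the new variable has
    logarithm ln x + q, and at natural exponents [rpow] is the ordinary power. *)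
Lemma reducible_monomial B f q k m N : k <> 0 -> N <> O ->
  (forall x, bx B x -> f x = k * (ln x + q) ^ N + m) -> reducible B f.
Proof.
  intros Hk HN Hf.
  assert (Pos := scaled_power_pos 1 q).
  assert (Hl : forall x, ln (exp (1 * q) * Rpower x 1) = ln x + q).
  { intros x. rewrite ln_scaled_power. ring. }
  destruct (Nat.eq_dec N 1) as [->|N1].
  - apply (reducible_affine B f 1 q k m _ _ _ R1_neq_R0 Hk canonical_ln).
    intros x Hx. split; [ apply Pos | ]. rewrite Hl, (Hf x Hx). ring.
  - eapply (reducible_affine B f 1 q k m _ _ _ R1_neq_R0 Hk (canonical_ln_pow (INR N) _ _ _)).
    intros x Hx. split.
    + split; [ apply Pos | ]. right. exists (Z.of_nat N).
      split; [ apply INR_IZR_INZ | right; lia ].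
    + now rewrite Hl, rpow_INR, (Hf x Hx).
    Unshelve.
    + assert (0 <= INR N) by apply pos_INR. lra.
    + now apply not_0_INR.
    + intros E. apply N1, INR_eq, E.
Qed.

(** Taking [s] as the exponent of x makes the new logarithm positive, by an inversion of x when ln x
    + q < 0. The exponents 1 and -2 lead to canonical equations of their own. *)
Lemma reducible_power B f s q k m n : k <> 0 -> n <> 0 -> s <> 0 ->
  (forall x, bx B x -> 0 < s * (ln x + q)) ->
  (forall x, bx B x -> f x = k * Rpower (s * (ln x + q)) n + m) -> reducible B f.
Proof.
  intros Hk Hn Hs Hpos Hf.
  assert (Hl := ln_scaled_power s q). assert (Pos := scaled_power_pos s q).
  destruct (Req_dec n 1) as [->|N1]; [ | destruct (Req_dec n (-2)) as [->|N2] ].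
  - apply (reducible_affine B f s q k m _ _ _ Hs Hk canonical_ln).
    intros x Hx. split; [ apply Pos | ]. rewrite Hl, (Hf x Hx).
    now rewrite Rpower_1 by now apply Hpos.
  - apply (reducible_affine B f s q k m _ _ _ Hs Hk canonical_ln_m2).
    intros x Hx. specialize (Hpos x Hx). cbv beta. rewrite Hl. split; [ split; [ apply Pos | lra ] | ].
    rewrite (Hf x Hx). replace (-2) with (- INR 2) by (simpl; ring).
    rewrite Rpower_Ropp, Rpower_pow by exact Hpos. simpl. field.
    split; intros Z; rewrite Z in Hpos; lra.
  - apply (reducible_affine B f s q k m _ _ _ Hs Hk (canonical_ln_pow n N2 Hn N1)).
    intros x Hx. specialize (Hpos x Hx). cbv beta. rewrite Hl.
    split; [ split; [ apply Pos | now left ] | ].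
    rewrite (Hf x Hx). unfold rpow. now destruct (Rlt_dec 0 (s * (ln x + q))).
Qed.

Lemma ode_sign B q : domain B -> ~ bx B (exp (- q)) ->
  exists s, (s = 1 \/ s = -1) /\ forall x, bx B x -> 0 < s * (ln x + q).
Proof.
  intros HB HN. assert (P : forall s, bx B s -> 0 < s) by apply HB.
  destruct HB as (_ & (_ & [xa Ha] & CJ) & _).
  assert (NZ : forall x, bx B x -> ln x + q <> 0).
  { intros x Hx Z. apply HN. replace (exp (- q)) with x; [ exact Hx | ].
    replace (- q) with (ln x) by lra. rewrite exp_ln; auto. }
  assert (Mid : forall x y, bx B x -> bx B y -> ln x + q < 0 -> 0 < ln y + q -> False).
  { intros x y Hx Hy Lx Ly. apply HN. apply (CJ x _ y Hx Hy).
    rewrite <- (exp_ln x), <- (exp_ln y) by auto.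
    split; left; apply exp_increasing; lra. }
  destruct (Rtotal_order (ln xa + q) 0) as [L|[L|L]].
  - exists (-1). split; [ now right | ]. intros x Hx.
    destruct (Rtotal_order (ln x + q) 0) as [K|[K|K]]; [ lra | now apply NZ in K | ].
    exfalso. now apply (Mid xa x).
  - now apply NZ in L.
  - exists 1. split; [ now left | ]. intros x Hx.
    destruct (Rtotal_order (ln x + q) 0) as [K|[K|K]]; [ | now apply NZ in K | lra ].
    exfalso. now apply (Mid x xa).
Qed.

(** For a = 0 the equation has constant coefficients in ln x, with solutions affine or exponential
    in ln x, that is ln x and x up to equivalence. For a <> 0 it is an Euler equation in ln x + q,
    with logarithms for n = 0 and powers otherwise, and its singular point exp(-q) may lie in the
    interval. *)
Lemma ode_reducible B f a b c d :
  domain B -> smooth B (fun _ x _ _ => f x) ->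
  (exists x1 x2, bx B x1 /\ bx B x2 /\ f x1 <> f x2) ->
  (a <> 0 \/ b <> 0) ->
  (forall x, bx B x -> logD f x * (a * ln x + b) = c * f x + d) -> reducible B f.
Proof.
  intros HB Sf (xa & xb & Hxa & Hxb & Hab) Hnz H.
  assert (P : forall s, bx B s -> 0 < s) by apply HB.
  assert (CJ : forall a b c, bx B a -> bx B c -> a <= b <= c -> bx B b) by apply HB.
  assert (Df := fun x Hx => smooth_of_x_derive B f x HB Sf Hx).
  destruct (Req_dec a 0) as [->|Ha].
  - assert (Hb : b <> 0) by tauto. clear Hnz.
    destruct (Req_dec c 0) as [->|Hc].
    + set (k := d / b). set (m := f xa - k * ln xa).
      assert (E : forall x, bx B x -> f x = k * (ln x + 0) ^ 1 + m).
      { intros x Hx.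
        assert (E : f x - k * ln x = m); [ | lra ].
        apply (derive_zero_constant (bx B) (fun x => f x - k * ln x)); auto.
        intros s Hs. assert (Ps := P s Hs). specialize (Df s Hs). specialize (H s Hs).
        auto_derive; [ repeat split; [ eexists; exact Df | exact Ps ] | ].
        rewrite_derive Df.
        apply Rmult_eq_reg_l with (s * b); [ | apply Rmult_integral_contrapositive_currified; lra ].
        transitivity (logD f s * (0 * ln s + b) - d); [ unfold k; field; lra | rewrite H; ring ]. }
      apply (reducible_monomial B f 0 k m 1); auto.
      intros Z. apply Hab. rewrite (E xa Hxa), (E xb Hxb), Z. ring.
    + set (l := c / b). assert (Hl : l <> 0).
      { unfold l. apply Rmult_integral_contrapositive_currified; auto.
        now apply Rinv_neq_0_compat. }
      set (g := fun x => (f x + d / c) * exp (- l * ln x)).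
      assert (G : forall x, bx B x -> g x = g xa).
      { intros x Hx. apply derive_zero_constant with (bx B); auto. intros s Hs. unfold g.
        assert (Ps := P s Hs). specialize (Df s Hs). specialize (H s Hs).
        auto_derive; [ repeat split; [ eexists; exact Df | exact Ps ] | ].
        rewrite_derive Df.
        transitivity (exp (- l * ln s) / s * (logD f s - l * (f s + d / c))); [ field; lra | ].
        replace (logD f s) with (l * (f s + d / c)); [ ring | ].
        apply Rmult_eq_reg_r with b; [ | exact Hb ].
        transitivity (c * f s + d); [ unfold l; field; lra | rewrite <- H; ring ]. }
      set (k := g xa) in *.
      assert (E : forall x, bx B x -> f x = k * Rpower x l - d / c).
      { intros x Hx. rewrite <- (G x Hx). unfold g, Rpower.
        rewrite Rmult_assoc, <- exp_plus.
        replace (- l * ln x + l * ln x) with 0 by ring. rewrite exp_0. ring. }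
      assert (Hk : k <> 0).
      { intros Z. apply Hab. rewrite (E xa Hxa), (E xb Hxb), Z. ring. }
      apply (reducible_affine B f l 0 k (- (d / c)) _ _ _ Hl Hk canonical_x).
      intros x Hx. cbv beta. rewrite Rmult_0_r, exp_0, Rmult_1_l.
      split; [ apply exp_pos | exact (E x Hx) ].
  - clear Hnz. set (q := b / a). set (n := c / a). set (d' := d / a).
    assert (H' : forall x, bx B x -> (ln x + q) * logD f x = n * f x + d').
    { intros x Hx. specialize (H x Hx). apply Rmult_eq_reg_l with a; [ | exact Ha ].
      transitivity (c * f x + d); [ rewrite <- H; unfold q; field; exact Ha
                                  | unfold n, d'; field; exact Ha ]. }
    clear H. clearbody q n d'.
    destruct (Req_dec n 0) as [->|Hn].
    + destruct (classic (bx B (exp (- q)))) as [H0|H0].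
      (* At the singular point the left-hand side vanishes, so d' = 0, and a smooth solution of
         exponent 0 is constant. *)
      * exfalso. assert (Hz : ln (exp (- q)) + q = 0) by (rewrite ln_exp; ring).
        assert (D0 : d' = 0).
        { specialize (H' _ H0). rewrite Hz in H'. lra. }
        destruct (euler_monomial B q (exp (- q)) 1 HB H0 Hz f 0 Sf) as [Z|(N & k & EN & Ek)].
        -- simpl. lra.
        -- intros x Hx. rewrite (H' x Hx), D0. ring.
        -- apply Hab. now rewrite !Z.
        -- assert (N = O) by (apply INR_eq; simpl; lra). subst N.
           apply Hab. rewrite (Ek xa Hxa), (Ek xb Hxb). reflexivity.
      * destruct (ode_sign B q HB H0) as (s & Hs & Hpos).
        set (m := f xa - d' * ln (s * (ln xa + q))).
        assert (E : forall x, bx B x -> f x = d' * ln (s * (ln x + q)) + m).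
        { intros x Hx. assert (E : f x - d' * ln (s * (ln x + q)) = m); [ | lra ].
          apply (derive_zero_constant (bx B) (fun x => f x - d' * ln (s * (ln x + q)))); auto.
          intros r Hr. assert (Pr := P r Hr). specialize (Df r Hr). specialize (H' r Hr).
          assert (Qr := Hpos r Hr).
          assert (Nz : ln r + q <> 0) by (intros Z; rewrite Z in Qr; lra).
          auto_derive; [ repeat split; try (eexists; exact Df); assumption | ].
          rewrite_derive Df.
          transitivity (((ln r + q) * logD f r - d') / (r * (ln r + q))).
          - field. repeat split; try lra; destruct Hs; lra.
          - rewrite H'. field. split; [ exact Nz | lra ]. }
        assert (Hd : d' <> 0).
        { intros Z. apply Hab. rewrite (E xa Hxa), (E xb Hxb), Z. ring. }
        assert (Hs0 : s <> 0) by (destruct Hs; lra).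
        apply (reducible_affine B f s q d' m _ _ _ Hs0 Hd canonical_ln_ln).
        intros x Hx. cbv beta. rewrite ln_scaled_power.
        split; [ split; [ apply scaled_power_pos | now apply Hpos ] | exact (E x Hx) ].
    + set (K := fun x => f x + d' / n).
      assert (SK : smooth B (fun _ x _ _ => K x)) by (unfold K; smooth_rec).
      assert (DK : forall x, bx B x -> logD K x = logD f x).
      { intros x Hx. unfold logD, K. f_equal. apply is_derive_unique.
        specialize (Df x Hx). auto_derive; [ eexists; exact Df | ].
        change (fun x => f x) with f. ring. }
      assert (HK : forall x, bx B x -> (ln x + q) * logD K x = n * K x).
      { intros x Hx. rewrite (DK x Hx), (H' x Hx). unfold K. field. exact Hn. }
      assert (NZ : ~ forall x, bx B x -> K x = 0).
      { intros Z. apply Hab. assert (Z1 := Z xa Hxa). assert (Z2 := Z xb Hxb).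
        unfold K in Z1, Z2. lra. }
      destruct (classic (bx B (exp (- q)))) as [H0|H0].
      * assert (Hz : ln (exp (- q)) + q = 0) by (rewrite ln_exp; ring).
        destruct (INR_unbounded n) as [M HM].
        destruct (euler_monomial B q (exp (- q)) M HB H0 Hz K n SK HM HK) as [Z|(N & k & EN & Ek)].
        -- now apply NZ in Z.
        -- apply (reducible_monomial B f q k (- (d' / n)) N).
           ++ intros Z. apply NZ. intros x Hx. rewrite (Ek x Hx), Z. ring.
           ++ intros Z. apply Hn. rewrite EN, Z. reflexivity.
           ++ intros x Hx. rewrite <- (Ek x Hx). unfold K. ring.
      * destruct (ode_sign B q HB H0) as (s & Hs & Hpos).
        assert (Hs0 : s <> 0) by (destruct Hs; lra).
        set (g := fun x => K x * exp (- n * ln (s * (ln x + q)))).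
        assert (G : forall x, bx B x -> g x = g xa).
        { intros x Hx. apply derive_zero_constant with (bx B); auto. intros r Hr. unfold g.
          assert (Pr := P r Hr). specialize (HK r Hr). assert (Qr := Hpos r Hr).
          assert (Dr := smooth_of_x_derive B K r HB SK Hr).
          assert (Nz : ln r + q <> 0) by (intros Z; rewrite Z in Qr; lra).
          auto_derive; [ repeat split; try (eexists; exact Dr); assumption | ].
          rewrite_derive Dr.
          transitivity (exp (- n * ln (s * (ln r + q))) / (r * (ln r + q))
                        * ((ln r + q) * logD K r - n * K r)).
          - field. repeat split; try lra; exact Nz.
          - rewrite HK. ring. }
        set (k := g xa) in *.
        assert (E : forall x, bx B x -> f x = k * Rpower (s * (ln x + q)) n + - (d' / n)).
        { intros x Hx. rewrite <- (G x Hx). unfold g, Rpower.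
          rewrite Rmult_assoc, <- exp_plus.
          replace (- n * ln (s * (ln x + q)) + n * ln (s * (ln x + q))) with 0 by ring.
          rewrite exp_0. unfold K. ring. }
        apply (reducible_power B f s q k (- (d' / n)) n); auto.
        intros Z. apply Hab. rewrite (E xa Hxa), (E xb Hxb), Z. ring.
Qed.

Lemma reducible_equivalence B f : domain B -> reducible B f ->
  exists (g : equiv_transf) (h : R -> R) (D : R -> Prop) (L : list vfield),
    in_Gequiv B g /\ canonical h D L /\ maps_equation B g f h D.
Proof.
  intros HB (e & q & k & m & h & D & L & He & Hk & HC & H).
  (* The factors e^2 compensate the division by [e1]^2 in the transformed coefficient, which becomes
     k f - m. *)
  exists (Equiv e 0 (exp (e * q)) (e ^ 2 * m) (e ^ 2 * k) 0 1 (fun _ _ => 0)), h, D, L.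
  assert (He2 : e ^ 2 <> 0) by now apply pow_nonzero.
  assert (Hq := exp_pos (e * q)).
  split; [ | split; [ exact HC | ] ].
  - unfold in_Gequiv. cbn [e1 e3 e5 e7 phi]. split; [ | split ].
    + repeat apply Rmult_integral_contrapositive_currified; auto; lra.
    + now apply smooth_const.
    + intros t x _ _. rewrite !Derive_const. simpl.
      rewrite (Derive_ext _ (fun _ => 0)) by (intros; apply Derive_const).
      rewrite Derive_const. ring.
  - intros t x y u Hp. cbn. destruct (H x (proj1 (proj2 Hp))) as [H1 H2].
    split; [ exact H1 | ]. rewrite <- H2. simpl in He2. field. exact He.
Qed.

(** * Symmetry algebras of the canonical equations *)

Lemma interval_two_points J : open_interval J -> exists a b, J a /\ J b /\ a <> b.
Proof.
  intros (O & [a Ha] & _). destruct (O a Ha) as [d Hd]. assert (P := cond_pos d).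
  exists a, (a + d / 2). repeat split; [ exact Ha | | lra ].
  apply Hd. unfold ball; simpl. unfold AbsRing_ball, abs, minus, plus, opp; simpl.
  apply Rabs_def1; lra.
Qed.

Lemma poly_zero J l : open_interval J -> (forall s, J s -> horner l s = 0) ->
  List.Forall (fun c => c = 0) l.
Proof.
  intros (O & E & _) H. apply (horner_zero J (fun s => s) (fun _ => 1) l O E); auto.
  intros x _. split; [ exact (is_derive_id x) | lra ].
Qed.

Lemma log_poly_zero B l : domain B -> (forall x, bx B x -> horner l (ln x) = 0) ->
  List.Forall (fun c => c = 0) l.
Proof.
  intros HB H. assert (HB' := HB). destruct HB' as (_ & (O & E & _) & _ & _ & P).
  apply (horner_zero (bx B) ln Rinv l O E); auto.
  intros x Hx. specialize (P x Hx). split; [ now apply is_derive_ln | ].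
  apply Rinv_neq_0_compat. lra.
Qed.

Lemma equal_pd B F G : domain B -> smooth B F -> smooth B G ->
  (forall v, eq_on B (pd v F) (pd v G)) ->
  exists C, eq_on B F (fun t x y u => G t x y u + C).
Proof.
  intros HB SF SG H.
  destruct (constant_of_pd B (fun t x y u => F t x y u - G t x y u) HB) as [C HC].
  - smooth_rec.
  - intros v t x y u Hp. pd_compute B. rewrite (H v _ _ _ _ Hp). ring.
  - exists C. intros t x y u Hp. rewrite <- (HC _ _ _ _ Hp). ring.
Qed.

(* Finds [F] from its known partial derivatives, given a candidate [G] with the same ones. The
   constants [C] obtained in this way become the coefficients of the basis operators. *)
Tactic Notation "integrate" constr(B) constr(HB) constr(F) constr(G) "as" ident(C) ident(H) :=
  destruct (equal_pd B F G HB) as [C H];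
  [ smooth_rec | smooth_rec
  | intros []; intros t x y u Hp; pd_compute B; simpl INR; simpl Nat.pred; reduce_on Hp;
    first [ ring | field | lra ]
  | cbv beta in H ].

Ltac vf_smooth_rec :=
  refine (conj _ (conj _ (conj _ _)));
  cbn [xi0 xi1 xi2 eta vf_add vf_scale vf_zero vf_beta op_t op_y op_u]; smooth_rec.

(** * Verification of listed operators *)

(** The determining equations are linear in [X], so linear combinations can be handled without
    returning to the prolongation. *)
Definition operator (B : box) (f : R -> R) (X : vfield) : Prop :=
  vf_smooth B X /\ determining B f X.

Lemma operator_combination B f k X Y : domain B -> operator B f X -> operator B f Y ->
  operator B f (vf_add (vf_scale k X) Y).
Proof.
  intros HB [(S0 & S1 & S2 & S3) DX] [(T0 & T1 & T2 & T3) DY]. split.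
  { vf_smooth_rec. }
  intros t x y u Hp.
  destruct (DX _ _ _ _ Hp) as ((A1 & A2) & (A3 & A4) & (A5 & A6) & A7 & A8 & A9 & A10).
  destruct (DY _ _ _ _ Hp) as ((B1 & B2) & (B3 & B4) & (B5 & B6) & B7 & B8 & B9 & B10).
  cbv beta zeta in *.
  assert (Pe : forall v F G, smooth B F -> smooth B G ->
     eq_on B (pd v (fun t x y u => k * F t x y u + G t x y u))
             (fun t x y u => k * pd v F t x y u + pd v G t x y u)).
  { intros v F G SF SG a b c d H. pd_compute B. ring. }
  unfold determining_at. cbn [xi0 xi1 xi2 eta vf_add vf_scale].
  rewrite (pd_ext Vu HB (Pe Vu _ _ S3 T3) _ _ _ _ Hp),
    (pd_ext Vx HB (Pe Vu _ _ S3 T3) _ _ _ _ Hp),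
    (pd_ext Vx HB (Pe Vx _ _ S1 T1) _ _ _ _ Hp),
    (pd_ext Vx HB (Pe Vx _ _ S3 T3) _ _ _ _ Hp).
  pd_compute B.
  rewrite A1, A2, A3, A4, A5, A6, A10, B1, B2, B3, B4, B5, B6, B10.
  repeat split; try ring.
  - transitivity (k * (2 * (x * pd Vx (xi1 X) t x y u - xi1 X t x y u))
      + 2 * (x * pd Vx (xi1 Y) t x y u - xi1 Y t x y u)); [ ring | rewrite A7, B7; ring ].
  - transitivity (k * (Derive f x * xi1 X t x y u) + Derive f x * xi1 Y t x y u);
      [ ring | rewrite A8, B8; ring ].
  - transitivity (k * (x ^ 2 * (2 * pd Vx (pd Vu (eta X)) t x y u - pd Vx (pd Vx (xi1 X)) t x y u))
      + x ^ 2 * (2 * pd Vx (pd Vu (eta Y)) t x y u - pd Vx (pd Vx (xi1 Y)) t x y u));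
      [ ring | rewrite A9, B9; ring ].
Qed.

Lemma operator_beta B f beta : domain B -> solution B f beta -> operator B f (vf_beta beta).
Proof.
  intros HB [Sb Eb]. split.
  { vf_smooth_rec. }
  intros t x y u Hp. unfold determining_at. cbn [xi0 xi1 xi2 eta vf_beta].
  assert (Z : forall v c, eq_on B (pd v (fun _ _ _ _ => c)) zero4).
  { intros v c a b c0 d _. apply pd_const. }
  assert (Zu : eq_on B (pd Vu (fun t x y _ => beta t x y)) zero4).
  { intros a b c d _. unfold pd. apply Derive_const. }
  rewrite (pd_zero B Vu Vu _ HB Zu _ _ _ _ Hp), (pd_zero B Vu Vx _ HB Zu _ _ _ _ Hp),
    (pd_zero B Vx Vx _ HB (Z Vx 0) _ _ _ _ Hp), !pd_const.
  repeat split; try ring.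
  destruct Hp as (Ht & Hx & Hy & _). exact (Eb t x y Ht Hx Hy).
Qed.

Lemma operator_ext B f X Y : domain B -> vf_eq B X Y -> operator B f X -> operator B f Y.
Proof.
  intros HB HE [(S0 & S1 & S2 & S3) DX].
  assert (E0 : eq_on B (xi0 X) (xi0 Y)) by (intros t x y u Hp; apply HE, Hp).
  assert (E1 : eq_on B (xi1 X) (xi1 Y)) by (intros t x y u Hp; apply HE, Hp).
  assert (E2 : eq_on B (xi2 X) (xi2 Y)) by (intros t x y u Hp; apply HE, Hp).
  assert (E3 : eq_on B (eta X) (eta Y)) by (intros t x y u Hp; apply HE, Hp).
  split.
  { refine (conj _ (conj _ (conj _ _))); eapply smooth_ext; eauto. }
  intros t x y u Hp. assert (D := DX _ _ _ _ Hp). revert D.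
  unfold determining_at. cbv zeta.
  rewrite (E1 _ _ _ _ Hp).
  rewrite !(pd_ext _ HB E0 _ _ _ _ Hp), !(pd_ext _ HB E1 _ _ _ _ Hp),
    !(pd_ext _ HB E2 _ _ _ _ Hp), !(pd_ext _ HB E3 _ _ _ _ Hp),
    !(pd_ext _ HB (pd_ext _ HB E3) _ _ _ _ Hp),
    !(pd_ext _ HB (pd_ext _ HB E1) _ _ _ _ Hp).
  trivial.
Qed.

Lemma operator_zero B f : domain B -> operator B f vf_zero.
Proof.
  intros HB. apply (operator_beta B f (fun _ _ _ => 0) HB). split.
  - now apply smooth_const.
  - intros t x y _ _ _. rewrite !Derive_const. simpl.
    rewrite (Derive_ext _ (fun _ => 0)) by (intros; apply Derive_const).
    rewrite Derive_const. ring.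
Qed.

Lemma operator_lincomb B f c L : domain B -> List.Forall (operator B f) L ->
  operator B f (lincomb c L).
Proof.
  intros HB HL. revert c. induction HL as [|X L HX _ IH]; intros [|a c];
    try (now apply operator_zero).
  apply operator_combination; [ exact HB | exact HX | apply IH ].
Qed.

(** The reduced system for fields with tau_y = 0 and eta = A u. [A1] gives A_x in closed form, so
    that A_xx is again one explicit first derivative. *)
Lemma operator_explicit B f tau zeta psi A A1 V : domain B -> smooth B (fun _ x _ _ => f x) ->
  smooth B tau -> smooth B zeta -> smooth B psi -> smooth B A -> smooth B A1 ->
  eq_on B (pd Vx A) A1 ->
  (forall t x y u, in_box B t x y u -> x <> 0 ->
     (pd Vx tau t x y u = 0 /\ pd Vy tau t x y u = 0 /\ pd Vu tau t x y u = 0) /\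
     (pd Vx psi t x y u = 0 /\ pd Vu psi t x y u = 0) /\
     (pd Vu zeta t x y u = 0 /\ pd Vu A t x y u = 0) /\
     pd Vx zeta t x y u = pd Vt tau t x y u / (2 * x) /\
     logD f x * zeta t x y u
       = - f x * (pd Vt tau t x y u - pd Vy psi t x y u) - pd Vt psi t x y u /\
     2 * (x * A1 t x y u)
       = f x * pd Vy zeta t x y u - pd Vt zeta t x y u + pd Vt tau t x y u / 2 /\
     pd Vt A t x y u = x ^ 2 * pd Vx A1 t x y u + f x * pd Vy A t x y u) ->
  vf_eq B (VF tau (fun t x y u => x * zeta t x y u) psi (fun t x y u => A t x y u * u)) V ->
  operator B f V.
Proof.
  intros HB Sf St Sz Sp SA SA1 EA H HV.
  apply operator_ext with (1 := HB) (2 := HV). clear HV.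
  assert (Nx : forall t x y u, in_box B t x y u -> x <> 0).
  { intros t x y u. now apply in_box_x_neq0. }
  assert (N2x : forall t x y u : R, in_box B t x y u -> 2 * x <> 0).
  { intros t x y u Hp. specialize (Nx t x y u Hp). lra. }
  split; [ vf_smooth_rec | ].
  assert (Tx : eq_on B (pd Vx tau) zero4).
  { intros t x y u Hp. apply (H t x y u Hp (Nx _ _ _ _ Hp)). }
  assert (Zx : eq_on B (pd Vx zeta) (fun t x y u => pd Vt tau t x y u / (2 * x))).
  { intros t x y u Hp. apply (H t x y u Hp (Nx _ _ _ _ Hp)). }
  assert (Au : eq_on B (pd Vu A) zero4).
  { intros t x y u Hp. apply (H t x y u Hp (Nx _ _ _ _ Hp)). }
  assert (Zxx : eq_on B (pd Vx (fun t x y u => x * zeta t x y u))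
                  (fun t x y u => zeta t x y u + pd Vt tau t x y u / 2)).
  { intros t x y u Hp. pd_compute B. rewrite (Zx _ _ _ _ Hp). field. now apply (Nx t x y u). }
  assert (Eu : eq_on B (pd Vu (fun t x y u => A t x y u * u)) A).
  { intros t x y u Hp. pd_compute B. rewrite (Au _ _ _ _ Hp). ring. }
  assert (Ex : eq_on B (pd Vx (fun t x y u => A t x y u * u)) (fun t x y u => A1 t x y u * u)).
  { intros t x y u Hp. pd_compute B. rewrite (EA _ _ _ _ Hp). ring. }
  intros t x y u Hp. assert (N := Nx _ _ _ _ Hp).
  destruct (H t x y u Hp N) as ((T1 & T2 & T3) & (P1 & P2) & (Z1 & A0) & _ & Hb & Hc & Hd).
  unfold determining_at; cbn [xi0 xi1 xi2 eta].
  rewrite !(pd_ext _ HB Zxx _ _ _ _ Hp), !(pd_ext _ HB Eu _ _ _ _ Hp),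
    !(pd_ext _ HB Ex _ _ _ _ Hp), (Zxx _ _ _ _ Hp).
  pd_compute B.
  rewrite T1, T2, T3, P1, P2, Z1, A0, Hd, (Zx _ _ _ _ Hp), (EA _ _ _ _ Hp).
  rewrite (pd_zero_comm B Vx Vt tau HB St Tx _ _ _ _ Hp).
  repeat split; try ring.
  - field.
  - transitivity (logD f x * zeta t x y u); [ unfold logD; ring | rewrite Hb; ring ].
  - transitivity (x * (2 * (x * A1 t x y u)) - x * pd Vt tau t x y u / 2); [ field; exact N | ].
    rewrite Hc. field.
Qed.

Tactic Notation "check_operator" constr(B) constr(HB)
  constr(tau) constr(zeta) constr(psi) constr(A) constr(A1) :=
  assert (box_neq0 := fun t x y u => @in_box_x_neq0 B t x y u HB);
  apply (operator_explicit B _ tau zeta psi A A1 _ HB);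
  [ assumption | smooth_rec | smooth_rec | smooth_rec | smooth_rec | smooth_rec
  | intros t x y u Hp; assert (x_neq0 := box_neq0 _ _ _ _ Hp);
    assert (x_pos := in_box_x_pos HB Hp);
    pd_compute B; simpl INR; simpl Nat.pred; field; assumption
  | intros t x y u Hp x_neq0; assert (x_pos := in_box_x_pos HB Hp);
    pd_compute B; simpl INR; simpl Nat.pred
  | intros t x y u Hp; cbn [xi0 xi1 xi2 eta op_t op_y op_u];
    repeat split; try reflexivity; try (field; now apply (box_neq0 _ _ _ _ Hp)) ].

Lemma operator_t B f : domain B -> smooth B (fun _ x _ _ => f x) -> operator B f op_t.
Proof.
  intros HB Sf. check_operator B HB (fun _ _ _ _ : R => 1) zero4 zero4 zero4 zero4.
  repeat split; try ring; field; assumption.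
Qed.

Lemma operator_y B f : domain B -> smooth B (fun _ x _ _ => f x) -> operator B f op_y.
Proof.
  intros HB Sf. check_operator B HB zero4 zero4 (fun _ _ _ _ : R => 1) zero4 zero4.
  repeat split; try ring; field; assumption.
Qed.

Lemma operator_u B f : domain B -> smooth B (fun _ x _ _ => f x) -> operator B f op_u.
Proof.
  intros HB Sf. check_operator B HB zero4 zero4 zero4 (fun _ _ _ _ : R => 1) zero4.
  repeat split; try ring; field; assumption.
Qed.

(** * A criterion for the finite-dimensional part *)

Lemma lincomb_zero c L t x y u : List.Forall (fun a => a = 0) c ->
  xi0 (lincomb c L) t x y u = 0 /\ xi1 (lincomb c L) t x y u = 0 /\
  xi2 (lincomb c L) t x y u = 0 /\ eta (lincomb c L) t x y u = 0.
Proof.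
  intros Hc. revert L. induction Hc as [|a c Ha _ IH]; intros [|X L];
    try (now repeat split).
  destruct (IH L) as (I0 & I1 & I2 & I3). unfold lincomb in *.
  cbn [combine fold_right xi0 xi1 xi2 eta vf_add vf_scale fst snd].
  rewrite Ha, I0, I1, I2, I3. repeat split; ring.
Qed.

(** In each list xi0 and xi2 separate all operators but u d_u. The coefficient k of the latter is
    caught by eta: k u = beta(t,x,y) at two values of u forces k = 0. The same argument, [Direct],
    shows that the sum is direct. As beta is supplied by [symmetry_shape], a symmetry need only be
    matched up to eta_u. *)
Lemma basis_criterion B f L :
  domain B -> smooth B (fun _ x _ _ => f x) ->
  List.Forall (operator B f) L ->
  (forall a b k c, length c = length L ->
     (forall t x y u, in_box B t x y u ->
        let V := lincomb (a :: b :: k :: c) (op_t :: op_y :: op_u :: L) in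
        xi0 V t x y u = 0 /\ xi2 V t x y u = 0) ->
     a = 0 /\ b = 0 /\ List.Forall (fun s => s = 0) c) ->
  (forall X, lie_symmetry B f X -> exists a b k c, length c = length L /\
     forall t x y u, in_box B t x y u ->
        let V := lincomb (a :: b :: k :: c) (op_t :: op_y :: op_u :: L) in
        xi0 X t x y u = xi0 V t x y u /\ xi1 X t x y u = xi1 V t x y u /\
        xi2 X t x y u = xi2 V t x y u /\
        pd Vu (eta X) t x y u * u = eta V t x y u) ->
  finite_part_basis B f (op_t :: op_y :: op_u :: L).
Proof.
  intros HB Sf HL HI HX.
  assert (Df : forall x, bx B x -> ex_derive f x).
  { intros x Hx. eexists. now apply smooth_of_x_derive with B. }
  assert (Direct : forall c beta, length c = length (op_t :: op_y :: op_u :: L) ->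
     vf_eq B (lincomb c (op_t :: op_y :: op_u :: L)) (vf_beta beta) ->
     List.Forall (fun s => s = 0) c).
  { intros [|a [|b [|k c]]] beta Hlen; try discriminate. intros HV.
    destruct (HI a b k c) as (Ha & Hb & Hc).
    - simpl in Hlen. congruence.
    - intros t x y u Hp. destruct (HV _ _ _ _ Hp) as (H0 & _ & H2 & _).
      split; [ exact H0 | exact H2 ].
    - destruct (domain_point B HB) as (t & x & y & u0 & Ht & Hxx & Hy & _).
      destruct (interval_two_points (bu B)) as (u1 & u2 & Hu1 & Hu2 & Hu); [ apply HB | ].
      assert (K : forall u, bu B u -> k * u = beta t x y).
      { intros u Hu'. destruct (HV t x y u) as (_ & _ & _ & H3); [ repeat split; assumption | ].
        destruct (lincomb_zero c L t x y u Hc) as (_ & _ & _ & E).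
        unfold lincomb in H3, E.
        cbn [combine fold_right xi0 xi1 xi2 eta vf_add vf_scale fst snd op_t op_y op_u vf_beta] in H3.
        rewrite E in H3. lra. }
      assert (K1 := K u1 Hu1). assert (K2 := K u2 Hu2).
      assert (K3 : k * (u1 - u2) = 0) by lra.
      apply Rmult_integral in K3. destruct K3 as [K3|K3]; [ | lra ].
      repeat constructor; assumption. }
  split; [ | split ].
  - intros c Hc HV. now apply (Direct c (fun _ _ _ => 0)).
  - intros X. split.
    + intros HS. destruct (HX X HS) as (a & b & k & c & Hlen & HV).
      destruct (symmetry_shape B f X HB Sf HS) as (_ & _ & _ & beta & Sb & Eb).
      exists (a :: b :: k :: c), beta. split; [ simpl; now rewrite Hlen | split; [ exact Sb | ] ].
      intros t x y u Hp. destruct (HV _ _ _ _ Hp) as (H0 & H1 & H2 & H3).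
      unfold vf_add, vf_beta. cbn [xi0 xi1 xi2 eta].
      rewrite (Eb _ _ _ _ Hp), H0, H1, H2, H3. repeat split; ring.
    + intros (c & beta & _ & Sb & HE).
      assert (OX : operator B f X).
      { apply operator_ext with (vf_add (vf_scale 1
          (lincomb c (op_t :: op_y :: op_u :: L))) (vf_beta beta)); [ exact HB | | ].
        - intros t x y u Hp. destruct (HE _ _ _ _ Hp) as (H0 & H1 & H2 & H3).
          cbn [xi0 xi1 xi2 eta vf_add vf_scale] in *. rewrite !Rmult_1_l. now repeat split.
        - apply operator_combination; [ exact HB | | now apply operator_beta ].
          apply operator_lincomb; [ exact HB | ].
          exact (Forall_cons _ (operator_t B f HB Sf) (Forall_cons _ (operator_y B f HB Sf)
                   (Forall_cons _ (operator_u B f HB Sf) HL))). }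
      destruct OX. now apply determining_lie_symmetry.
  - intros c beta Hlen Sb HV t x y u Hp.
    destruct (lincomb_zero c (op_t :: op_y :: op_u :: L) t x y u (Direct c beta Hlen HV))
      as (H0 & H1 & H2 & H3).
    rewrite H0, H1, H2, H3. now repeat split.
Qed.

(** * Consequences common to the symmetries of all equations of the class *)

Lemma derive_vanishing B F x d : domain B -> (forall s, bx B s -> F s = 0) -> bx B x ->
  is_derive F x d -> d = 0.
Proof.
  intros (_ & (O & _) & _) H Hx D. apply is_derive_unique in D. rewrite <- D.
  apply is_derive_unique. apply is_derive_ext_loc with (fun _ => 0);
    [ | exact (is_derive_const 0 x) ].
  generalize (O x Hx). apply filter_imp. intros s Hs. symmetry. now apply H.
Qed.

Lemma nonconstant_of_logD B f x : domain B -> smooth B (fun _ x _ _ => f x) ->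
  bx B x -> logD f x <> 0 -> exists x1 x2, bx B x1 /\ bx B x2 /\ f x1 <> f x2.
Proof.
  intros HB Sf Hx Hd. apply NNPP. intros N. apply Hd.
  assert (D := smooth_of_x_derive B f x HB Sf Hx).
  assert (E : logD f x / x = 0).
  { apply (derive_vanishing B (fun s => f s - f x) x); auto.
    - intros s Hs. apply Rminus_diag_eq, NNPP. intros N'. apply N. now exists s, x.
    - auto_derive; [ eexists; exact D | ].
      rewrite_derive D. ring. }
  assert (P : 0 < x) by now apply HB.
  transitivity (x * (logD f x / x)); [ field; lra | rewrite E; ring ].
Qed.

(** What is known before f is specified; each canonical case starts from here. *)
Record point_symmetry (B : box) (f : R -> R) (X : vfield) : Prop := PointSymmetry {
  ps_reduced : reduced B f (xi0 X) (xi2 X) (zeta_of X) (pd Vu (eta X));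
  ps_tau_y : eq_on B (pd Vy (xi0 X)) zero4;
  ps_tau_u : eq_on B (pd Vu (xi0 X)) zero4;
  ps_psi_u : eq_on B (pd Vu (xi2 X)) zero4;
  ps_zeta_u : eq_on B (pd Vu (zeta_of X)) zero4;
  ps_A_u : eq_on B (pd Vu (pd Vu (eta X))) zero4;
  ps_xi1 : eq_on B (xi1 X) (fun t x y u => x * zeta_of X t x y u) }.

Lemma lie_point_symmetry B f X : domain B -> smooth B (fun _ x _ _ => f x) ->
  (exists x1 x2, bx B x1 /\ bx B x2 /\ f x1 <> f x2) ->
  lie_symmetry B f X -> point_symmetry B f X.
Proof.
  intros HB Sf Hnc HX.
  destruct (symmetry_shape B f X HB Sf HX) as (HS & HD & HR & _).
  assert (Nx : forall t x y u, in_box B t x y u -> x <> 0).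
  { intros t x y u. now apply in_box_x_neq0. }
  split.
  - exact HR.
  - now apply tau_y_zero with f (xi2 X) (zeta_of X) (pd Vu (eta X)).
  - intros t x y u Hp. apply HD, Hp.
  - intros t x y u Hp. apply HD, Hp.
  - destruct HS as (_ & S1 & _). intros t x y u Hp. unfold zeta_of. pd_compute B.
    replace (pd Vu (xi1 X) t x y u) with 0 by (symmetry; apply HD, Hp). ring.
  - intros t x y u Hp. apply HD, Hp.
  - intros t x y u Hp. unfold zeta_of. field. now apply Nx with t y u.
Qed.

(** With tau_y = 0 the term D^2 f drops out of [gauge_identity]. Since al does not depend on x, the
    last clause is at fixed (t,y) a relation between functions of x'; splitting it gives al_t, al_y
    and restrictions on tau and psi. *)
Lemma gauge_solution B f X S : domain B -> smooth B (fun _ x _ _ => f x) ->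
  point_symmetry B f X -> smooth B S -> eq_on B (pd Vu S) zero4 ->
  eq_on B (fun t x y u => x * pd Vx S t x y u)
    (fun t x y u => pd Vt (zeta_of X) t x y u - f x * pd Vy (zeta_of X) t x y u) ->
  exists al, smooth B al /\ eq_on B (pd Vx al) zero4 /\
    eq_on B (pd Vu al) zero4 /\
    (forall t x y u, in_box B t x y u ->
       2 * pd Vu (eta X) t x y u
       = al t x y u + zeta_of X t x y u + pd Vt (xi0 X) t x y u / 2 - S t x y u) /\
    (forall t x x' y u, in_box B t x y u -> bx B x' ->
       pd Vt al t x y u - f x' * pd Vy al t x y u
       = - pd Vt (pd Vt (xi0 X)) t x y u - pd Vt (xi0 X) t x y u / 2
         + logD f x' * pd Vy (zeta_of X) t x' y u
         + (pd Vt S t x' y u - f x' * pd Vy S t x' y u)).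
Proof.
  intros HB Sf PS SS Su HS. destruct PS as [HR Ty Tu Pu Zu Au _].
  assert (HR' := HR). destruct HR' as [St Sp Sz SA Tx Px _ _ _ _].
  set (al := gauge_rest f (xi0 X) (zeta_of X) (pd Vu (eta X)) S).
  assert (Sal : smooth B al) by now apply gauge_rest_smooth with (xi2 X).
  assert (Ax : eq_on B (pd Vx al) zero4)
    by now apply gauge_rest_x with (xi2 X).
  exists al. split; [ exact Sal | split; [ exact Ax | split; [ | split ] ] ].
  - intros t x y u Hp. unfold al, gauge_rest. pd_compute B.
    rewrite (Au _ _ _ _ Hp), (Zu _ _ _ _ Hp), (Su _ _ _ _ Hp).
    rewrite (pd_zero_comm B Vu Vt _ HB St Tu _ _ _ _ Hp),
      (pd_zero_comm B Vu Vy _ HB St Tu _ _ _ _ Hp). field.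
  - intros t x y u Hp. unfold al, gauge_rest. rewrite (Ty _ _ _ _ Hp). field.
  - intros t x x' y u Hp Hx'.
    assert (Hq := in_box_x Hp Hx').
    assert (K := gauge_identity B f _ _ _ _ S HB Sf HR SS HS _ _ _ _ Hq).
    cbv zeta in K. fold al in K.
    rewrite (Ty _ _ _ _ Hq), (pd_zero B Vy Vy _ HB Ty _ _ _ _ Hq),
      (pd_zero_comm B Vy Vt _ HB St Ty _ _ _ _ Hq) in K.
    revert K. shift_x Hp Hx'. intros K.
    lra.
Qed.

(** The other relation to be split: [red_b] as an identity in x', with tau_t, psi_y, psi_t and k
    constant. *)
Lemma symmetry_relation B f X t x y u : domain B -> smooth B (fun _ x _ _ => f x) ->
  point_symmetry B f X -> in_box B t x y u ->
  exists k, (forall x', bx B x' ->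
      zeta_of X t x' y u = pd Vt (xi0 X) t x y u / 2 * ln x' + k) /\
    forall x', bx B x' ->
      logD f x' * (pd Vt (xi0 X) t x y u / 2 * ln x' + k)
      = - f x' * (pd Vt (xi0 X) t x y u - pd Vy (xi2 X) t x y u) - pd Vt (xi2 X) t x y u.
Proof.
  intros HB Sf PS Hp. destruct PS as [HR Ty _ _ _ _ _].
  destruct (zeta_affine B f _ _ _ _ t y u x HB Sf HR Ty Hp) as [k Hk].
  exists k. split; [ exact Hk | ]. intros x' Hx'. rewrite <- (Hk x' Hx').
  assert (Hq := in_box_x Hp Hx').
  destruct HR as [St Sp Sz SA Tx Px _ Rb _ _].
  assert (K := Rb _ _ _ _ Hq). cbv beta in K. rewrite K, (Ty _ _ _ _ Hq).
  shift_x Hp Hx'. ring.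
Qed.

(** * Logarithmic derivatives of the canonical coefficients *)

Lemma logD_x x : logD (fun x => x) x = x.
Proof. unfold logD. rewrite Derive_id. ring. Qed.

Lemma logD_ln x : 0 < x -> logD ln x = 1.
Proof.
  intros Hx. unfold logD. rewrite (is_derive_unique _ _ _ (is_derive_ln x Hx)).
  field. lra.
Qed.

Lemma logD_ln_m2 x : 0 < x -> ln x <> 0 ->
  logD (fun x => / (ln x) ^ 2) x = - 2 * / (ln x) ^ 3.
Proof.
  intros Hx Hl. unfold logD.
  assert (D : is_derive (fun x => / (ln x) ^ 2) x (- 2 * / (ln x) ^ 3 / x)).
  { auto_derive; [ repeat split; auto; simpl; rewrite Rmult_1_r;
      now apply Rmult_integral_contrapositive_currified | ].
    field. split; [ exact Hl | lra ]. }
  transitivity (x * (- 2 * / (ln x) ^ 3 / x)).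
  - f_equal. exact (is_derive_unique _ _ _ D).
  - field. split; [ exact Hl | lra ].
Qed.

Lemma logD_ln_ln x : 0 < x -> 0 < ln x -> logD (fun x => ln (ln x)) x = / ln x.
Proof.
  intros Hx Hl. unfold logD.
  assert (D : is_derive (fun x => ln (ln x)) x (/ ln x / x)).
  { auto_derive; [ repeat split; auto | ]. field. split; lra. }
  transitivity (x * (/ ln x / x)).
  - f_equal. exact (is_derive_unique _ _ _ D).
  - field. split; lra.
Qed.

Ltac lincomb_simpl :=
  unfold lincomb in *;
  cbn [combine fold_right xi0 xi1 xi2 eta vf_add vf_scale vf_zero fst snd op_t op_y op_u] in *.

(** * The coefficients ln^n x and ln ln x *)

(** For h = z^n with z = ln x these are the functions z^(n+1), z^n and z; two of them coincide for n
    = 0 and for n = 1. The Euler equation stands in for the explicit power, so no sign of ln x has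
    to be distinguished. *)
Lemma log_power_independent B h n x0 p r s : domain B -> smooth B (fun _ x _ _ => h x) ->
  (forall x, bx B x -> ln x * logD h x = n * h x) ->
  bx B x0 -> ln x0 <> 0 -> h x0 <> 0 -> n <> 0 -> n <> 1 ->
  (forall x, bx B x -> h x * (p * ln x + r) + s * ln x = 0) -> p = 0 /\ r = 0 /\ s = 0.
Proof.
  intros HB Sh Hh Hx0 Nl Nh N0 N1 H.
  assert (P : forall x, bx B x -> 0 < x) by apply HB.
  assert (D := fun x Hx => smooth_of_x_derive B h x HB Sh Hx).
  (* Applying z d/dz - n to the relation annihilates the term r h. *)
  assert (E2 : forall x, bx B x -> ln x * (h x * p + (1 - n) * s) = 0).
  { intros x Hx. specialize (D x Hx). specialize (P x Hx). assert (Hx' := H x Hx).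
    assert (K : logD h x / x * (p * ln x + r) + h x * p / x + s / x = 0).
    { apply (derive_vanishing B _ x _ HB H Hx).
      auto_derive; [ repeat split; [ eexists; exact D | exact P | exact P ] | ].
      rewrite_derive D. field. lra. }
    assert (K' : logD h x * (p * ln x + r) + h x * p + s = 0).
    { transitivity (x * (logD h x / x * (p * ln x + r) + h x * p / x + s / x));
        [ field; lra | rewrite K; ring ]. }
    transitivity (ln x * (logD h x * (p * ln x + r) + h x * p + s)
                  - ln x * logD h x * (p * ln x + r) + n * h x * (p * ln x + r)
                  - n * (h x * (p * ln x + r) + s * ln x)); [ ring | ].
    rewrite K', Hx', (Hh x Hx). ring. }
  assert (E3 : h x0 * p + (1 - n) * s = 0).
  { specialize (E2 x0 Hx0). apply Rmult_integral in E2. tauto. }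
  assert (Hp : p = 0).
  { specialize (D x0 Hx0). specialize (P x0 Hx0).
    assert (K : / x0 * (h x0 * p + (1 - n) * s) + ln x0 * (logD h x0 / x0 * p) = 0).
    { apply (derive_vanishing B _ x0 _ HB E2 Hx0).
      auto_derive; [ repeat split; [ exact P | eexists; exact D ] | ].
      rewrite_derive D. field. lra. }
    rewrite E3 in K.
    assert (K' : n * h x0 * p = 0).
    { rewrite <- (Hh x0 Hx0).
      transitivity (x0 * (/ x0 * 0 + ln x0 * (logD h x0 / x0 * p))); [ field; lra | ].
      rewrite K. ring. }
    apply Rmult_integral in K'. destruct K' as [K'|K']; [ | exact K' ].
    apply Rmult_integral in K'. tauto. }
  subst p. assert (Hs : s = 0).
  { assert (K : (1 - n) * s = 0) by lra. apply Rmult_integral in K. destruct K; lra. }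
  subst s. split; [ reflexivity | split; [ | reflexivity ] ].
  specialize (H x0 Hx0). assert (K : h x0 * r = 0) by lra.
  apply Rmult_integral in K. tauto.
Qed.

(** Here Y zeta = 0, so S = 0 is admissible and splitting gives al_t = - c/2 and al_y = 0. This is
    shared by ln^n x and ln ln x, whose scaling operators differ only in psi. *)
Lemma scaling_solution B f X : domain B -> smooth B (fun _ x _ _ => f x) ->
  (exists x1 x2, bx B x1 /\ bx B x2 /\ f x1 <> f x2) -> point_symmetry B f X ->
  eq_on B (zeta_of X) (fun t x y u => pd Vt (xi0 X) t x y u / 2 * ln x) ->
  eq_on B (pd Vt (pd Vt (xi0 X))) zero4 ->
  exists c a k, eq_on B (pd Vt (xi0 X)) (fun _ _ _ _ => c) /\
    eq_on B (xi0 X) (fun t _ _ _ => c * t + a) /\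
    eq_on B (xi1 X) (fun _ x _ _ => c * (/ 2 * x * ln x)) /\
    eq_on B (pd Vu (eta X)) (fun t x _ _ => c * (/ 4 * (ln x - t)) + k).
Proof.
  intros HB Sf Hnc PS HZ Ttt. assert (PS' := PS).
  destruct PS' as [HR Ty Tu Pu Zu Au X1]. destruct HR as [St Sp Sz SA Tx Px _ _ _ _].
  destruct (constant_of_pd B (pd Vt (xi0 X)) HB (smooth_pd _ _ _ St)) as [c Hc].
  { intros []; vanishing_pd. }
  assert (Hc' : eq_on B (pd Vt (xi0 X)) (fun _ _ _ _ => c)) by exact Hc.
  integrate B HB (xi0 X) (fun t _ _ _ : R => c * t) as a Ha.
  assert (HZ' : eq_on B (zeta_of X) (fun t x y u => c / 2 * ln x)).
  { intros t x y u Hp. rewrite (HZ _ _ _ _ Hp), (Hc _ _ _ _ Hp). reflexivity. }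
  clear HZ.
  assert (Zt : eq_on B (pd Vt (zeta_of X)) zero4).
  { intros t x y u Hp. assert (P := in_box_x_pos HB Hp).
    rewrite (pd_ext _ HB HZ' _ _ _ _ Hp). pd_compute B. ring. }
  assert (Zy : eq_on B (pd Vy (zeta_of X)) zero4).
  { intros t x y u Hp. assert (P := in_box_x_pos HB Hp).
    rewrite (pd_ext _ HB HZ' _ _ _ _ Hp). pd_compute B. ring. }
  destruct (gauge_solution B f X zero4 HB Sf PS) as (al & Sal & Ax & Alu & EA & Eal).
  { now apply smooth_const. }
  { intros t x y u Hp. apply pd_const. }
  { intros t x y u Hp. rewrite pd_const. reduce_on Hp. ring. }
  assert (Alt : eq_on B (fun t x y u => pd Vt al t x y u + c / 2) zero4 /\ eq_on B (pd Vy al) zero4).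
  { apply eq_on_and2. intros t x y u Hp. apply (two_values B f _ _ Hnc). intros x' Hx'.
    assert (Hq := in_box_x Hp Hx').
    assert (K := Eal t x x' y u Hp Hx'). rewrite !pd_const in K. revert K.
    reduce_on Hp. reduce_on Hq. intros K. lra. }
  destruct Alt as [Alt0 Al2].
  assert (Al1 : eq_on B (pd Vt al) (fun _ _ _ _ => - (c / 2))).
  { intros t x y u Hp. assert (K := Alt0 _ _ _ _ Hp). cbv beta in K. lra. }
  integrate B HB al (fun t _ _ _ : R => - (c / 2) * t) as k Hk.
  exists c, a, ((k + c / 2) / 2). repeat split; auto; intros t x y u Hp.
  - reduce_on Hp. field.
  - assert (KA := EA _ _ _ _ Hp). revert KA. reduce_on Hp. lra.
Qed.

Lemma scaling_independence B p L : domain B ->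
  forall a b k (c : list R), length c = 1%nat ->
  (forall t x y u, in_box B t x y u ->
     let V := lincomb (a :: b :: k :: c) (op_t :: op_y :: op_u ::
        [VF (fun t x y u => t) (fun t x y u => / 2 * x * ln x) p L]) in
     xi0 V t x y u = 0 /\ xi2 V t x y u = 0) ->
  a = 0 /\ b = 0 /\ List.Forall (fun s => s = 0) c.
Proof.
  intros HB a b k [|c [|]]; try discriminate. intros _ H.
  destruct (domain_point B HB) as (t0 & x & y & u & Ht0 & Hx & Hy & Hu).
  assert (Z : List.Forall (fun s => s = 0) [a; c]).
  { apply (poly_zero (bt B) _ (proj1 HB)). intros t Ht.
    destruct (H t x y u) as [K _]; [ repeat split; assumption | ].
    lincomb_simpl. simpl. lra. }
  assert (Za := Forall_inv Z). assert (Zc := Forall_inv (Forall_inv_tail Z)).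
  cbv beta in Za, Zc. subst a c.
  destruct (H t0 x y u) as [_ K]; [ repeat split; assumption | ].
  lincomb_simpl. repeat split; [ lra | ]. repeat constructor.
Qed.

Lemma finite_part_power B h n x0 : domain B -> smooth B (fun _ x _ _ => h x) ->
  (forall x, bx B x -> ln x * logD h x = n * h x) ->
  bx B x0 -> ln x0 <> 0 -> h x0 <> 0 -> n <> -2 -> n <> 0 -> n <> 1 ->
  finite_part_basis B h
   [ op_t; op_y; op_u;
        VF (fun t x y u => t) (fun t x y u => / 2 * x * ln x)
           (fun t x y u => (n + 2) / 2 * y)
           (fun t x y u => / 4 * (ln x - t) * u) ].
Proof.
  intros HB Sh Hh Hx0 Nl Nh N2 N0 N1.
  assert (Hnc : exists x1 x2, bx B x1 /\ bx B x2 /\ h x1 <> h x2).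
  { apply nonconstant_of_logD with x0; auto. intros Z.
    specialize (Hh x0 Hx0). rewrite Z in Hh. apply Nh.
    apply Rmult_eq_reg_l with n; lra. }
  apply basis_criterion; auto.
  - repeat apply Forall_cons; [ | constructor ].
    check_operator B HB (fun t _ _ _ : R => t) (fun _ x _ _ : R => / 2 * ln x)
      (fun t _ y _ : R => (n + 2) / 2 * y) (fun t x y _ : R => / 4 * (ln x - t))
      (fun t x _ _ : R => / 4 * / x).
    assert (L := Hh _ (proj1 (proj2 Hp))). repeat split; try ring; try (field; auto).
    transitivity (/ 2 * (ln x * logD h x)); [ ring | rewrite L; field ].
  - now apply scaling_independence.
  - intros X HX. assert (PS := lie_point_symmetry B h X HB Sh Hnc HX).
    assert (Rel : eq_on B (zeta_of X) (fun t x y u => pd Vt (xi0 X) t x y u / 2 * ln x) /\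
       eq_on B (pd Vy (xi2 X)) (fun t x y u => (n + 2) / 2 * pd Vt (xi0 X) t x y u) /\
       eq_on B (pd Vt (xi2 X)) zero4).
    { apply eq_on_and3. intros t x y u Hp.
      destruct (symmetry_relation B h X t x y u HB Sh PS Hp) as (k & Hk & K).
      destruct (log_power_independent B h n x0
        ((n + 2) / 2 * pd Vt (xi0 X) t x y u - pd Vy (xi2 X) t x y u) (n * k)
        (pd Vt (xi2 X) t x y u) HB Sh Hh Hx0 Nl Nh N0 N1) as (E1 & E2 & E3).
      - intros s Hs. specialize (K s Hs). specialize (Hh s Hs).
        transitivity (ln s * (logD h s * (pd Vt (xi0 X) t x y u / 2 * ln s + k))
          - (ln s * logD h s) * (pd Vt (xi0 X) t x y u / 2 * ln s + k)
          + h s * (((n + 2) / 2 * pd Vt (xi0 X) t x y u - pd Vy (xi2 X) t x y u) * ln s + n * k)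
          + pd Vt (xi2 X) t x y u * ln s); [ ring | ].
        rewrite K, Hh. field.
      - assert (Ek : k = 0) by (apply Rmult_eq_reg_l with n; lra). subst k.
        rewrite (Hk x (proj1 (proj2 Hp))). repeat split; lra. }
    assert (PS' := PS). destruct PS' as [HR Ty Tu Pu Zu Au X1].
    destruct HR as [St Sp Sz SA Tx Px _ _ _ _].
    destruct Rel as (EZ & Ey & Et).
    destruct (scaling_solution B h X HB Sh Hnc PS) as (c & a & k & E0 & E1 & E2 & E3).
    { exact EZ. }
    { intros t x y u Hp. assert (K := schwarz Vt Vy HB Sp _ _ _ _ Hp). revert K.
      rewrite (pd_ext Vt HB Ey _ _ _ _ Hp), (pd_zero B Vt Vy _ HB Et _ _ _ _ Hp).
      pd_compute B. intros K. apply Rmult_eq_reg_l with ((n + 2) / 2); lra. }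
    integrate B HB (xi2 X) (fun _ _ y _ : R => (n + 2) / 2 * c * y) as b Hb.
    exists a, b, k, [c]. split; [ reflexivity | ]. intros t x y u Hp. lincomb_simpl.
    reduce_on Hp. repeat split; field.
Qed.

Lemma finite_part_ln_ln B : domain B -> (forall x, bx B x -> 0 < ln x) ->
  finite_part_basis B (fun x => ln (ln x))
   [ op_t; op_y; op_u;
        VF (fun t x y u => t) (fun t x y u => / 2 * x * ln x)
           (fun t x y u => y - / 2 * t)
           (fun t x y u => / 4 * (ln x - t) * u) ].
Proof.
  intros HB Pl. set (h := fun x => ln (ln x)).
  assert (Px0 : forall x, bx B x -> 0 < x) by apply HB.
  assert (Sl := smooth_ln_x B HB).
  assert (Sh : smooth B (fun _ x _ _ => h x)).
  { apply (smooth_ln B (fun _ x _ _ => ln x)); auto. intros t x y u Hp. apply Pl, Hp. }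
  assert (Hh : forall x, bx B x -> logD h x = / ln x).
  { intros x Hx. apply logD_ln_ln; auto. }
  assert (Hnc : exists x1 x2, bx B x1 /\ bx B x2 /\ h x1 <> h x2).
  { destruct (domain_point B HB) as (_ & x0 & _ & _ & _ & Hx0 & _).
    apply nonconstant_of_logD with x0; auto. rewrite (Hh x0 Hx0).
    apply Rinv_neq_0_compat. specialize (Pl x0 Hx0). lra. }
  apply basis_criterion; auto.
  - repeat apply Forall_cons; [ | constructor ].
    check_operator B HB (fun t _ _ _ : R => t) (fun _ x _ _ : R => / 2 * ln x)
      (fun t _ y _ : R => y - / 2 * t) (fun t x y _ : R => / 4 * (ln x - t))
      (fun t x _ _ : R => / 4 * / x).
    assert (L := Pl _ (proj1 (proj2 Hp))). rewrite (Hh _ (proj1 (proj2 Hp))).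
    unfold h. repeat split; try ring; field; auto; lra.
  - now apply scaling_independence.
  - intros X HX. assert (PS := lie_point_symmetry B h X HB Sh Hnc HX).
    assert (Rel : eq_on B (zeta_of X) (fun t x y u => pd Vt (xi0 X) t x y u / 2 * ln x) /\
       eq_on B (pd Vy (xi2 X)) (pd Vt (xi0 X)) /\
       eq_on B (pd Vt (xi2 X)) (fun t x y u => - / 2 * pd Vt (xi0 X) t x y u)).
    { apply eq_on_and3. intros t x y u Hp.
      destruct (symmetry_relation B h X t x y u HB Sh PS Hp) as (k & Hk & K).
      set (c := pd Vt (xi0 X) t x y u) in *. set (py := pd Vy (xi2 X) t x y u) in *.
      set (pt := pd Vt (xi2 X) t x y u) in *.
      assert (F : forall s, bx B s -> (c / 2 + pt) * ln s + k + h s * (c - py) * ln s = 0).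
      { intros s Hs. specialize (K s Hs). rewrite (Hh s Hs) in K. specialize (Pl s Hs).
        transitivity (ln s * (/ ln s * (c / 2 * ln s + k) - (- h s * (c - py) - pt)));
          [ field; lra | rewrite K; ring ]. }
      (* With z = ln s, applying z d/dz - 1 to [F] kills z and turns z ln z into z, which leaves a
         polynomial in z. *)
      assert (Z : List.Forall (fun s => s = 0) [- k; c - py]).
      { apply (log_poly_zero B _ HB). intros s Hs. assert (Fs := F s Hs).
        assert (D := smooth_of_x_derive B h s HB Sh Hs). rewrite (Hh s Hs) in D.
        specialize (Px0 s Hs). specialize (Pl s Hs).
        assert (K1 : (c / 2 + pt) / s + h s * (c - py) / s + (/ ln s / s) * (c - py) * ln s = 0).
        { apply (derive_vanishing B _ s _ HB F Hs).
          auto_derive; [ repeat split; [ exact Px0 | eexists; exact D | exact Px0 ] | ].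
          rewrite_derive D. field. lra. }
        assert (K2 : (c / 2 + pt) + h s * (c - py) + (c - py) = 0).
        { transitivity (s * ((c / 2 + pt) / s + h s * (c - py) / s
                        + (/ ln s / s) * (c - py) * ln s)); [ field; lra | rewrite K1; ring ]. }
        simpl. transitivity (ln s * ((c / 2 + pt) + h s * (c - py) + (c - py))
          - ((c / 2 + pt) * ln s + k + h s * (c - py) * ln s)); [ ring | ].
        rewrite K2, Fs. ring. }
      assert (Z1 := Forall_inv Z). assert (Z2 := Forall_inv (Forall_inv_tail Z)).
      cbv beta in Z1, Z2. assert (Ek : k = 0) by lra. subst k.
      rewrite (Hk x (proj1 (proj2 Hp))).
      assert (Hx : bx B x) by apply Hp. specialize (F x Hx). specialize (Pl x Hx).
      rewrite Z2 in F. assert (F' : (c / 2 + pt) * ln x = 0) by lra.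
      apply Rmult_integral in F'. repeat split; destruct F'; lra. }
    assert (PS' := PS). destruct PS' as [HR Ty Tu Pu Zu Au X1].
    destruct HR as [St Sp Sz SA Tx Px _ _ _ _].
    destruct Rel as (EZ & Ey & Et).
    destruct (scaling_solution B h X HB Sh Hnc PS) as (c & a & k & E0 & E1 & E2 & E3).
    { exact EZ. }
    (* tau_tt = psi_yt = psi_ty = - tau_ty / 2 = 0. *)
    { intros t x y u Hp. rewrite <- (pd_ext Vt HB Ey _ _ _ _ Hp).
      rewrite (schwarz Vt Vy HB Sp _ _ _ _ Hp), (pd_ext Vy HB Et _ _ _ _ Hp).
      pd_compute B. reduce_on Hp. ring. }
    integrate B HB (xi2 X) (fun t _ y _ : R => c * (y - / 2 * t)) as b Hb.
    exists a, b, k, [c]. split; [ reflexivity | ]. intros t x y u Hp. lincomb_simpl.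
    reduce_on Hp. repeat split; field.
Qed.

(** * The coefficient x *)

Lemma finite_part_x B : domain B ->
  finite_part_basis B (fun x => x)
   [ op_t; op_y; op_u;
        VF (fun t x y u => 0) (fun t x y u => x) (fun t x y u => y)
           (fun t x y u => 0);
        VF (fun t x y u => 0) (fun t x y u => x * y) (fun t x y u => / 2 * y ^ 2)
           (fun t x y u => / 2 * x * u) ].
Proof.
  intros HB. assert (Sf := smooth_x B HB).
  assert (Px0 : forall x, bx B x -> 0 < x) by apply HB.
  assert (Ix : open_interval (bx B)) by apply HB.
  assert (Hnc : exists x1 x2, bx B x1 /\ bx B x2 /\ x1 <> x2) by now apply interval_two_points.
  apply basis_criterion; auto.
  - repeat apply Forall_cons; [ | | constructor ].
    + check_operator B HB zero4 (fun _ _ _ _ : R => 1) (fun _ _ y _ : R => y)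
        zero4 zero4.
      rewrite logD_x. repeat split; try ring; field; assumption.
    + check_operator B HB zero4 (fun _ _ y _ : R => y)
        (fun _ _ y _ : R => / 2 * y ^ 2) (fun _ x _ _ : R => / 2 * x) (fun _ _ _ _ : R => / 2).
      rewrite logD_x. repeat split; try ring; field; assumption.
  - intros a b k [|c4 [|c5 [|]]]; try discriminate. intros _ H.
    destruct (domain_point B HB) as (t & x & y0 & u & Ht & Hx & Hy0 & Hu).
    assert (Z : List.Forall (fun s => s = 0) [b; c4; / 2 * c5]).
    { apply (poly_zero (by_ B) _ (proj1 (proj2 (proj2 HB)))). intros y Hy.
      destruct (H t x y u) as [_ K]; [ repeat split; assumption | ].
      lincomb_simpl. simpl. lra. }
    destruct (H t x y0 u) as [K _]; [ repeat split; assumption | ]. lincomb_simpl.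
    coefficients Z.
    repeat split; try lra. repeat constructor; lra.
  - intros X HX. assert (PS := lie_point_symmetry B (fun x => x) X HB Sf Hnc HX).
    assert (PS' := PS). destruct PS' as [HR Ty Tu Pu Zu Au X1].
    destruct HR as [St Sp Sz SA Tx Px _ _ _ _].
    assert (Rel : eq_on B (pd Vt (xi0 X)) zero4 /\ eq_on B (pd Vt (xi2 X)) zero4 /\
       eq_on B (zeta_of X) (pd Vy (xi2 X))).
    { apply eq_on_and3. intros t x y u Hp.
      destruct (symmetry_relation B (fun x => x) X t x y u HB Sf PS Hp) as (k & Hk & K).
      set (c := pd Vt (xi0 X) t x y u) in *. set (py := pd Vy (xi2 X) t x y u) in *.
      set (pt := pd Vt (xi2 X) t x y u) in *.
      assert (F : forall s, bx B s -> c / 2 * ln s + k + (c - py) + pt / s = 0).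
      { intros s Hs. specialize (K s Hs). rewrite logD_x in K. specialize (Px0 s Hs).
        transitivity ((s * (c / 2 * ln s + k) - (- s * (c - py) - pt)) / s);
          [ field; lra | rewrite K; field; lra ]. }
      (* One differentiation of [F] removes the constant terms and turns the logarithm into 1/s;
         multiplication by s^2 makes the result polynomial. *)
      assert (Z : List.Forall (fun s => s = 0) [- pt; c / 2]).
      { apply (poly_zero (bx B) _ Ix). intros s Hs. specialize (Px0 s Hs).
        assert (E : c / 2 / s - pt / s ^ 2 = 0).
        { apply (derive_vanishing B _ s _ HB F Hs).
          auto_derive; [ repeat split; auto; lra | field; lra ]. }
        simpl. transitivity (s ^ 2 * (c / 2 / s - pt / s ^ 2)); [ field; lra | ].
        rewrite E. ring. }
      coefficients Z. assert (E1 : c = 0) by lra. assert (E2 : pt = 0) by lra.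
      assert (Hx : bx B x) by apply Hp. specialize (F x Hx). rewrite (Hk x Hx).
      rewrite E1, E2 in *. repeat split. unfold Rdiv in F |- *. lra. }
    destruct Rel as (Et & Ept & EZ).
    set (psi := xi2 X) in *.
    assert (Zt : eq_on B (pd Vt (zeta_of X)) zero4).
    { intros t x y u Hp. rewrite (pd_ext Vt HB EZ _ _ _ _ Hp). now apply pd_zero_comm with B. }
    assert (Zy : eq_on B (pd Vy (zeta_of X)) (pd Vy (pd Vy psi))) by now apply pd_ext.
    assert (P2x : eq_on B (pd Vx (pd Vy (pd Vy psi))) zero4) by vanishing_pd.
    (* Y zeta = - x psi_yy is its own primitive, because D x = x. *)
    set (S := fun t x y u : R => - (x * pd Vy (pd Vy psi) t x y u)).
    destruct (gauge_solution B (fun x => x) X S HB Sf PS) as (al & Sal & Ax & Alu & EA & Eal).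
    { unfold S; smooth_rec. }
    { intros t x y u Hp. unfold S. pd_compute B. reduce_on Hp. ring. }
    { intros t x y u Hp. unfold S.
      pd_compute B. reduce_on Hp. ring. }
    assert (Rel2 : eq_on B (pd Vt al) zero4 /\
       eq_on B (pd Vy al) (fun t x y u => - pd Vy (pd Vy psi) t x y u) /\
       eq_on B (pd Vy (pd Vy (pd Vy psi))) zero4).
    { apply eq_on_and3. intros t x y u Hp.
      assert (Z : List.Forall (fun s => s = 0)
        [ pd Vt al t x y u; - pd Vy al t x y u - pd Vy (pd Vy psi) t x y u;
          - pd Vy (pd Vy (pd Vy psi)) t x y u ]).
      { apply (poly_zero (bx B) _ Ix). intros s Hs.
        assert (Hq := in_box_x Hp Hs).
        assert (K := Eal t x s y u Hp Hs).
        rewrite logD_x in K. revert K. unfold S. pd_compute B. reduce_on Hp. reduce_on Hq.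
        shift_x Hp Hs.
        simpl. lra. }
      coefficients Z. repeat split; lra. }
    destruct Rel2 as (Al1 & Al2 & P3y).
    integrate B HB (xi0 X) zero4 as c1 H1.
    integrate B HB (pd Vy (pd Vy psi)) zero4 as c5 H5.
    integrate B HB (pd Vy psi) (fun _ _ y _ : R => c5 * y) as c4 H4.
    integrate B HB psi (fun _ _ y _ : R => c5 * (/ 2 * y ^ 2) + c4 * y) as c2 H2.
    integrate B HB al (fun _ _ y _ : R => - (c5 * y)) as k Hk.
    (* In 2 eta_u = al + zeta - S the terms c5 y of al and zeta cancel, leaving k + c4 + c5 x. *)
    exists c1, c2, ((k + c4) / 2), [c4; c5]. split; [ reflexivity | ].
    intros t x y u Hp. assert (KA := EA _ _ _ _ Hp). revert KA. unfold S. lincomb_simpl.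
    fold psi. reduce_on Hp. intros KA. repeat split; try ring.
    replace (pd Vu (eta X) t x y u) with (2 * pd Vu (eta X) t x y u / 2) by field.
    rewrite KA. field.
Qed.

(** * The coefficient ln^-2 x *)

Lemma finite_part_ln_m2 B : domain B -> (forall x, bx B x -> ln x <> 0) ->
  finite_part_basis B (fun x => / (ln x) ^ 2)
   [ op_t; op_y; op_u;
        VF (fun t x y u => t) (fun t x y u => / 2 * x * ln x) (fun t x y u => 0)
           (fun t x y u => / 4 * (ln x - t) * u);
        VF (fun t x y u => t ^ 2) (fun t x y u => t * x * ln x) (fun t x y u => 0)
           (fun t x y u =>
              - (/ 4 * ((ln x) ^ 2 - 2 * t * ln x + t ^ 2 + 2 * t)) * u) ].
Proof.
  intros HB Nl. set (h := fun x => / (ln x) ^ 2).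
  assert (Px0 : forall x, bx B x -> 0 < x) by apply HB.
  assert (Nl2 : forall t x y u, in_box B t x y u -> ln x ^ 2 <> 0).
  { intros t x y u Hp. apply pow_nonzero, Nl, Hp. }
  assert (Sh : smooth B (fun _ x _ _ => h x)) by (unfold h; smooth_rec).
  assert (Hh : forall x, bx B x -> logD h x = - 2 * / (ln x) ^ 3).
  { intros x Hx. apply logD_ln_m2; auto. }
  assert (Hnc : exists x1 x2, bx B x1 /\ bx B x2 /\ h x1 <> h x2).
  { destruct (domain_point B HB) as (_ & x0 & _ & _ & _ & Hx0 & _).
    apply nonconstant_of_logD with x0; auto. rewrite (Hh x0 Hx0).
    apply Rmult_integral_contrapositive_currified; [ lra | ].
    apply Rinv_neq_0_compat, pow_nonzero, Nl, Hx0. }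
  apply basis_criterion; auto.
  - repeat apply Forall_cons; [ | | constructor ].
    + check_operator B HB (fun t _ _ _ : R => t) (fun _ x _ _ : R => / 2 * ln x)
        zero4 (fun t x y _ : R => / 4 * (ln x - t)) (fun t x _ _ : R => / 4 * / x).
      assert (Hx : bx B x) by apply Hp. assert (N := Nl _ Hx).
      rewrite Hh by assumption. unfold h. repeat split; try ring; field; auto.
    + check_operator B HB (fun t _ _ _ : R => t ^ 2) (fun t x _ _ : R => t * ln x)
        zero4 (fun t x y _ : R => - (/ 4 * ((ln x) ^ 2 - 2 * t * ln x + t ^ 2 + 2 * t)))
        (fun t x _ _ : R => - (/ 4 * (2 * ln x * / x - 2 * t * / x))).
      assert (Hx : bx B x) by apply Hp. assert (N := Nl _ Hx).
      rewrite Hh by assumption. unfold h. repeat split; try ring; field; auto.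
  - intros a b k [|c4 [|c5 [|]]]; try discriminate. intros _ H.
    destruct (domain_point B HB) as (t0 & x & y & u & Ht0 & Hx & Hy & Hu).
    assert (Z : List.Forall (fun s => s = 0) [a; c4; c5]).
    { apply (poly_zero (bt B) _ (proj1 HB)). intros t Ht.
      destruct (H t x y u) as [K _]; [ repeat split; assumption | ].
      lincomb_simpl. simpl. lra. }
    destruct (H t0 x y u) as [_ K]; [ repeat split; assumption | ]. lincomb_simpl.
    assert (Z1 := Forall_inv Z). split; [ exact Z1 | split; [ lra | exact (Forall_inv_tail Z) ] ].
  - intros X HX. assert (PS := lie_point_symmetry B h X HB Sh Hnc HX).
    assert (PS' := PS). destruct PS' as [HR Ty Tu Pu Zu Au X1].
    destruct HR as [St Sp Sz SA Tx Px _ _ _ _].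
    assert (Rel : eq_on B (zeta_of X) (fun t x y u => pd Vt (xi0 X) t x y u / 2 * ln x) /\
       eq_on B (pd Vy (xi2 X)) zero4 /\ eq_on B (pd Vt (xi2 X)) zero4).
    { apply eq_on_and3. intros t x y u Hp.
      destruct (symmetry_relation B h X t x y u HB Sh PS Hp) as (k & Hk & K).
      (* The relation times (ln s)^3. The terms with tau_t cancel for this exponent, so tau_t stays
         unrestricted at this stage. *)
      assert (Z : List.Forall (fun s => s = 0)
        [- 2 * k; - pd Vy (xi2 X) t x y u; 0; pd Vt (xi2 X) t x y u]).
      { apply (log_poly_zero B _ HB). intros s Hs. specialize (K s Hs).
        rewrite (Hh s Hs) in K. specialize (Nl s Hs).
        simpl. transitivity (ln s ^ 3 * (-2 * / ln s ^ 3 * (pd Vt (xi0 X) t x y u / 2 * ln s + k)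
          - (- h s * (pd Vt (xi0 X) t x y u - pd Vy (xi2 X) t x y u) - pd Vt (xi2 X) t x y u)));
          [ unfold h; field; exact Nl | rewrite K; ring ]. }
      coefficients Z.
      assert (Ek : k = 0) by lra. rewrite (Hk x (proj1 (proj2 Hp))), Ek. repeat split; lra. }
    destruct Rel as (EZ & Epy & Ept).
    set (tau := xi0 X) in *.
    assert (St1 : smooth B (pd Vt tau)) by smooth_rec.
    assert (St2 : smooth B (pd Vt (pd Vt tau))) by smooth_rec.
    assert (T2x : eq_on B (pd Vx (pd Vt (pd Vt tau))) zero4) by vanishing_pd.
    assert (Zt : eq_on B (pd Vt (zeta_of X)) (fun t x y u => pd Vt (pd Vt tau) t x y u / 2 * ln x)).
    { intros t x y u Hp. assert (P := in_box_x_pos HB Hp).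
      rewrite (pd_ext Vt HB EZ _ _ _ _ Hp). pd_compute B. field. }
    assert (Zy : eq_on B (pd Vy (zeta_of X)) zero4).
    { intros t x y u Hp. assert (P := in_box_x_pos HB Hp).
      rewrite (pd_ext Vy HB EZ _ _ _ _ Hp). pd_compute B.
      reduce_on Hp. field. }
    (* As zeta_y = 0, Y zeta = zeta_t = tau_tt ln x / 2. *)
    set (S := fun t x y u : R => pd Vt (pd Vt tau) t x y u * (/ 4 * ln x ^ 2)).
    destruct (gauge_solution B h X S HB Sh PS) as (al & Sal & Ax & Alu & EA & Eal).
    { unfold S; smooth_rec. }
    { intros t x y u Hp. assert (P := in_box_x_pos HB Hp).
      unfold S. pd_compute B. reduce_on Hp. ring. }
    { intros t x y u Hp. assert (P := in_box_x_pos HB Hp).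
      unfold S. pd_compute B. reduce_on Hp. simpl INR. simpl Nat.pred. field. lra. }
    assert (Rel2 : eq_on B (pd Vt al)
         (fun t x y u => - pd Vt (pd Vt tau) t x y u - pd Vt tau t x y u / 2) /\
       eq_on B (pd Vy al) zero4 /\ eq_on B (pd Vt (pd Vt (pd Vt tau))) zero4).
    { apply eq_on_and3. intros t x y u Hp.
      (* The relation times (ln s)^2, of degree four in ln s. Its top coefficient makes tau
         quadratic in t. *)
      assert (Z : List.Forall (fun s => s = 0)
        [ - pd Vy al t x y u; 0;
          pd Vt al t x y u + pd Vt (pd Vt tau) t x y u + pd Vt tau t x y u / 2; 0;
          - (/ 4 * pd Vt (pd Vt (pd Vt tau)) t x y u) ]).
      { apply (log_poly_zero B _ HB). intros s Hs.
        assert (Hq := in_box_x Hp Hs).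
        assert (P := Px0 s Hs). assert (N := Nl s Hs).
        assert (K := Eal t x s y u Hp Hs).
        revert K. unfold S. pd_compute B. reduce_on Hq.
        shift_x Hp Hs. fold tau.
        simpl Nat.pred. simpl INR. intros K.
        simpl. transitivity (ln s ^ 2 * ((pd Vt al t x y u - h s * pd Vy al t x y u)
          + pd Vt (pd Vt tau) t x y u + pd Vt tau t x y u / 2
          - pd Vt (pd Vt (pd Vt tau)) t x y u * (/ 4 * ln s ^ 2)));
          [ unfold h; field; exact N | rewrite K; ring ]. }
      coefficients Z. repeat split; lra. }
    destruct Rel2 as (Al1 & Al2 & T3).
    integrate B HB (xi2 X) zero4 as c2 H2.
    integrate B HB (pd Vt (pd Vt tau)) zero4 as e He.
    integrate B HB (pd Vt tau) (fun t _ _ _ : R => e * t) as c4 H4.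
    integrate B HB tau (fun t _ _ _ : R => e / 2 * t ^ 2 + c4 * t) as c1 H1.
    integrate B HB al (fun t _ _ _ : R => - (e * t + c4 / 2 * t + e / 4 * t ^ 2)) as k Hk.
    exists c1, c2, ((k + c4 / 2) / 2), [c4; e / 2]. split; [ reflexivity | ].
    intros t x y u Hp. assert (KA := EA _ _ _ _ Hp). revert KA. unfold S. lincomb_simpl.
    fold tau. reduce_on Hp. intros KA. repeat split; try field.
    replace (pd Vu (eta X) t x y u) with (2 * pd Vu (eta X) t x y u / 2) by field.
    rewrite KA. field.
Qed.

(** * The coefficient ln x *)

Lemma finite_part_ln B : domain B ->
  finite_part_basis B ln
   [ op_t; op_y; op_u;
        VF (fun t x y u => 0) (fun t x y u => x) (fun t x y u => - t)
           (fun t x y u => 0);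
        VF (fun t x y u => 0) (fun t x y u => t * x)
           (fun t x y u => - (/ 2 * t ^ 2))
           (fun t x y u => / 2 * (t - ln x) * u);
        VF (fun t x y u => 0) (fun t x y u => t ^ 2 * x)
           (fun t x y u => - (/ 3 * t ^ 3))
           (fun t x y u => - (t * ln x + y - / 2 * t ^ 2) * u);
        VF (fun t x y u => t) (fun t x y u => / 2 * x * ln x)
           (fun t x y u => 3 / 2 * y)
           (fun t x y u => / 4 * (ln x - t) * u);
        VF (fun t x y u => t ^ 2) (fun t x y u => (t * ln x - 3 * y) * x)
           (fun t x y u => 3 * t * y)
           (fun t x y u =>
              - ((ln x) ^ 2 - / 2 * t * ln x + / 4 * t ^ 2 + 2 * t + 3 / 2 * y) * u) ].
Proof.
  intros HB. assert (Sf := smooth_ln_x B HB).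
  assert (Px0 : forall x, bx B x -> 0 < x) by apply HB.
  assert (Hnc : exists x1 x2, bx B x1 /\ bx B x2 /\ ln x1 <> ln x2).
  { destruct (domain_point B HB) as (_ & x0 & _ & _ & _ & Hx0 & _).
    apply nonconstant_of_logD with x0; auto. rewrite logD_ln by auto. lra. }
  apply basis_criterion; auto.
  - repeat apply Forall_cons; [ | | | | | constructor ].
    + check_operator B HB zero4 (fun _ _ _ _ : R => 1) (fun t _ _ _ : R => - t)
        zero4 zero4.
      rewrite logD_ln by assumption. repeat split; try ring; field; assumption.
    + check_operator B HB zero4 (fun t _ _ _ : R => t) (fun t _ _ _ : R => - (/ 2 * t ^ 2))
        (fun t x _ _ : R => / 2 * (t - ln x)) (fun _ x _ _ : R => - (/ 2 * / x)).
      rewrite logD_ln by assumption. repeat split; try ring; field; assumption.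
    + check_operator B HB zero4 (fun t _ _ _ : R => t ^ 2)
        (fun t _ _ _ : R => - (/ 3 * t ^ 3))
        (fun t x y _ : R => - (t * ln x + y - / 2 * t ^ 2)) (fun t x _ _ : R => - (t * / x)).
      rewrite logD_ln by assumption. repeat split; try ring; field; assumption.
    + check_operator B HB (fun t _ _ _ : R => t) (fun _ x _ _ : R => / 2 * ln x)
        (fun _ _ y _ : R => 3 / 2 * y) (fun t x y _ : R => / 4 * (ln x - t))
        (fun t x _ _ : R => / 4 * / x).
      rewrite logD_ln by assumption. repeat split; try ring; field; assumption.
    + check_operator B HB (fun t _ _ _ : R => t ^ 2) (fun t x y _ : R => t * ln x - 3 * y)
        (fun t _ y _ : R => 3 * t * y)
        (fun t x y _ : R => - ((ln x) ^ 2 - / 2 * t * ln x + / 4 * t ^ 2 + 2 * t + 3 / 2 * y))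
        (fun t x _ _ : R => - (2 * ln x * / x - / 2 * t * / x)).
      rewrite logD_ln by assumption. repeat split; try ring; field; assumption.
  - intros a b k [|c4 [|c5 [|c6 [|c7 [|c8 [|]]]]]]; try discriminate. intros _ H.
   
    destruct (domain_point B HB) as (t0 & x & y & u & Ht0 & Hx & Hy & Hu).
    (* xi0 is settled first; once c7 and c8 vanish, xi2 no longer involves y and is a polynomial in
       t. *)
    assert (Z : List.Forall (fun s => s = 0) [a; c7; c8]).
    { apply (poly_zero (bt B) _ (proj1 HB)). intros t Ht.
      destruct (H t x y u) as [K _]; [ repeat split; assumption | ].
      lincomb_simpl. simpl. lra. }
    coefficients Z. subst a c7 c8.
    assert (Z : List.Forall (fun s => s = 0) [b; - c4; - / 2 * c5; - / 3 * c6]).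
    { apply (poly_zero (bt B) _ (proj1 HB)). intros t Ht.
      destruct (H t x y u) as [_ K]; [ repeat split; assumption | ].
      lincomb_simpl. simpl. lra. }
    coefficients Z.
    split; [ reflexivity | split; [ lra | ] ].
    repeat apply Forall_cons; try apply Forall_nil; lra.
  - intros X HX. assert (PS := lie_point_symmetry B ln X HB Sf Hnc HX).
    assert (PS' := PS). destruct PS' as [HR Ty Tu Pu Zu Au X1].
    destruct HR as [St Sp Sz SA Tx Px _ _ _ _].
    set (tau := xi0 X) in *. set (psi := xi2 X) in *.
    assert (Rel : eq_on B (zeta_of X)
         (fun t x y u => pd Vt tau t x y u / 2 * ln x - pd Vt psi t x y u) /\
       eq_on B (pd Vy psi) (fun t x y u => 3 / 2 * pd Vt tau t x y u)).
    { apply eq_on_and2. intros t x y u Hp.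
      destruct (symmetry_relation B ln X t x y u HB Sf PS Hp) as (k & Hk & K).
      fold tau psi in Hk, K.
      assert (Z : List.Forall (fun s => s = 0)
        [k + pd Vt psi t x y u; 3 / 2 * pd Vt tau t x y u - pd Vy psi t x y u]).
      { apply (log_poly_zero B _ HB). intros s Hs. specialize (K s Hs).
        rewrite logD_ln in K by auto. simpl. lra. }
      coefficients Z. rewrite (Hk x (proj1 (proj2 Hp))). split; lra. }
    destruct Rel as (EZ & Epy).
    assert (St1 : smooth B (pd Vt tau)) by smooth_rec.
    assert (St2 : smooth B (pd Vt (pd Vt tau))) by smooth_rec.
    assert (Sp1 : smooth B (pd Vt psi)) by smooth_rec.
    assert (Sp2 : smooth B (pd Vt (pd Vt psi))) by smooth_rec.
    assert (T2x : eq_on B (pd Vx (pd Vt (pd Vt tau))) zero4) by vanishing_pd.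
    assert (P2x : eq_on B (pd Vx (pd Vt (pd Vt psi))) zero4) by vanishing_pd.
    assert (P1y : eq_on B (pd Vy (pd Vt psi)) (fun t x y u => 3 / 2 * pd Vt (pd Vt tau) t x y u)).
    { intros t x y u Hp. rewrite (schwarz Vy Vt HB Sp _ _ _ _ Hp).
      rewrite (pd_ext Vt HB Epy _ _ _ _ Hp). pd_compute B. field. }
    assert (P2y : eq_on B (pd Vy (pd Vt (pd Vt psi)))
              (fun t x y u => 3 / 2 * pd Vt (pd Vt (pd Vt tau)) t x y u)).
    { intros t x y u Hp. rewrite (schwarz Vy Vt HB Sp1 _ _ _ _ Hp).
      rewrite (pd_ext Vt HB P1y _ _ _ _ Hp). pd_compute B. field. }
    assert (Zt : eq_on B (pd Vt (zeta_of X))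
       (fun t x y u => pd Vt (pd Vt tau) t x y u / 2 * ln x - pd Vt (pd Vt psi) t x y u)).
    { intros t x y u Hp. assert (P := in_box_x_pos HB Hp).
      rewrite (pd_ext Vt HB EZ _ _ _ _ Hp). pd_compute B. field. }
    assert (Zy : eq_on B (pd Vy (zeta_of X)) (fun t x y u => - (3 / 2) * pd Vt (pd Vt tau) t x y u)).
    { intros t x y u Hp. assert (P := in_box_x_pos HB Hp).
      rewrite (pd_ext Vy HB EZ _ _ _ _ Hp). pd_compute B.
      reduce_on Hp. field. }
    (* Here zeta_y = - (3/2) tau_tt also contributes, and Y zeta = 2 tau_tt ln x - psi_tt. *)
    set (S := fun t x y u : R => pd Vt (pd Vt tau) t x y u * ln x ^ 2
                                 - pd Vt (pd Vt psi) t x y u * ln x).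
    destruct (gauge_solution B ln X S HB Sf PS) as (al & Sal & Ax & Alu & EA & Eal).
    { unfold S; smooth_rec. }
    { intros t x y u Hp. assert (P := in_box_x_pos HB Hp).
      unfold S. pd_compute B. reduce_on Hp. ring. }
    { intros t x y u Hp. assert (P := in_box_x_pos HB Hp).
      unfold S. pd_compute B. reduce_on Hp. simpl INR. simpl Nat.pred. field. lra. }
    assert (Rel2 : eq_on B (pd Vt al)
         (fun t x y u => - (5 / 2) * pd Vt (pd Vt tau) t x y u - pd Vt tau t x y u / 2) /\
       eq_on B (pd Vy al) (pd Vt (pd Vt (pd Vt psi))) /\
       eq_on B (pd Vt (pd Vt (pd Vt tau))) zero4).
    { apply eq_on_and3. intros t x y u Hp.
      assert (Z : List.Forall (fun s => s = 0)
        [ pd Vt al t x y u + 5 / 2 * pd Vt (pd Vt tau) t x y u + pd Vt tau t x y u / 2;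
          - pd Vy al t x y u + pd Vt (pd Vt (pd Vt psi)) t x y u;
          - (5 / 2 * pd Vt (pd Vt (pd Vt tau)) t x y u) ]).
      { apply (log_poly_zero B _ HB). intros s Hs.
        assert (Hq := in_box_x Hp Hs).
        assert (P := Px0 s Hs).
        assert (K := Eal t x s y u Hp Hs). rewrite logD_ln in K by auto.
        revert K. unfold S. pd_compute B. reduce_on Hq. shift_x Hp Hs. fold tau. simpl Nat.pred. simpl INR. intros K. simpl.
        transitivity ((pd Vt al t x y u - ln s * pd Vy al t x y u)
          + 5 / 2 * pd Vt (pd Vt tau) t x y u + pd Vt tau t x y u / 2
          + pd Vt (pd Vt (pd Vt psi)) t x y u * ln s
          - 5 / 2 * pd Vt (pd Vt (pd Vt tau)) t x y u * ln s ^ 2); [ ring | ].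
        rewrite K. field. }
      coefficients Z. repeat split; lra. }
    destruct Rel2 as (Al1 & Al2 & T3).
    (* psi_tttt = al_yt = al_ty, and al_t involves tau alone. So psi is cubic in t, which is the
       origin of the three operators without d_t. *)
    assert (P4t : eq_on B (pd Vt (pd Vt (pd Vt (pd Vt psi)))) zero4).
    { intros t x y u Hp. rewrite <- (pd_ext Vt HB Al2 _ _ _ _ Hp).
      rewrite (schwarz Vt Vy HB Sal _ _ _ _ Hp), (pd_ext Vy HB Al1 _ _ _ _ Hp).
      pd_compute B. reduce_on Hp. field. }
    assert (P3y : eq_on B (pd Vy (pd Vt (pd Vt (pd Vt psi)))) zero4).
    { intros t x y u Hp. rewrite (schwarz Vy Vt HB Sp2 _ _ _ _ Hp).
      rewrite (pd_ext Vt HB P2y _ _ _ _ Hp). pd_compute B. reduce_on Hp. field. }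
    integrate B HB (pd Vt (pd Vt tau)) zero4 as e He.
    integrate B HB (pd Vt tau) (fun t _ _ _ : R => e * t) as c7 H7.
    integrate B HB tau (fun t _ _ _ : R => e / 2 * t ^ 2 + c7 * t) as c1 H1.
    integrate B HB (pd Vt (pd Vt (pd Vt psi))) zero4 as d6 H6.
    integrate B HB (pd Vt (pd Vt psi)) (fun t _ _ _ : R => d6 * t) as d5 H5.
    integrate B HB (pd Vt psi) (fun t _ y _ : R => d6 / 2 * t ^ 2 + d5 * t + 3 / 2 * e * y) as d4 H4.
    integrate B HB psi (fun t _ y _ : R => d6 / 6 * t ^ 3 + d5 / 2 * t ^ 2 + 3 / 2 * e * t * y
      + d4 * t + 3 / 2 * c7 * y) as c2 H2.
    integrate B HB al (fun t _ y _ : R => d6 * y - 5 / 2 * e * t - e / 4 * t ^ 2 - c7 / 2 * t) as k Hk.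
    (* The terms d4 t, d5 t^2/2, d6 t^3/6 of psi are matched with the entries - t, - t^2/2, - t^3/3
       of the listed operators; e / 2 is the coefficient of t^2 in tau. *)
    exists c1, c2, ((k - d4 + c7 / 2) / 2), [- d4; - d5; - d6 / 2; c7; e / 2].
    split; [ reflexivity | ].
    intros t x y u Hp. assert (KA := EA _ _ _ _ Hp). revert KA. unfold S. lincomb_simpl.
    fold tau psi. reduce_on Hp. intros KA. repeat split; try field.
    replace (pd Vu (eta X) t x y u) with (2 * pd Vu (eta X) t x y u / 2) by field.
    rewrite KA. field.
Qed.

(** * Real powers of ln x *)

Lemma Int_part_IZR k : Int_part (IZR k) = k.
Proof. symmetry. apply Int_part_spec. lra. Qed.

Lemma is_derive_powerRZ a k : a <> 0 ->
  is_derive (fun s => powerRZ s k) a (IZR k * powerRZ a k / a).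
Proof.
  intros Ha. destruct k as [|p|p]; simpl powerRZ.
  - auto_derive; [ exact I | field; exact Ha ].
  - auto_derive; [ exact I | ].
    destruct (Pos2Nat.is_succ p) as [m Em].
    replace (IZR (Z.pos p)) with (INR (Pos.to_nat p)) by (rewrite INR_IZR_INZ; now rewrite positive_nat_Z).
    rewrite Em. simpl pred. rewrite <- tech_pow_Rmult. field. exact Ha.
  - auto_derive; [ now apply pow_nonzero | ].
    destruct (Pos2Nat.is_succ p) as [m Em].
    replace (IZR (Z.neg p)) with (- INR (Pos.to_nat p))
      by (rewrite INR_IZR_INZ, positive_nat_Z; reflexivity).
    rewrite Em. simpl pred. rewrite <- tech_pow_Rmult.
    assert (a ^ m <> 0) by now apply pow_nonzero. field. split; assumption.
Qed.

Lemma is_derive_rpow a n : a <> 0 -> rpow_dom a n ->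
  is_derive (fun s => rpow s n) a (n * rpow a n / a).
Proof.
  intros Ha Hd. destruct (Rlt_dec 0 a) as [P|N].
  - apply is_derive_ext_loc with (fun s => Rpower s n).
    + generalize (open_gt 0 a P). apply filter_imp. intros s Hs.
      unfold rpow. destruct (Rlt_dec 0 s); [ reflexivity | contradiction ].
    + unfold rpow. destruct (Rlt_dec 0 a); [ | contradiction ].
      unfold Rpower. auto_derive; [ exact P | field; exact Ha ].
  - destruct Hd as [P|(k & -> & _)]; [ contradiction | ].
    assert (La : a < 0) by lra.
    apply is_derive_ext_loc with (fun s => powerRZ s k).
    + generalize (open_lt 0 a La). apply filter_imp. intros s Hs.
      unfold rpow. rewrite Int_part_IZR. destruct (Rlt_dec 0 s); [ lra | reflexivity ].
    + unfold rpow. rewrite Int_part_IZR. destruct (Rlt_dec 0 a); [ lra | ].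
      now apply is_derive_powerRZ.
Qed.

Lemma rpow_neq_0 a n : a <> 0 -> rpow_dom a n -> rpow a n <> 0.
Proof.
  intros Ha Hd. unfold rpow. destruct (Rlt_dec 0 a).
  - apply Rgt_not_eq, exp_pos.
  - now apply powerRZ_NOR.
Qed.

(** For natural n the power is polynomial in ln x and smooth even where ln x = 0. For any other n,
    [rpow_dom] excludes ln x = 0, and the derivative (n/s) [rpow s n] is a smooth factor times the
    function itself, so smoothness follows by induction on the order. *)
Lemma rpow_ln_regular B n : domain B ->
  (forall x, bx B x -> 0 < x /\ rpow_dom (ln x) n) -> n <> 0 ->
  smooth B (fun _ x _ _ => rpow (ln x) n) /\
  forall x, bx B x -> ln x * logD (fun x => rpow (ln x) n) x = n * rpow (ln x) n.
Proof.
  intros HB HD Hn. assert (Sl := smooth_ln_x B HB).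
  assert (P : forall x, bx B x -> 0 < x) by apply HB.
  assert (DL : forall x, bx B x -> ln x <> 0 ->
     is_derive (fun x => rpow (ln x) n) x (n * rpow (ln x) n / ln x / x)).
  { intros x Hx Nl.
    assert (D := is_derive_comp (fun s => rpow s n) ln x _ _
       (is_derive_rpow (ln x) n Nl (proj2 (HD x Hx))) (is_derive_ln x (P x Hx))).
    replace (n * rpow (ln x) n / ln x / x) with (scal (/ x) (n * rpow (ln x) n / ln x));
      [ exact D | ].
    unfold scal; simpl; unfold mult; simpl. field. specialize (P x Hx). split; [ exact Nl | lra ]. }
  destruct (classic (exists N, n = INR N)) as [[N ->]|HN].
  - assert (E : eq_on B (fun _ x _ _ => ln x ^ N) (fun _ x _ _ => rpow (ln x) (INR N))).
    { intros t x y u _. now rewrite rpow_INR. }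
    split.
    + apply smooth_ext with (1 := HB) (2 := E). smooth_rec.
    + intros x Hx. specialize (P x Hx).
      assert (D : is_derive (fun x => rpow (ln x) (INR N)) x (INR N * ln x ^ pred N / x)).
      { apply is_derive_ext with (fun x => ln x ^ N); [ intros; now rewrite rpow_INR | ].
        auto_derive; [ exact P | field; lra ]. }
      unfold logD. rewrite rpow_INR.
      replace (Derive (fun x => rpow (ln x) (INR N)) x) with (INR N * ln x ^ pred N / x)
        by (symmetry; exact (is_derive_unique _ _ _ D)).
      destruct N as [|N]; [ now elim Hn | ]. simpl pred. rewrite <- tech_pow_Rmult. field. lra.
  - assert (Nl : forall x, bx B x -> ln x <> 0).
    { intros x Hx Z. destruct (HD x Hx) as [_ [H|(k & Hk & [H|H])]]; [ lra | contradiction | ].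
      apply HN. exists (Z.to_nat k). rewrite Hk, INR_IZR_INZ, Z2Nat.id; auto. }
    split.
    + apply smooth_differentiable. intros M.
      assert (Nl' : forall t x y u, in_box B t x y u -> ln x <> 0).
      { intros t x y u Hp. apply Nl, Hp. }
      assert (Si : smooth B (fun _ x _ _ => n * / ln x)) by smooth_rec.
      assert (Dr : forall t x y u, in_box B t x y u ->
                is_derive (fun s => rpow s n) (ln x) (n * / ln x * rpow (ln x) n)).
      { intros t x y u (_ & Hx & _).
        replace (n * / ln x * rpow (ln x) n) with (n * rpow (ln x) n / ln x)
          by (field; now apply Nl).
        apply is_derive_rpow; [ now apply Nl | apply HD, Hx ]. }
      induction M as [|M IH].
      * split; [ | exact I ].
        apply (basic_comp B (fun s => rpow s n) (fun _ x _ _ => ln x));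
          [ now apply smooth_basic | ].
        intros t x y u Hp. assert (E : ex_derive (fun s => rpow s n) (ln x)).
        { eexists. exact (Dr t x y u Hp). }
        split; [ now apply (ex_derive_continuous_R (fun s => rpow s n)) | exact E ].
      * apply (differentiable_comp_step M B (fun s => rpow s n)
          (fun s => n * / s * rpow s n) (fun _ x _ _ => ln x) HB Dr).
        -- now apply smooth_differentiable.
        -- apply (differentiable_mult M B (fun _ x _ _ => n * / ln x)
             (fun _ x _ _ => rpow (ln x) n)); [ exact HB | now apply smooth_differentiable | exact IH ].
    + intros x Hx. assert (D := DL x Hx (Nl x Hx)).
      transitivity (ln x * (x * (n * rpow (ln x) n / ln x / x))).
      * unfold logD. do 2 f_equal. exact (is_derive_unique _ _ _ D).
      * specialize (P x Hx). specialize (Nl x Hx). field. split; [ exact Nl | lra ].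
Qed.

Lemma interval_ln_neq_0 B : domain B -> exists x, bx B x /\ ln x <> 0.
Proof.
  intros HB. assert (P : forall x, bx B x -> 0 < x) by apply HB.
  destruct (interval_two_points (bx B)) as (a & b & Ha & Hb & N); [ apply HB | ].
  destruct (Req_dec (ln a) 0) as [Z|Z]; [ | now exists a ].
  exists b. split; [ exact Hb | ]. intros Z'. apply N. apply ln_inv; auto. congruence.
Qed.

Theorem theorem4 :
  (forall (B : box) (f : R -> R),
     domain B -> smooth_nonconstant B f -> admits_proper_extension B f ->
     exists (g : equiv_transf) (h : R -> R) (D : R -> Prop) (L : list vfield),
       in_Gequiv B g /\ canonical h D L /\ maps_equation B g f h D)
  /\
  (forall (h : R -> R) (D : R -> Prop) (L : list vfield),
     canonical h D L ->
     forall B : box, domain B -> (forall x, bx B x -> D x) ->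
       finite_part_basis B h L).
Proof.
  split.
  - intros B f HB Hf HX.
    destruct (extension_ode B f HB Hf HX) as (a & b & c & d & Hab & H).
    destruct Hf as [Sf Hnc]. apply reducible_equivalence; [ exact HB | ].
    apply (ode_reducible B f a b c d); auto. now apply smooth_of_x.
  - intros h D L HC B HB HD. destruct HC as [|n Hn2 Hn0 Hn1| | |].
    + now apply finite_part_x.
    + destruct (rpow_ln_regular B n HB HD Hn0) as [Sh Hh].
      destruct (interval_ln_neq_0 B HB) as (x0 & Hx0 & Nl).
      apply (finite_part_power B (fun x => rpow (ln x) n) n x0); auto.
      apply rpow_neq_0; [ exact Nl | apply HD, Hx0 ].
    + now apply finite_part_ln.
    + apply finite_part_ln_m2; [ exact HB | ]. intros x Hx. now apply HD.
    + apply finite_part_ln_ln; [ exact HB | ]. intros x Hx. now apply HD.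
Qed.
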